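(* Let $\gamma\in\mathbb{R}$, let $S\in\mathcal{S}_\gamma$, and denote by $\Lambda$ the zero set of $S$. Then (a) $\Lambda$ is a uniqueness set for $\mathcal{F}^2_\varphi(\mathbb{C})$ if and only if $\gamma\le 1$; (b) $\Lambda$ is a weak interpolation set for $\mathcal{F}^2_\varphi(\mathbb{C})$ if and only if $\gamma>0$.
   Context: Standing assumptions: $\varphi$ is an increasing function on $[0,+\infty)$ with $\lim_{x\to\infty}\varphi(x)=\infty$; its radial extension $\varphi(z)=\varphi(|z|)$ is $C^2$ smooth and subharmonic on $\mathbb{C}$. Put $\rho(z)=(\Delta\varphi(z))^{-1/2}$ (a radial function, $\rho(z)=\rho(|z|)$). It is assumed that for every fixed $C$, $\rho(x+C\rho(x))\asymp\rho(x)$ for $0<x<\infty$. Here $A\lesssim B$ means $A\le cB$ with a constant $c$ independent of the relevant variables, and $A\asymp B$ means $A\lesssim B$ and $B\lesssim A$. The weighted Fock space $\mathcal{F}^2_\varphi(\mathbb{C})$ is the space of entire functions $f$ with $\|f\|_\varphi^2=\int_{\mathbb{C}}|f(z)|^2e^{-2\varphi(|z|)}\,dm(z)<\infty$, where $dm$ is area measure. For $z,w\in\mathbb{C}$ let $d_\rho(z,w)=\frac{|z-w|}{\min(\rho(z),\rho(w))}$. A set $\Lambda\subset\mathbb{C}$ is $d_\rho$-separated if $\inf\{d_\rho(\lambda,\lambda^* ):\lambda,\lambda^*\in\Lambda,\ \lambda\ne\lambda^*\}>0$. For $\gamma\in\mathbb{R}$, an entire function $S$ belongs to the class $\mathcal{S}_\gamma$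 if (1) the zero set $\Lambda$ of $S$ is $d_\rho$-separated, and (2) $|S(z)|\asymp e^{\varphi(z)}\frac{d(z,\Lambda)}{\rho(z)}\frac{1}{(1+|z|)^\gamma}$ for $z\in\mathbb{C}$, where $d(z,\Lambda)$ is the Euclidean distance from $z$ to $\Lambda$. A set $\Lambda\subset\mathbb{C}$ is a weak interpolation set for $\mathcal{F}^2_\varphi(\mathbb{C})$ if for every $\lambda\in\Lambda$ there exists $f_\lambda\in\mathcal{F}^2_\varphi(\mathbb{C})$ such that $f_\lambda(\lambda)=1$ and $f_\lambda$ vanishes on $\Lambda\setminus\{\lambda\}$. It is a uniqueness set for $\mathcal{F}^2_\varphi(\mathbb{C})$ if $f\in\mathcal{F}^2_\varphi(\mathbb{C})$ and $f|_\Lambda=0$ together imply $f=0$. *)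

(* Defs.v *)
(* MathComp / MathComp-Analysis *)
From HB Require Import structures.
From mathcomp Require Import all_boot all_order all_algebra.
From mathcomp Require Import all_classical all_reals all_analysis.
From mathcomp Require Export complex.
Set Implicit Arguments.
Unset Strict Implicit.
Unset Printing Implicit Defensive.
Import Order.TTheory GRing.Theory Num.Theory numFieldNormedType.Exports.
Local Open Scope classical_set_scope.
Local Open Scope ring_scope.
Local Open Scope complex_scope.

(* The real-valued modulus; the norm of [R[i]] as a numDomainType takes its
   values in [R[i]]. *)
Notation cmod := Normc.normc.

Section Plane.
Context {R : realType}.
Implicit Types (u : R[i] -> R) (f : R[i] -> R[i]) (z w : R[i]) (L : set R[i]).

(* [R[i]^o] carries the topology and the normed [R[i]]-module structure. *)
Definition entire f : Prop :=
  forall z, derivable (f : R[i]^o -> R[i]^o) z 1.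

Definition zero_set f : set R[i] := [set z | f z = 0].

(* real partial derivatives in x and y, where z = x + iy *)
Definition partial_x u z : R := derive1 (fun t : R => u (z + t%:C)) 0.
Definition partial_y u z : R := derive1 (fun t : R => u (z + t *i)) 0.

Definition C1 u : Prop :=
  [/\ forall z, derivable (fun t : R => u (z + t%:C)) 0 1,
      forall z, derivable (fun t : R => u (z + t *i)) 0 1,
      continuous (partial_x u : R[i]^o -> R) &
      continuous (partial_y u : R[i]^o -> R)].

Definition C2 u : Prop := [/\ C1 u, C1 (partial_x u) & C1 (partial_y u)].

Definition laplacian u z : R :=
  partial_x (partial_x u) z + partial_y (partial_y u) z.

(* upper semicontinuity and the sub-mean value property on all circles *)
Definition subharmonic u : Prop :=
  lower_semicontinuous ((fun z => (- u z)%:E) : R[i]^o -> \bar R) /\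
  forall z (r : R), 0 < r ->
    ((u z)%:E <= ((2 * pi)^-1)%:E *
       \int[lebesgue_measure]_(t in `[0%R, (2 * pi)%R])
          (u (z + (r * cos t) +i* (r * sin t)))%:E)%E.

(* A pitfall: [inf set0 = 0], so [dist z set0 = 0]. *)
Definition dist z L : R := inf [set cmod (z - w) | w in L].

Definition asymp_on (T : Type) (D : set T) (g h : T -> R) : Prop :=
  exists2 c : R, 0 < c & forall x, D x -> g x <= c * h x /\ h x <= c * g x.

End Plane.

Section Fock.
Context {R : realType}.
Variable phi : R -> R.
Implicit Types (f S : R[i] -> R[i]) (z w : R[i]) (L : set R[i]).

Definition radial : R[i] -> R := fun z => phi (cmod z).

Definition rho z : R := (Num.sqrt (laplacian radial z))^-1.

(* [fw_laplacian_gt0] says that [rho] takes values in ]0, +oo[. It is implied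
   by [fw_regular] when [rho] is allowed the value +oo at the zeros of the
   Laplacian, but has to be assumed here because [0^-1 = 0]. In [fw_regular],
   [rho] at a negative real is given by its radial extension. *)
Record fock_weight : Prop := FockWeight {
  fw_increasing : forall x y : R, 0 <= x -> x <= y -> phi x <= phi y;
  fw_unbounded : phi x @[x --> +oo] --> +oo;
  fw_C2 : C2 radial;
  fw_subharmonic : subharmonic radial;
  fw_laplacian_gt0 : forall z, 0 < laplacian radial z;
  fw_regular : forall C : R,
    asymp_on [set x : R | 0 < x]
      (fun x => rho (x + C * rho x%:C)%:C) (fun x => rho x%:C) }.

Definition fock f : Prop :=
  entire f /\
  (\int[lebesgue_measure \x lebesgue_measure]_(p in [set: R * R])
     (cmod (f (p.1 +i* p.2)) ^+ 2
        * expR (- 2 * phi (cmod (p.1 +i* p.2))))%:E < +oo)%E.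

Definition drho z w : R := cmod (z - w) / Num.min (rho z) (rho w).

(* The infimum is taken in [\bar R]: it is +oo if L has at most one point. *)
Definition drho_separated L : Prop :=
  (0 < ereal_inf [set e : \bar R |
         exists z w, [/\ L z, L w, z <> w & e = (drho z w)%:E]])%E.

(* A zero-free S is excluded, as it should be: the second condition would read
   |S| <= 0. *)
Definition class_S (gamma : R) S : Prop :=
  [/\ entire S,
      drho_separated (zero_set S) &
      asymp_on [set: R[i]] (fun z => cmod (S z))
        (fun z => expR (phi (cmod z)) * (dist z (zero_set S) / rho z)
                    * (1 / (1 + cmod z) `^ gamma))].

Definition weak_interpolation_set L : Prop :=
  forall l, L l -> exists f,
    [/\ fock f, f l = 1 & forall m, L m -> m <> l -> f m = 0].

Definition uniqueness_set L : Prop :=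
  forall f, fock f -> (forall l, L l -> f l = 0) -> forall z, f z = 0.

End Fock.

(* Main.v *)
Require Import Defs.
From HB Require Import structures.
From mathcomp Require Import all_boot all_order all_algebra.
From mathcomp Require Import all_classical all_reals all_analysis.
From mathcomp Require Import measurable_realfun.
From mathcomp Require Import ring lra.

(** Both equivalences come from dividing by [S] and asking when the quotient must vanish.

    The two-sided bound on [S] and the separation of its zero set [L] make every zero of [S] simple
    ([simple_zeros]). Hence an entire [f] that vanishes on [L] is f = S h with [h] entire
    ([divide_entire]), and the lower bound on [S] turns the finiteness of the norm of [f] into
      \int |h|^2 (d(z, L) / rho)^2 (1 + |z|)^(- 2 gamma) < +oo.
    The heart of the matter is the Liouville theorem [entire_L2_weight_eq0]: if this integral is finite
    with 1 in place of [gamma], then h = 0. Around each point there is a square annulus of size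
    comparable to [rho] on which d(z, L) >= k rho ([good_annulus]), and the area mean inequality
    [area_mean] bounds |h|^2 at the point by the mean over this annulus. Integrating and exchanging the
    integrals removes the factor (d / rho)^2, and the mean inequality on larger and larger annuli
    excludes nonzero values of [h].

    So [L] is a uniqueness set when gamma <= 1. If [L] is a weak interpolation set, apply the same to
    (z - l) f_l = S h: the factor z - l costs one power of 1 + |z|, which is available when gamma <= 0,
    and h = 0 contradicts f_l(l) = 1.

    Conversely, assume gamma > 0. Then d(z, L) <= A rho(z) ([dist_le_rho]). Indeed, on a zero-free
    square around [z] the function phi - log |S| minus a barrier of the form k log^2(1 + |w - z|^2 /
    rho(z)^2) is subharmonic, as the Laplacian of the barrier is less than that of [phi], which is
    rho^(-2). By the maximum principle ([max_principle]) its value at [z] is at most that at a point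
    at distance comparable to d(z, L). But phi - log |S| is, up to constants, log rho - log d(., L) +
    gamma log(1 + |.|), whose growth from [z] is at most logarithmic in |w - z| / rho(z), hence is
    exceeded by the squared logarithm unless d(z, L) / rho(z) is bounded. Therefore
    |S| <= C exp(phi) (1 + |z|)^(- gamma), and division by z - l gains one more power. When gamma > 1
    the function [S] is in the Fock space and vanishes on [L], so [L] is not a uniqueness set; when
    gamma > 0 the functions S / (z - l), normalized at [l], solve the interpolation problem.

    Two preparations enter. The regularity of [rho] is assumed for each [C] separately; Baire's theorem
    makes it uniform for small [C] ([uniform_regularity]), which gives the slow variation [rho_slow].
    The complex analysis is built from contour integrals over rectangles: Goursat's theorem, Cauchy's
    formula, the Taylor expansion of order two ([Taylor2]), and from it division by zeros as well as a
    four-point form of the harmonicity of log |S| ([four_point]), which is what the maximum principle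
    uses. *)

Set Implicit Arguments.
Unset Strict Implicit.
Unset Printing Implicit Defensive.
Import Order.TTheory GRing.Theory Num.Theory numFieldNormedType.Exports.
Local Open Scope classical_set_scope.
Local Open Scope ring_scope.
Local Open Scope complex_scope.

(** * Modulus and complex derivative *)

Notation re := (@complex.Re _).
Notation im := (@complex.Im _).
Section Cmod.
Context {R : realType}.
Implicit Types (z w : R[i]) (x y : R).

Lemma cmod_ge0 z : 0 <= cmod z.
Proof. by case: z => a b; rewrite /= sqrtr_ge0. Qed.

Lemma cmodE z : (cmod z)%:C = `|z|.
Proof. by rewrite normc_def; case: z. Qed.

Lemma cmodM z w : cmod (z * w) = cmod z * cmod w.
Proof. exact: Normc.normcM. Qed.

Lemma cmodV z : cmod z^-1 = (cmod z)^-1.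
Proof. exact: Normc.normcV. Qed.

Lemma cmodD z w : cmod (z + w) <= cmod z + cmod w.
Proof. exact: le_normcD. Qed.

Lemma cmodN z : cmod (- z) = cmod z.
Proof. exact: normcN. Qed.

Lemma cmodC z w : cmod (z - w) = cmod (w - z).
Proof. by rewrite -opprB cmodN. Qed.

Lemma cmodX z n : cmod (z ^+ n) = cmod z ^+ n.
Proof.
elim: n => [|n IH]; first by rewrite !expr0 Normc.normc1.
by rewrite !exprS cmodM IH.
Qed.

Lemma cmod0 : cmod (0 : R[i]) = 0.
Proof. exact: Normc.normc0. Qed.

Lemma cmod1 : cmod (1 : R[i]) = 1.
Proof. exact: Normc.normc1. Qed.

Lemma cmod_eq0 z : (cmod z == 0) = (z == 0).
Proof.
apply/eqP/eqP => [/Normc.eq0_normc//|->]; exact: cmod0.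
Qed.

Lemma cmod_gt0 z : (0 < cmod z) = (z != 0).
Proof. by rewrite lt_neqAle cmod_ge0 andbT eq_sym cmod_eq0. Qed.

Lemma cmod_distD z w v : cmod (z - v) <= cmod (z - w) + cmod (w - v).
Proof. by have := cmodD (z - w) (w - v); rewrite addrA subrK. Qed.

Lemma cmod_lerB z w : cmod z - cmod w <= cmod (z - w).
Proof. by have := cmodD (z - w) w; rewrite subrK lerBlDr. Qed.

Lemma cmod_dist_dist z w : `|cmod z - cmod w| <= cmod (z - w).
Proof.
rewrite ler_norml cmod_lerB andbT lerNl opprB cmodC; exact: cmod_lerB.
Qed.

Lemma cmod_real x : cmod x%:C = `|x|.
Proof. by rewrite /= expr0n addr0 sqrtr_sqr. Qed.

Lemma cmod_imag x : cmod (x *i) = `|x|.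
Proof. by rewrite /= expr0n add0r sqrtr_sqr. Qed.

Lemma sqr_cmod z : cmod z ^+ 2 = re z ^+ 2 + im z ^+ 2.
Proof. by case: z => a b /=; rewrite sqr_sqrtr// addr_ge0// sqr_ge0. Qed.

Lemma re_le_cmod z : `|re z| <= cmod z.
Proof.
by rewrite -(@ler_pXn2r _ 2)// ?nnegrE ?cmod_ge0// sqr_cmod real_normK ?num_real// lerDl sqr_ge0.
Qed.

Lemma im_le_cmod z : `|im z| <= cmod z.
Proof.
by rewrite -(@ler_pXn2r _ 2)// ?nnegrE ?cmod_ge0// sqr_cmod real_normK ?num_real// lerDr sqr_ge0.
Qed.

Lemma cmod_le_ReIm z : cmod z <= `|re z| + `|im z|.
Proof.
have -> : z = (re z)%:C + (im z) *i by case: z => a b; simpc.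
by rewrite (le_trans (cmodD _ _))// cmod_real cmod_imag; simpc.
Qed.

Lemma reD z w : re (z + w) = re z + re w. Proof. by case: z w => [? ?] [? ?]. Qed.
Lemma imD z w : im (z + w) = im z + im w. Proof. by case: z w => [? ?] [? ?]. Qed.
Lemma reN z : re (- z) = - re z. Proof. by case: z. Qed.
Lemma imN z : im (- z) = - im z. Proof. by case: z. Qed.
Lemma reM z w : re (z * w) = re z * re w - im z * im w.
Proof. by case: z w => [? ?] [? ?]. Qed.
Lemma imM z w : im (z * w) = re z * im w + im z * re w.
Proof. by case: z w => [? ?] [? ?]. Qed.
Lemma complexP z w : re z = re w -> im z = im w -> z = w.
Proof. by case: z w => [? ?] [? ?] /= -> ->. Qed.

End Cmod.

Section Cderiv.
Context {R : realType}.
Implicit Types (f g : R[i] -> R[i]) (z w l : R[i]).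

(** Differentiability in real epsilon-delta form: the canonical metric of [R[i]] takes its values in
    [R[i]], while all the estimates below are between real numbers. *)
Definition cderiv f z l := forall e : R, 0 < e -> exists2 d : R, 0 < d &
  forall w, cmod (w - z) < d -> cmod (f w - f z - l * (w - z)) <= e * cmod (w - z).

Definition ccont f z := forall e : R, 0 < e -> exists2 d : R, 0 < d &
  forall w, cmod (w - z) < d -> cmod (f w - f z) <= e.

Lemma ltcR_pos (e : R[i]) : 0 < e -> exists2 e' : R, 0 < e' & e = e'%:C.
Proof. by case: e => a b; rewrite ltcE /= => /andP[/eqP -> a0]; exists a. Qed.

Lemma nbhs_cP (z : R[i]^o) (P : set R[i]) : nbhs z P <-> exists2 d : R, 0 < d & forall w : R[i], cmod (w - z) < d -> P w.
Proof.
split.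
- move=> /nbhs_ballP[e /= /ltcR_pos [d d0 ->]] H; exists d => // w wd; apply: H.
  rewrite -ball_normE /= -normrN opprB -cmodE ltcR//.
- move=> [d d0 H]; apply/nbhs_ballP; exists (d%:C) => /=; first by rewrite ltcR.
  move=> w; rewrite -ball_normE /= -normrN opprB -cmodE ltcR; exact: H.
Qed.

Lemma derivableP_cderiv f z :
  derivable (f : R[i]^o -> R[i]^o) z 1 <-> exists l, cderiv f z l.
Proof.
split=> [H|[l Hl]].
- have /cvg_ex[l /cvgrPdist_le /= Hl] := H.
  exists l => e e0.
  have ec0 : 0 < e%:C :> R[i] by rewrite ltcR.
  have := Hl _ ec0; rewrite /prop_near1 /= nbhs_simpl => /nbhs_cP [d d0 Hd].
  exists d => // w wd.
  have [->|wz] := eqVneq w z; first by rewrite !subrr mulr0 subr0 cmod0 mulr0.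
  have := Hd (w - z); rewrite subr0 => /(_ wd); rewrite subr_eq0 => /(_ wz).
  rewrite -cmodE lecR [(w - z)%:A]mulr1 subrK /GRing.scale /= => Hw.
  have wz0 : w - z != 0 by rewrite subr_eq0.
  have -> : f w - f z - l * (w - z) = - ((l - (w - z)^-1 * (f w - f z)) * (w - z)).
    by rewrite mulrBl mulrAC mulVf// mul1r opprB.
  by rewrite cmodN cmodM ler_wpM2r// cmod_ge0.
- apply/cvg_ex; exists l; apply/cvgrPdist_le => e /ltcR_pos [e' e0 ->].
  have [d d0 Hd] := Hl _ e0.
  rewrite /prop_near1 /=; apply/nbhs_cP; exists d => // h hd /= h0.
  have := Hd (h + z); rewrite addrK subr0 in hd *; move=> /(_ hd) Hw.
  rewrite -cmodE lecR [h%:A]mulr1 /GRing.scale /=.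
  have -> : l - h^-1 * (f (h + z) - f z) = - h^-1 * (f (h + z) - f z - l * h).
    by field.
  rewrite cmodM cmodN cmodV ler_pdivrMl// ?cmod_gt0//.
  by rewrite [leRHS]mulrC.
Qed.

End Cderiv.

(** * Integrals of complex functions over segments *)

Section LineIntegral.
Context {R : realType}.
Local Notation mu := (@lebesgue_measure R).
Implicit Types (g : R -> R[i]) (a b c x y : R).

(** Two-sided continuity at every point of the segment, endpoints included: the integrands below are
    restrictions of functions that are continuous beyond the segment. *)
Definition lcont a b g := forall x, a <= x <= b -> forall e : R, 0 < e ->
  exists2 d : R, 0 < d & forall y, `|y - x| < d -> cmod (g y - g x) <= e.

Definition cint a b g : R[i] :=
  (\int[mu]_(x in `[a, b]) re (g x)) +i* (\int[mu]_(x in `[a, b]) im (g x)).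

Lemma lcont_comp a b (u : R[i] -> R) g : (forall z w, `|u z - u w| <= cmod (z - w)) ->
  lcont a b g -> {within `[a, b], continuous (fun x => u (g x))}.
Proof.
move=> Hu H; apply: continuous_in_subspaceT => x; rewrite inE /= in_itv /= => xab.
apply/cvgrPdist_le => e e0; have [d d0 Hd] := H _ xab _ e0.
apply/nbhs_ballP; exists d => //= y yd; rewrite distrC.
by apply: (le_trans (Hu _ _)); apply: Hd; rewrite distrC.
Qed.

Lemma lcont_re a b g : lcont a b g -> {within `[a, b], continuous (fun x => re (g x))}.
Proof. by apply: lcont_comp => z w; rewrite -reN -reD; exact: re_le_cmod. Qed.

Lemma lcont_im a b g : lcont a b g -> {within `[a, b], continuous (fun x => im (g x))}.
Proof. by apply: lcont_comp => z w; rewrite -imN -imD; exact: im_le_cmod. Qed.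

Lemma within_integrable a b (u : R -> R) : {within `[a, b], continuous u} ->
  mu.-integrable `[a, b] (EFin \o u).
Proof. by move=> H; apply: continuous_compact_integrable => //; exact: segment_compact. Qed.

Lemma lcont_ire a b g : lcont a b g -> mu.-integrable `[a, b] (EFin \o (fun x => re (g x))).
Proof. by move=> /lcont_re/within_integrable. Qed.
Lemma lcont_iim a b g : lcont a b g -> mu.-integrable `[a, b] (EFin \o (fun x => im (g x))).
Proof. by move=> /lcont_im/within_integrable. Qed.

Lemma eq_cint a b g1 g2 : (forall x, a <= x <= b -> g1 x = g2 x) -> cint a b g1 = cint a b g2.
Proof.
move=> H; congr Complex; apply: eq_Rintegral => x; rewrite inE /= in_itv /= => xab;
  by rewrite H.
Qed.

Lemma cintD a b g1 g2 : lcont a b g1 -> lcont a b g2 ->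
  cint a b (fun x => g1 x + g2 x) = cint a b g1 + cint a b g2.
Proof.
move=> H1 H2; apply: complexP; rewrite ?reD ?imD /= -RintegralD//; try
  exact: lcont_ire; try exact: lcont_iim.
  by apply: eq_Rintegral => x _; rewrite reD.
by apply: eq_Rintegral => x _; rewrite imD.
Qed.

Lemma integrableZl_R a b (k : R) (u : R -> R) : mu.-integrable `[a, b] (EFin \o u) ->
  mu.-integrable `[a, b] (EFin \o (fun x => k * u x)).
Proof.
move=> H.
by have := @integrableZl _ _ _ mu `[a,b] (measurable_itv _) k _ H.
Qed.

Lemma cintZ a b (k : R[i]) g : lcont a b g ->
  cint a b (fun x => k * g x) = k * cint a b g.
Proof.
move=> H; have H1 := lcont_ire H; have H2 := lcont_iim H.
have -> : k * cint a b g =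
  (re k * (\int[mu]_(x in `[a, b]) re (g x)) - im k * (\int[mu]_(x in `[a, b]) im (g x)))
  +i* (re k * (\int[mu]_(x in `[a, b]) im (g x)) + im k * (\int[mu]_(x in `[a, b]) re (g x))).
  by case: k.
rewrite -!RintegralZl// -RintegralB//; try exact: integrableZl_R.
rewrite -RintegralD//; try exact: integrableZl_R.
congr Complex; apply: eq_Rintegral => x _; first by rewrite reM.
by rewrite imM.
Qed.

Lemma lcontZ a b (k : R[i]) g : lcont a b g -> lcont a b (fun x => k * g x).
Proof.
move=> H x xab e e0.
have k0 := cmod_ge0 k.
have e2 : 0 < e / (cmod k + 1) by rewrite divr_gt0//; lra.
have [d d0 Hd] := H _ xab _ e2; exists d => // y /Hd h.
rewrite -mulrBr cmodM (le_trans (ler_wpM2l k0 h))//.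
by rewrite mulrCA ler_piMr ?(ltW e0)// ler_pdivrMr; lra.
Qed.

Lemma cintB a b g1 g2 : lcont a b g1 -> lcont a b g2 ->
  cint a b (fun x => g1 x - g2 x) = cint a b g1 - cint a b g2.
Proof.
move=> H1 H2; have -> : - cint a b g2 = cint a b (fun x => -1 * g2 x).
  by rewrite cintZ// mulN1r.
rewrite -cintD//; last exact: lcontZ.
by apply: eq_cint => x _; rewrite mulN1r.
Qed.

Lemma cint_cst a b (k : R[i]) : a <= b -> cint a b (fun=> k) = (b - a)%:C * k.
Proof.
move=> ab; have E r : \int[mu]_(x in `[a, b]) r = (b - a) * r.
  by rewrite Rintegral_cst//= lebesgue_measure_itv /= lte_fin; case: ltgtP ab => // ab _;
    rewrite /= mulrC // ab subrr.
by apply: complexP; rewrite ?reM ?imM /= !E mul0r ?subr0 ?addr0.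
Qed.

Lemma cint_split a b c g : a <= c -> c <= b -> lcont a b g ->
  cint a b g = cint a c g + cint c b g.
Proof.
move=> ac cb H; have H1 := lcont_ire H; have H2 := lcont_iim H.
have E (u : R -> R) : mu.-integrable `[a, b] (EFin \o u) ->
  \int[mu]_(x in `[a, b]) u x = \int[mu]_(x in `[a, c]) u x + \int[mu]_(x in `[c, b]) u x.
  move=> Hu; have := @Rintegral_itvB _ u (BLeft a) (BRight b) c Hu.
  rewrite !bnd_simp => /(_ ac cb).
  rewrite Rintegral_itv_obnd_cbnd; last first.
    by apply: integrableS Hu => //; apply: subset_itvr; rewrite bnd_simp.
  by move=> <-; rewrite addrC subrK.
by apply: complexP; rewrite ?reD ?imD /= -E.
Qed.

(** The factor 2 comes from bounding the real and the imaginary part separately. *)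
Lemma cmod_cint a b g (M : R) : a <= b -> lcont a b g ->
  (forall x, a <= x <= b -> cmod (g x) <= M) -> cmod (cint a b g) <= 2 * M * (b - a).
Proof.
move=> ab H HM.
have E (u : R -> R) : mu.-integrable `[a, b] (EFin \o u) -> (forall x, a <= x <= b -> `|u x| <= M) ->
    `|\int[mu]_(x in `[a, b]) u x| <= M * (b - a).
  move=> iu uM; apply: (le_trans (le_normr_Rintegral _ iu)) => //.
  have -> : M * (b - a) = \int[mu]_(x in `[a, b]) M.
    rewrite Rintegral_cst//= lebesgue_measure_itv /= lte_fin; case: ltgtP ab => // ab _.
    by rewrite ab subrr.
  apply: le_Rintegral => //.
  - exact: integrable_norm iu.
  - by apply: within_integrable; apply: continuous_subspaceT => x; exact: cvg_cst.
have h1 := E _ (lcont_ire H) (fun x xab => le_trans (re_le_cmod _) (HM x xab)).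
have h2 := E _ (lcont_iim H) (fun x xab => le_trans (im_le_cmod _) (HM x xab)).
have /= := cmod_le_ReIm (cint a b g); move: h1 h2; clear.
set A := `|_|; set B := `|_|; set D := Num.sqrt _; lra.
Qed.

End LineIntegral.

(** * Bisection of rectangles *)

Section Bisection.
Context {R : realType}.

Lemma nested_intervals (a b : nat -> R) :
  (forall n, a n <= a n.+1) -> (forall n, b n.+1 <= b n) -> (forall n, a n <= b n) ->
  exists p, forall n, a n <= p <= b n.
Proof.
move=> ha hb hab.
have /nondecreasing_seqP am := ha; have /nonincreasing_seqP bm := hb.
have abmn m n : a m <= b n.
  have [mn|nm] := leqP m n; first exact: le_trans (am _ _ mn) (hab n).
  exact: le_trans (hab m) (bm _ _ (ltnW nm)).
have ub n : ubound (range a) (b n) by move=> _ [m _ <-].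
exists (sup (range a)) => n; apply/andP; split.
- apply: ub_le_sup; last by exists n.
  by exists (b 0%N); exact: ub.
- by apply: ge_sup; [exists (a 0%N), 0%N|exact: ub].
Qed.

Lemma pow2_small (x d : R) : 0 < d -> exists n, x / 2 ^+ n < d.
Proof.
move=> d0; have [x0|x0] := leP x 0.
  by exists 0%N; rewrite expr0 divr1 (le_lt_trans x0).
exists (Num.bound (x / d)).
rewrite ltr_pdivrMr ?exprn_gt0// mulrC -ltr_pdivrMr//.
apply: lt_le_trans (archi_boundP (divr_ge0 (ltW x0) (ltW d0))) _.
by rewrite -natrX ler_nat ltnW// ltn_expl.
Qed.

Definition is_quarter (q q' : R * R * (R * R)) :=
  let: ((a, b), (c, d)) := q in let: ((a', b'), (c', d')) := q' in
  [/\ a <= a' /\ b' <= b, c <= c' /\ d' <= d, b' - a' = (b - a) / 2 & d' - c' = (d - c) / 2].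

(** If the property failed, it would fail on one quarter of the rectangle, then on a quarter of that
    quarter, and so on; the nested quarters shrink to a point, near which the property holds. *)
Lemma bisection (P : R -> R -> R -> R -> Prop) (a b c d : R) :
  a <= b -> c <= d ->
  (forall a b c d, a <= b -> c <= d ->
     P a ((a + b) / 2) c ((c + d) / 2) -> P ((a + b) / 2) b c ((c + d) / 2) ->
     P a ((a + b) / 2) ((c + d) / 2) d -> P ((a + b) / 2) b ((c + d) / 2) d -> P a b c d) ->
  (forall x y, a <= x <= b -> c <= y <= d -> exists2 e : R, 0 < e &
     forall a' b' c' d', a <= a' <= x -> x <= b' <= b -> c <= c' <= y -> y <= d' <= d ->
       (b' - a') + (d' - c') < e -> P a' b' c' d') ->
  P a b c d.
Proof.
move=> ab cd Hadd Hloc; apply: contrapT => nP.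
pose Q (q : R * R * (R * R)) := P q.1.1 q.1.2 q.2.1 q.2.2.
pose ok (q : R * R * (R * R)) := [/\ q.1.1 <= q.1.2, q.2.1 <= q.2.2 & ~ Q q].
have /choice[f Hf] : forall q, exists q', ok q -> ok q' /\ is_quarter q q'.
  move=> [[a1 b1] [c1 d1]]; have [|] := pselect (ok ((a1, b1), (c1, d1))); last first.
    by move=> h; exists ((a1, b1), (c1, d1)).
  move=> [/= ab1 cd1 nQ].
  have [h1|h1] := pselect (P a1 ((a1 + b1) / 2) c1 ((c1 + d1) / 2)); last first.
    exists ((a1, (a1 + b1) / 2), (c1, (c1 + d1) / 2)) => _.
    by split; split => //=; try split; lra.
  have [h2|h2] := pselect (P ((a1 + b1) / 2) b1 c1 ((c1 + d1) / 2)); last first.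
    exists (((a1 + b1) / 2, b1), (c1, (c1 + d1) / 2)) => _.
    by split; split => //=; try split; lra.
  have [h3|h3] := pselect (P a1 ((a1 + b1) / 2) ((c1 + d1) / 2) d1); last first.
    exists ((a1, (a1 + b1) / 2), ((c1 + d1) / 2, d1)) => _.
    by split; split => //=; try split; lra.
  have [h4|h4] := pselect (P ((a1 + b1) / 2) b1 ((c1 + d1) / 2) d1); last first.
    exists (((a1 + b1) / 2, b1), ((c1 + d1) / 2, d1)) => _.
    by split; split => //=; try split; lra.
  by case: nQ; exact: Hadd.
pose s n := iter n f ((a, b), (c, d)).
have oks n : ok (s n).
  by elim: n => [|n IH]; [split | case: (Hf _ IH)].
have qs n : is_quarter (s n) (s n.+1) by case: (Hf _ (oks n)).
have nest1 n : (s n).1.1 <= (s n.+1).1.1 /\ (s n.+1).1.2 <= (s n).1.2.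
  by have := qs n; case: (s n) => [[? ?] [? ?]]; case: (s n.+1) => [[? ?] [? ?]] /= [].
have nest2 n : (s n).2.1 <= (s n.+1).2.1 /\ (s n.+1).2.2 <= (s n).2.2.
  by have := qs n; case: (s n) => [[? ?] [? ?]]; case: (s n.+1) => [[? ?] [? ?]] /= [].
have size n : ((s n).1.2 - (s n).1.1) + ((s n).2.2 - (s n).2.1) = ((b - a) + (d - c)) / 2 ^+ n.
  elim: n => [|n IH]; first by rewrite expr0 divr1.
  rewrite exprS invfM mulrCA -IH; have := qs n.
  by case: (s n) => [[? ?] [? ?]]; case: (s n.+1) => [[? ?] [? ?]] /= []; lra.
have [x Hx] := nested_intervals (fun n => (nest1 n).1) (fun n => (nest1 n).2)
  (fun n => let: And3 h _ _ := oks n in h).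
have [y Hy] := nested_intervals (fun n => (nest2 n).1) (fun n => (nest2 n).2)
  (fun n => let: And3 _ h _ := oks n in h).
have [e e0 He] := Hloc x y (Hx 0%N) (Hy 0%N).
have [n Hn] := pow2_small ((b - a) + (d - c)) e0.
have in1 m : a <= (s m).1.1 /\ (s m).1.2 <= b.
  elim: m => [//|m [h1 h2]]; have [h3 h4] := nest1 m.
  by split; [exact: le_trans h3 | exact: le_trans h4 h2].
have in2 m : c <= (s m).2.1 /\ (s m).2.2 <= d.
  elim: m => [//|m [h1 h2]]; have [h3 h4] := nest2 m.
  by split; [exact: le_trans h3 | exact: le_trans h4 h2].
have [_ _] := oks n; apply; apply: He.
- by rewrite (in1 n).1; case/andP: (Hx n).
- by rewrite (in1 n).2 andbT; case/andP: (Hx n).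
- by rewrite (in2 n).1; case/andP: (Hy n).
- by rewrite (in2 n).2 andbT; case/andP: (Hy n).
- by rewrite size.
Qed.

End Bisection.

(** * Goursat's theorem on rectangles *)

Section Goursat.
Context {R : realType}.
Implicit Types (F G : R[i] -> R[i]) (a b c d x y : R).

Definition imag_unit : R[i] := 0 +i* 1.

(** The counterclockwise contour integral over the boundary of [a, b] x [c, d]. *)
Definition rectI F a b c d : R[i] :=
  cint a b (fun x => F (x +i* c)) + imag_unit * cint c d (fun y => F (b +i* y))
  - cint a b (fun x => F (x +i* d)) - imag_unit * cint c d (fun y => F (a +i* y)).

Definition rcont F a b c d := forall x y, a <= x <= b -> c <= y <= d -> ccont F (x +i* y).
Definition rderiv F a b c d := forall x y, a <= x <= b -> c <= y <= d ->
  exists l, cderiv F (x +i* y) l.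

Lemma cmod_imag_unit : cmod imag_unit = 1.
Proof. by rewrite /imag_unit cmod_imag normr1. Qed.

Lemma cmod_hor x1 x2 y : cmod ((x1 +i* y) - (x2 +i* y)) = `|x1 - x2|.
Proof. by rewrite -cmod_real; congr cmod; apply: complexP => /=; ring. Qed.

Lemma cmod_ver x y1 y2 : cmod ((x +i* y1) - (x +i* y2)) = `|y1 - y2|.
Proof. by rewrite -cmod_imag; congr cmod; apply: complexP => /=; ring. Qed.

Lemma cderiv_cont F z l : cderiv F z l -> ccont F z.
Proof.
move=> H e e0; have [d d0 Hd] := H 1 ltr01.
have l0 := cmod_ge0 l.
exists (Num.min d (e / (1 + cmod l))); first by rewrite lt_min d0 divr_gt0//; lra.
move=> w; rewrite lt_min => /andP[/Hd h1 h2].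
have -> : F w - F z = (F w - F z - l * (w - z)) + l * (w - z) by ring.
apply: (le_trans (cmodD _ _)); rewrite cmodM.
have := cmod_ge0 (w - z); move: h2; rewrite ltr_pdivlMr; last lra.
move: h1; set A := cmod (_ - l * _); set B := cmod (w - z); nra.
Qed.

Lemma rderiv_cont F a b c d : rderiv F a b c d -> rcont F a b c d.
Proof. by move=> H x y hx hy; have [l /cderiv_cont] := H _ _ hx hy. Qed.

Lemma rcontS F a b c d a' b' c' d' : a <= a' -> b' <= b -> c <= c' -> d' <= d ->
  rcont F a b c d -> rcont F a' b' c' d'.
Proof.
by move=> h1 h2 h3 h4 H x y /andP[h5 h6] /andP[h7 h8]; apply: H; apply/andP; split; lra.
Qed.

(** Continuity at the boundary points only, so that a pole may lie inside the rectangle. *)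
Definition bcont F a b c d := forall x y, a <= x <= b -> c <= y <= d ->
  (x == a) || (x == b) || (y == c) || (y == d) -> ccont F (x +i* y).

Lemma rcont_bcont F a b c d : rcont F a b c d -> bcont F a b c d.
Proof. by move=> H x y hx hy _; exact: H. Qed.

Lemma bcont_hor F a b c d y : c <= d -> bcont F a b c d -> (y == c) || (y == d) ->
  lcont a b (fun x => F (x +i* y)).
Proof.
move=> cd H hy x hx e e0; have hy' : c <= y <= d by case/orP: hy => /eqP ->; rewrite lexx ?cd.
have hb : (x == a) || (x == b) || (y == c) || (y == d) by case/orP: hy => ->; rewrite ?orbT.
have [r r0 Hr] := H _ _ hx hy' hb _ e0.
by exists r => // x' h; apply: Hr; rewrite cmod_hor.
Qed.

Lemma bcont_ver F a b c d x : a <= b -> bcont F a b c d -> (x == a) || (x == b) ->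
  lcont c d (fun y => F (x +i* y)).
Proof.
move=> ab H hx y hy e e0; have hx' : a <= x <= b by case/orP: hx => /eqP ->; rewrite lexx ?ab.
have hb : (x == a) || (x == b) || (y == c) || (y == d) by rewrite hx.
have [r r0 Hr] := H _ _ hx' hy hb _ e0.
by exists r => // y' h; apply: Hr; rewrite cmod_ver.
Qed.

Lemma bcont_bottom F a b c d : c <= d -> bcont F a b c d -> lcont a b (fun x => F (x +i* c)).
Proof. by move=> cd H; apply: (bcont_hor cd H); rewrite eqxx. Qed.
Lemma bcont_top F a b c d : c <= d -> bcont F a b c d -> lcont a b (fun x => F (x +i* d)).
Proof. by move=> cd H; apply: (bcont_hor cd H); rewrite eqxx orbT. Qed.
Lemma bcont_left F a b c d : a <= b -> bcont F a b c d -> lcont c d (fun y => F (a +i* y)).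
Proof. by move=> ab H; apply: (bcont_ver ab H); rewrite eqxx. Qed.
Lemma bcont_right F a b c d : a <= b -> bcont F a b c d -> lcont c d (fun y => F (b +i* y)).
Proof. by move=> ab H; apply: (bcont_ver ab H); rewrite eqxx orbT. Qed.

Lemma rectI_splitx F a b c d m : a <= m <= b -> c <= d -> bcont F a b c d ->
  rectI F a b c d = rectI F a m c d + rectI F m b c d.
Proof.
move=> /andP[am mb] cd H; rewrite /rectI.
rewrite (cint_split am mb (bcont_bottom cd H)).
rewrite (cint_split am mb (bcont_top cd H)).
by ring.
Qed.

Lemma rectI_splity F a b c d m : a <= b -> c <= m <= d -> bcont F a b c d ->
  rectI F a b c d = rectI F a b c m + rectI F a b m d.
Proof.
move=> ab /andP[cm md] H; rewrite /rectI.
rewrite (cint_split cm md (bcont_left ab H)).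
rewrite (cint_split cm md (bcont_right ab H)).
by ring.
Qed.

Lemma eq_rectI F G a b c d : a <= b -> c <= d ->
  (forall x y, a <= x <= b -> c <= y <= d -> (x == a) || (x == b) || (y == c) || (y == d) ->
     F (x +i* y) = G (x +i* y)) ->
  rectI F a b c d = rectI G a b c d.
Proof.
move=> ab cd H; rewrite /rectI.
congr (_ + _ * _ - _ - _ * _); apply: eq_cint => t ht; apply: H => //;
  rewrite ?lexx ?ab ?cd// ?eqxx ?orbT//.
Qed.

Lemma rectID F G a b c d : a <= b -> c <= d -> bcont F a b c d -> bcont G a b c d ->
  rectI (fun w => F w + G w) a b c d = rectI F a b c d + rectI G a b c d.
Proof.
move=> ab cd HF HG; rewrite /rectI.
rewrite (cintD (bcont_bottom cd HF) (bcont_bottom cd HG)) (cintD (bcont_top cd HF) (bcont_top cd HG)).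
rewrite (cintD (bcont_left ab HF) (bcont_left ab HG)) (cintD (bcont_right ab HF) (bcont_right ab HG)).
by ring.
Qed.

Lemma rectIZ F k a b c d : a <= b -> c <= d -> bcont F a b c d ->
  rectI (fun w => k * F w) a b c d = k * rectI F a b c d.
Proof.
move=> ab cd HF; rewrite /rectI.
rewrite (cintZ _ (bcont_bottom cd HF)) (cintZ _ (bcont_top cd HF)).
rewrite (cintZ _ (bcont_left ab HF)) (cintZ _ (bcont_right ab HF)).
by ring.
Qed.

Lemma ccont_id (z : R[i]) : ccont (fun w => w) z.
Proof. by move=> e e0; exists e => // w /ltW. Qed.

Lemma ccont_cst (k z : R[i]) : ccont (fun=> k) z.
Proof. by move=> e e0; exists 1 => // w _; rewrite subrr cmod0 ltW. Qed.

Lemma ccontD F G z : ccont F z -> ccont G z -> ccont (fun w => F w + G w) z.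
Proof.
move=> H1 H2 e e0; have e2 : 0 < e / 2 by lra.
have [d1 d10 Hd1] := H1 _ e2; have [d2 d20 Hd2] := H2 _ e2.
exists (Num.min d1 d2); first by rewrite lt_min d10.
move=> y; rewrite lt_min => /andP[/Hd1 h1 /Hd2 h2].
have -> : F y + G y - (F z + G z) = (F y - F z) + (G y - G z) by ring.
by rewrite (le_trans (cmodD _ _))//; lra.
Qed.

Lemma ccontM F G z : ccont F z -> ccont G z -> ccont (fun w => F w * G w) z.
Proof.
move=> H1 H2 e e0.
set A := cmod (F z); set B := cmod (G z).
have A0 : 0 <= A := cmod_ge0 _; have B0 : 0 <= B := cmod_ge0 _.
have e2 : 0 < Num.min 1 (e / (A + B + 1)).
  by rewrite lt_min ltr01 divr_gt0//; lra.
have [d1 d10 Hd1] := H1 _ e2; have [d2 d20 Hd2] := H2 _ e2.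
exists (Num.min d1 d2); first by rewrite lt_min d10.
move=> w; rewrite lt_min => /andP[/Hd1 h1 /Hd2 h2].
have -> : F w * G w - F z * G z = (F w - F z) * (G w - G z) + (F w - F z) * G z + F z * (G w - G z).
  by ring.
apply: (le_trans (cmodD _ _)); apply: (le_trans (lerD (cmodD _ _) (lexx _))).
rewrite !cmodM -/A -/B; move: h1 h2.
have := cmod_ge0 (F w - F z); have := cmod_ge0 (G w - G z).
set u := cmod (F w - F z); set v := cmod (G w - G z) => v0 u0.
rewrite !le_min !ler_pdivlMr; try lra.
move=> /andP[u1 ue] /andP[v1 ve].
have uv : u * v <= u by rewrite ler_piMr.
have [|] := lerP u v => huv; nra.
Qed.

Lemma ccontN F z : ccont F z -> ccont (fun w => - F w) z.
Proof. by move=> H e e0; have [d d0 Hd] := H _ e0; exists d => // w /Hd; rewrite -opprD cmodN. Qed.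

Lemma rectI_cst k a b c d : a <= b -> c <= d -> rectI (fun=> k) a b c d = 0.
Proof. by move=> ab cd; rewrite /rectI !cint_cst//; ring. Qed.

Lemma rectI_id a b c d : a <= b -> c <= d -> rectI id a b c d = 0.
Proof.
move=> ab cd; rewrite /rectI.
have idc : bcont id a b c d by move=> *; exact: ccont_id.
have E A B C D : A + imag_unit * B - C - imag_unit * D = (A - C) + imag_unit * (B - D) by ring.
rewrite E -(cintB (bcont_bottom cd idc) (bcont_top cd idc)) -(cintB (bcont_right ab idc) (bcont_left ab idc)).
rewrite (@eq_cint _ _ _ _ (fun=> (c - d) *i)); last by move=> x _; apply: complexP => /=; ring.
rewrite (@eq_cint _ c d _ (fun=> (b - a)%:C)); last by move=> x _; apply: complexP => /=; ring.
rewrite !cint_cst//; rewrite /imag_unit; simpc; congr Complex; ring.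
Qed.

Lemma cmod_rectI F a b c d M : a <= b -> c <= d -> bcont F a b c d ->
  (forall x y, a <= x <= b -> c <= y <= d -> (x == a) || (x == b) || (y == c) || (y == d) ->
     cmod (F (x +i* y)) <= M) ->
  cmod (rectI F a b c d) <= 4 * M * ((b - a) + (d - c)).
Proof.
move=> ab cd H HM; rewrite /rectI.
have lc : c <= c <= d by rewrite lexx.
have ld : c <= d <= d by rewrite lexx andbT.
have la : a <= a <= b by rewrite lexx.
have lb : a <= b <= b by rewrite lexx andbT.
have h1 := cmod_cint ab (bcont_bottom cd H) (fun x hx => HM _ _ hx lc (ltac:(by rewrite eqxx ?orbT))).
have h2 := cmod_cint ab (bcont_top cd H) (fun x hx => HM _ _ hx ld (ltac:(by rewrite eqxx ?orbT))).
have h3 := cmod_cint cd (bcont_left ab H) (fun x hx => HM _ _ la hx (ltac:(by rewrite eqxx ?orbT))).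
have h4 := cmod_cint cd (bcont_right ab H) (fun x hx => HM _ _ lb hx (ltac:(by rewrite eqxx ?orbT))).
set A := cint _ _ _ in h1 *; set B := cint _ _ _ in h4 *.
set C := cint _ _ _ in h2 *; set D := cint _ _ _ in h3 *.
have k1 := cmodD (A + imag_unit * B - C) (- (imag_unit * D)).
have k2 := cmodD (A + imag_unit * B) (- C).
have k3 := cmodD A (imag_unit * B).
rewrite ?cmodN ?cmodM ?cmod_imag_unit ?mul1r in k1 k2 k3.
clear - h1 h2 h3 h4 k1 k2 k3; lra.
Qed.

(** The bound [eta * s ^+ 2], with [s] the half-perimeter, is additive under quartering, so
    that bisection applies; on small rectangles around a point of differentiability it holds because
    affine functions integrate to zero. *)
Lemma Goursat F a b c d : a <= b -> c <= d -> rderiv F a b c d -> rectI F a b c d = 0.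
Proof.
move=> ab cd HF; apply: Normc.eq0_normc; apply/eqP; rewrite eq_le cmod_ge0 andbT.
set s := (b - a) + (d - c).
suff main eta : 0 < eta -> cmod (rectI F a b c d) <= eta * s ^+ 2.
  apply/ler_addgt0Pr => e e0; rewrite add0r.
  have s0 : 0 <= s by rewrite /s; lra.
  have h : 0 < e / (s ^+ 2 + 1) by rewrite divr_gt0// ltr_wpDl ?sqr_ge0.
  apply: (le_trans (main _ h)).
  by rewrite mulrAC ler_pdivrMr ?ltr_wpDl ?sqr_ge0// mulrDr mulr1 lerDl ltW.
move=> eta0.
pose P a' b' c' d' := a <= a' -> b' <= b -> c <= c' -> d' <= d ->
  cmod (rectI F a' b' c' d') <= eta * ((b' - a') + (d' - c')) ^+ 2.
suff : P a b c d by apply.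
apply: bisection => //.
- move=> a' b' c' d' ab' cd' h1 h2 h3 h4 k1 k2 k3 k4.
  have HFc := rcontS k1 k2 k3 k4 (rderiv_cont HF).
  have m1 : a' <= (a' + b') / 2 <= b' by lra.
  have m2 : c' <= (c' + d') / 2 <= d' by lra.
  rewrite (rectI_splity ab' m2); last exact: rcont_bcont.
  rewrite (rectI_splitx m1); [|lra|by apply: rcont_bcont; apply: rcontS HFc; lra].
  rewrite (rectI_splitx (c := (c' + d') / 2) m1); [|lra|by apply: rcont_bcont; apply: rcontS HFc; lra].
  have := h1 (ltac:(lra)) (ltac:(lra)) (ltac:(lra)) (ltac:(lra)).
  have := h2 (ltac:(lra)) (ltac:(lra)) (ltac:(lra)) (ltac:(lra)).
  have := h3 (ltac:(lra)) (ltac:(lra)) (ltac:(lra)) (ltac:(lra)).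
  have := h4 (ltac:(lra)) (ltac:(lra)) (ltac:(lra)) (ltac:(lra)).
  set r1 := rectI _ _ _ _ _; set r2 := rectI _ _ _ _ _.
  set r3 := rectI _ _ _ _ _; set r4 := rectI _ _ _ _ _.
  have := cmodD (r4 + r3) (r2 + r1); have := cmodD r4 r3; have := cmodD r2 r1.
  move: (cmod _) (cmod _) (cmod _) (cmod _) (cmod _) (cmod _) (cmod _).
  clear; move=> *; nra.
- move=> x y hx hy; have [l Hl] := HF _ _ hx hy.
  have e4 : 0 < eta / 4 by lra.
  have [r r0 Hr] := Hl _ e4; exists r => //.
  move=> a' b' c' d' /andP[a1 a2] /andP[b1 b2] /andP[c1 c2] /andP[d1 d2] small k1 k2 k3 k4.
  set z := x +i* y in Hl Hr.
  have ab' : a' <= b' by lra.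
  have cd' : c' <= d' by lra.
  have HFc := rcontS k1 k2 k3 k4 (rderiv_cont HF).
  pose A w := (F z - l * z) + l * w.
  have cA : rcont (fun w => l * w) a' b' c' d'.
    by move=> *; apply: ccontM; [exact: ccont_cst | exact: ccont_id].
  have cA' : rcont A a' b' c' d'.
    by move=> *; apply: ccontD; [exact: ccont_cst|exact: cA].
  have A0 : rectI A a' b' c' d' = 0.
    rewrite rectID//; [|by move=> *; exact: ccont_cst|exact: rcont_bcont cA].
    rewrite rectI_cst// rectIZ//; last by move=> *; exact: ccont_id.
    by rewrite rectI_id// mulr0 addr0.
  have -> : rectI F a' b' c' d' = rectI (fun w => F w - A w) a' b' c' d'.
    rewrite (rectID ab' cd' (rcont_bcont HFc) (G := fun w => - A w)); last by move=> *; apply: ccontN; exact: cA'.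
    have -> : rectI (fun w => - A w) a' b' c' d' = -1 * rectI A a' b' c' d'.
      rewrite -rectIZ//; last exact: rcont_bcont.
      by apply: eq_rectI => // *; rewrite mulN1r.
    by rewrite A0 mulr0 addr0.
  set s' := (b' - a') + (d' - c').
  have -> : eta * s' ^+ 2 = 4 * (eta / 4 * s') * s' by field.
  apply: cmod_rectI => //.
    by move=> *; apply: ccontD; [exact: HFc|apply: ccontN; exact: cA'].
  move=> x' y' /andP[x1 x2] /andP[y1 y2] _.
  have ws : cmod ((x' +i* y') - z) <= s'.
    apply: (le_trans (cmod_le_ReIm _)) => /=.
    by rewrite /s' lerD// ler_norml; apply/andP; split; lra.
  have -> : F (x' +i* y') - A (x' +i* y') = F (x' +i* y') - F z - l * ((x' +i* y') - z).
    by rewrite /A; ring.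
  apply: (le_trans (Hr _ _)); first by rewrite (le_lt_trans ws).
  by rewrite ler_wpM2l// ltW.
Qed.

End Goursat.

(** * Cauchy's formula on rectangles *)

Section ComplexDiff.
Context {R : realType}.
Implicit Types (f g : R[i] -> R[i]) (z w : R[i]).

Definition cdiff f z := derivable (f : R[i]^o -> R[i]^o) z 1.

Lemma cdiffB f g z : cdiff f z -> cdiff g z -> cdiff (fun w => f w - g w) z.
Proof. exact: derivableB. Qed.
Lemma cdiffM f g z : cdiff f z -> cdiff g z -> cdiff (fun w => f w * g w) z.
Proof. exact: derivableM. Qed.
Lemma cdiffV f z : f z != 0 -> cdiff f z -> cdiff (fun w => (f w)^-1) z.
Proof. exact: derivableV. Qed.
Lemma cdiff_cst (k : R[i]) z : cdiff (fun=> k) z.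
Proof. exact: derivable_cst. Qed.
Lemma cdiff_id z : cdiff (fun w => w) z.
Proof. exact: derivable_id. Qed.

Lemma cdiffP f z : cdiff f z <-> exists l, cderiv f z l.
Proof. exact: derivableP_cderiv. Qed.

Lemma cdiff_cont f z : cdiff f z -> ccont f z.
Proof. by move=> /cdiffP[l /cderiv_cont]. Qed.

Lemma cdiff_eq f g z (d : R) : 0 < d -> (forall w, cmod (w - z) < d -> f w = g w) ->
  cdiff g z -> cdiff f z.
Proof.
move=> d0 E /cdiffP[l H]; apply/cdiffP; exists l => e e0.
have [r r0 Hr] := H _ e0; exists (Num.min d r); first by rewrite lt_min d0.
move=> w; rewrite lt_min => /andP[wd wr]; rewrite E// E ?subrr ?cmod0//; exact: Hr.
Qed.

Lemma cdiff_pole z w : w != z -> cdiff (fun u => (u - z)^-1) w.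
Proof.
move=> wz; apply: (cdiffV (f := fun u => u - z)); first by rewrite subr_eq0.
by apply: cdiffB; [exact: cdiff_id|exact: cdiff_cst].
Qed.

Lemma ccont_bounded f a b c d : a <= b -> c <= d -> rcont f a b c d ->
  exists M : R, forall x y, a <= x <= b -> c <= y <= d -> cmod (f (x +i* y)) <= M.
Proof.
move=> ab cd H.
apply: (bisection (P := fun a b c d => exists M : R, forall x y, a <= x <= b -> c <= y <= d ->
  cmod (f (x +i* y)) <= M)) => //.
- move=> {H ab cd} {}a {}b {}c {}d ab cd [M1 h1] [M2 h2] [M3 h3] [M4 h4].
  exists (Num.max (Num.max M1 M2) (Num.max M3 M4)) => x y /andP[x1 x2] /andP[y1 y2].
  rewrite !le_max.
  have [hx|hx] := leP x ((a + b) / 2); have [hy|hy] := leP y ((c + d) / 2).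
  + by rewrite h1 ?x1 ?y1.
  + by rewrite h3 ?x1 ?y2 ?(ltW hy) ?orbT.
  + by rewrite h2 ?x2 ?y1 ?(ltW hx) ?orbT.
  + by rewrite h4 ?x2 ?y2 ?(ltW hx) ?(ltW hy) ?orbT.
- move=> x y hx hy; have [r r0 Hr] := H x y hx hy 1 ltr01.
  exists r => // a' b' c' d' /andP[a1 a2] /andP[b1 b2] /andP[c1 c2] /andP[d1 d2] small.
  exists (cmod (f (x +i* y)) + 1) => x' y' /andP[x1 x2] /andP[y1 y2].
  have := cmod_lerB (f (x' +i* y')) (f (x +i* y)).
  have /Hr : cmod ((x' +i* y') - (x +i* y)) < r.
    apply: le_lt_trans (cmod_le_ReIm _) _ => /=; apply: le_lt_trans small.
    by rewrite lerD// ler_norml; apply/andP; split; lra.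
  by lra.
Qed.

End ComplexDiff.

Section Cauchy.
Context {R : realType}.
Implicit Types (f F : R[i] -> R[i]) (z w p : R[i]) (a b c d : R).

Lemma Goursat_cdiff F a b c d : a <= b -> c <= d ->
  (forall x y, a <= x <= b -> c <= y <= d -> cdiff F (x +i* y)) -> rectI F a b c d = 0.
Proof. by move=> ab cd H; apply: Goursat => // x y hx hy; apply/cdiffP; exact: H. Qed.

(** The parts cut off lie where [F] is holomorphic, so that Goursat applies to them. *)
Lemma rectI_shrink F a b c d a' b' c' d' :
  a <= a' -> a' <= b' -> b' <= b -> c <= c' -> c' <= d' -> d' <= d ->
  (forall x y, x <= a' \/ b' <= x \/ y <= c' \/ d' <= y -> cdiff F (x +i* y)) ->
  rectI F a b c d = rectI F a' b' c' d'.
Proof.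
move=> aa ab bb cc cd dd H.
have Hb a1 b1 c1 d1 : a1 <= a' -> b' <= b1 -> c1 <= c' -> d' <= d1 -> bcont F a1 b1 c1 d1.
  move=> h1 h2 h3 h4 x y hx hy hh; apply: cdiff_cont; apply: H.
  by move: hh; rewrite -!orbA => /or4P[] /eqP ->; [left|right;left|do 2 right; left|do 3 right].
rewrite (rectI_splitx (m := a')); [|lra|lra|by apply: Hb; lra].
rewrite (Goursat_cdiff (a := a) (b := a')); [|lra|lra|]; last first.
  by move=> x y hx hy; apply: H; left; lra.
rewrite (rectI_splitx (m := b')); [|lra|lra|by apply: Hb; lra].
rewrite (Goursat_cdiff (a := b') (b := b)); [|lra|lra|]; last first.
  by move=> x y hx hy; apply: H; right; left; lra.
rewrite (rectI_splity (m := c')); [|lra|lra|by apply: Hb; lra].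
rewrite (Goursat_cdiff (c := c) (d := c')); [|lra|lra|]; last first.
  by move=> x y hx hy; apply: H; do 2 right; left; lra.
rewrite (rectI_splity (m := d')); [|lra|lra|by apply: Hb; lra].
rewrite (Goursat_cdiff (c := d') (d := d)); [|lra|lra|]; last first.
  by move=> x y hx hy; apply: H; do 3 right; lra.
by ring.
Qed.

(** Shrinking the rectangle to the exceptional point, near which [F] is bounded, makes the integral
    smaller than any multiple of the perimeter. *)
Lemma Goursat_punctured F a b c d p : a < re p < b -> c < im p < d ->
  ccont F p -> (forall w, w != p -> cdiff F w) -> rectI F a b c d = 0.
Proof.
move=> /andP[ap pb] /andP[cp pd] Fp HF.
have [r r0 Hr] := Fp 1 ltr01.
set M := cmod (F p) + 1.
have M0 : 0 < M by rewrite ltr_wpDl// cmod_ge0.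
apply: Normc.eq0_normc; apply/eqP; rewrite eq_le cmod_ge0 andbT.
apply/ler_addgt0Pr => e e0; rewrite add0r.
pose s := Num.min (Num.min (Num.min (re p - a) (b - re p)) (Num.min (im p - c) (d - im p)))
   (Num.min (r / 3) (e / (16 * M))).
have s0 : 0 < s by rewrite /s !lt_min !subr_gt0 ap pb cp pd /= !divr_gt0//; lra.
have : s <= s by []; rewrite {2}/s !le_min => /andP[/andP[/andP[s1 s2] /andP[s3 s4]] /andP[s5 s6]].
rewrite (@rectI_shrink F a b c d (re p - s) (re p + s) (im p - s) (im p + s)); try lra; last first.
  move=> x y h; apply: HF; apply/eqP => E; rewrite -E /= in s1 s2 s3 s4 h.
  by case: h => [|[|[|]]]; lra.
have cF w : ccont F w.
  by have [->//|wp] := eqVneq w p; apply: cdiff_cont; exact: HF.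
have -> : e = 4 * M * (e / (16 * M) + e / (16 * M) + (e / (16 * M) + e / (16 * M))).
  by field; rewrite gt_eqF.
have := @cmod_rectI _ F (re p - s) (re p + s) (im p - s) (im p + s) M (ltac:(lra)) (ltac:(lra)).
move=> /(_ _ _)/le_trans; apply => //.
- move=> x y /andP[x1 x2] /andP[y1 y2] _.
  have := cmod_lerB (F (x +i* y)) (F p).
  have /Hr : cmod ((x +i* y) - p) < r.
    apply: le_lt_trans (cmod_le_ReIm _) _; rewrite reD reN imD imN /=.
    have : `|x - re p| <= s by rewrite ler_norml; apply/andP; split; lra.
    have : `|y - im p| <= s by rewrite ler_norml; apply/andP; split; lra.
    lra.
  by rewrite /M; lra.
- by rewrite ler_wpM2l; lra.
Qed.

(** 2 pi i times the winding number of the boundary around [z]. Its exact value never matters: it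
    suffices that it stays away from 0 and does not vary with [z]. *)
Definition wind a b c d z : R[i] := rectI (fun w => (w - z)^-1) a b c d.

Lemma not_bdry a b c d z x y : a < re z < b -> c < im z < d ->
  (x == a) || (x == b) || (y == c) || (y == d) -> x +i* y != z.
Proof.
move=> /andP[az zb] /andP[cz zd] h; apply/eqP => E; rewrite -E /= in az zb cz zd.
by move: h; rewrite -!orbA => /or4P[] /eqP h; rewrite h ltxx in az zb cz zd.
Qed.

Lemma bcont_pole a b c d z : a < re z < b -> c < im z < d -> bcont (fun w => (w - z)^-1) a b c d.
Proof.
by move=> hx hy x y _ _ h; apply: cdiff_cont; apply: cdiff_pole; exact: (not_bdry hx hy h).
Qed.

(** The difference quotient of [f] at [z], completed by the derivative, is continuous at [z], so that
    the punctured Goursat theorem applies to it. *)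
Lemma Cauchy f a b c d z : entire f -> a < re z < b -> c < im z < d ->
  rectI (fun w => f w * (w - z)^-1) a b c d = f z * wind a b c d z.
Proof.
move=> fe hx hy.
have ab : a <= b by lra.
have cd : c <= d by lra.
have /cdiffP[l Hl] := fe z.
pose F w := if w == z then l else (f w - f z) * (w - z)^-1.
have F0 : rectI F a b c d = 0.
  apply: (@Goursat_punctured _ _ _ _ _ z) => //.
  - move=> e e0; have [r r0 Hr] := Hl _ e0; exists r => // w wr.
    rewrite /F eqxx; have [_|wz] := eqVneq w z; first by rewrite subrr cmod0 ltW.
    have wz0 : w - z != 0 by rewrite subr_eq0.
    have -> : (f w - f z) * (w - z)^-1 - l = (f w - f z - l * (w - z)) * (w - z)^-1 by field.
    by rewrite cmodM cmodV ler_pdivrMr ?cmod_gt0//; exact: Hr.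
  - move=> w wz; have wz0 : 0 < cmod (w - z) by rewrite cmod_gt0 subr_eq0.
    apply: (cdiff_eq (g := fun w => (f w - f z) * (w - z)^-1) wz0).
      move=> u hu; rewrite /F; case: eqP => // uz; exfalso.
      by move: hu; rewrite uz cmodC ltxx.
    apply: cdiffM; last exact: cdiff_pole.
    by apply: cdiffB; [exact: fe|exact: cdiff_cst].
have pc := bcont_pole hx hy.
have fc : bcont (fun w => f w * (w - z)^-1) a b c d.
  by move=> x y h1 h2 h3; apply: ccontM; [apply: cdiff_cont; exact: fe|exact: pc].
rewrite /wind -rectIZ//; apply/eqP; rewrite -subr_eq0; apply/eqP; rewrite -[RHS]F0.
have -> : - rectI (fun w => f z * (w - z)^-1) a b c d = rectI (fun w => - f z * (w - z)^-1) a b c d.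
  by rewrite !rectIZ// mulNr.
rewrite -rectID//; last by move=> x y h1 h2 h3; apply: ccontM; [exact: ccont_cst|exact: pc].
apply: eq_rectI => // x y h1 h2 /(not_bdry hx hy) /negbTE h3.
by rewrite /F h3; ring.
Qed.

End Cauchy.

(** * Taylor expansion of entire functions *)

Section Taylor.
Context {R : realType}.
Local Notation mu := (@lebesgue_measure R).
Implicit Types (f F : R[i] -> R[i]) (z w p : R[i]) (a b c d : R).

Lemma re_inv z : re z^-1 = re z / (re z ^+ 2 + im z ^+ 2).
Proof. by case: z. Qed.

Lemma im_inv z : im z^-1 = - im z / (re z ^+ 2 + im z ^+ 2).
Proof. by case: z => x y /=; rewrite mulNr. Qed.

(** On the lower side the imaginary part of 1 / (w - z) is at least 1 / (8 r), over a length of at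
    least 2 r; the other three sides contribute to the imaginary part with the same sign. *)
Lemma wind_im_ge a b c d z (r : R) : 0 < r ->
  r <= re z - a <= 2 * r -> r <= b - re z <= 2 * r ->
  r <= im z - c <= 2 * r -> r <= d - im z <= 2 * r -> 4^-1 <= im (wind a b c d z).
Proof.
move=> r0 /andP[a1 a2] /andP[b1 b2] /andP[c1 c2] /andP[d1 d2].
have ab : a <= b by lra.
have cd : c <= d by lra.
have hx : a < re z < b by lra.
have hy : c < im z < d by lra.
have pc := bcont_pole hx hy.
have IC := lcont_iim (bcont_bottom cd pc).
have ID := lcont_iim (bcont_top cd pc).
have IA := lcont_ire (bcont_left ab pc).
have E : im (wind a b c d z) =
  \int[mu]_(x in `[a, b]) im (((x +i* c) - z)^-1) + \int[mu]_(y in `[c, d]) re (((b +i* y) - z)^-1)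
  - \int[mu]_(x in `[a, b]) im (((x +i* d) - z)^-1) - \int[mu]_(y in `[c, d]) re (((a +i* y) - z)^-1).
  by rewrite /wind /rectI !imD !imN !imM /= !mul0r !mul1r !add0r.
have icst (u v k : R) : mu.-integrable `[u, v] (EFin \o (fun=> k)).
  by apply: within_integrable; apply: continuous_subspaceT => x; exact: cvg_cst.
have H2 (u v : R) : 0 <= u ^+ 2 + v ^+ 2 by rewrite addr_ge0 ?sqr_ge0.
have h1 : 4^-1 <= \int[mu]_(x in `[a, b]) im (((x +i* c) - z)^-1).
  apply: (@le_trans _ _ (\int[mu]_(x in `[a, b]) (8 * r)^-1)).
    rewrite Rintegral_cst//= lebesgue_measure_itv /= lte_fin.
    have -> : a < b by lra.
    rewrite /= mulrC ler_pdivlMr; lra.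
  apply: le_Rintegral => // x /=; rewrite in_itv /= => /andP[x1 x2].
  rewrite im_inv reD imD reN imN /=.
  set u := x - re z; set v := c - im z.
  have u1 : u ^+ 2 <= 4 * r ^+ 2 by rewrite /u; nra.
  have v1 : v ^+ 2 <= 4 * r ^+ 2 by rewrite /v; nra.
  have v0 : r <= - v by rewrite /v; lra.
  have uv0 : 0 < u ^+ 2 + v ^+ 2 by nra.
  rewrite ler_pdivlMr// ler_pdivrMl; last lra.
  nra.
have h2 : 0 <= \int[mu]_(y in `[c, d]) re (((b +i* y) - z)^-1).
  apply: Rintegral_ge0 => y _; rewrite re_inv reD imD reN imN /=.
  by rewrite divr_ge0 ?H2//; clear -b1 r0 a1 c1 d1; lra.
have h3 : \int[mu]_(x in `[a, b]) im (((x +i* d) - z)^-1) <= 0.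
  apply: (@le_trans _ _ (\int[mu]_(x in `[a, b]) 0)); last by rewrite Rintegral_cst// mul0r.
  apply: le_Rintegral => // x _; rewrite im_inv reD imD reN imN /=.
  by rewrite mulNr oppr_le0 divr_ge0 ?H2//; clear -b1 r0 a1 c1 d1; lra.
have h4 : \int[mu]_(y in `[c, d]) re (((a +i* y) - z)^-1) <= 0.
  apply: (@le_trans _ _ (\int[mu]_(x in `[c, d]) 0)); last by rewrite Rintegral_cst// mul0r.
  apply: le_Rintegral => // x _; rewrite re_inv reD imD reN imN /=.
  by rewrite -oppr_ge0 -mulNr divr_ge0 ?H2//; clear -b1 r0 a1 c1 d1; lra.
rewrite {}E; move: h1 h2 h3 h4; clear.
by move: (Rintegral _ _ _) (Rintegral _ _ _) (Rintegral _ _ _) (Rintegral _ _ _) => *; lra.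
Qed.

Lemma cmod_bdry_ge p (r x y : R) : 0 < r ->
  (x == re p - r) || (x == re p + r) || (y == im p - r) || (y == im p + r) ->
  r <= cmod ((x +i* y) - p).
Proof.
move=> r0; rewrite -!orbA => /or4P[] /eqP h.
- apply: le_trans (re_le_cmod _); rewrite reD reN /= h.
  by rewrite (_ : re p - r - re p = - r) ?normrN ?ger0_norm ?(ltW r0)//; ring.
- apply: le_trans (re_le_cmod _); rewrite reD reN /= h.
  by rewrite (_ : re p + r - re p = r) ?ger0_norm ?(ltW r0)//; ring.
- apply: le_trans (im_le_cmod _); rewrite imD imN /= h.
  by rewrite (_ : im p - r - im p = - r) ?normrN ?ger0_norm ?(ltW r0)//; ring.
- apply: le_trans (im_le_cmod _); rewrite imD imN /= h.
  by rewrite (_ : im p + r - im p = r) ?ger0_norm ?(ltW r0)//; ring.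
Qed.

(** The two integrands differ by (z - p) / ((w - z) (w - p)), which decays quadratically: its integral
    over large squares tends to 0, and by Goursat it is the same over all squares. *)
Lemma wind_cst p z : cmod (z - p) <= 1 ->
  wind (re p - 2) (re p + 2) (im p - 2) (im p + 2) z =
  wind (re p - 2) (re p + 2) (im p - 2) (im p + 2) p.
Proof.
move=> zp.
have zpx := le_trans (re_le_cmod _) zp; have zpy := le_trans (im_le_cmod _) zp.
rewrite reD reN ler_norml in zpx; rewrite imD imN ler_norml in zpy.
move: zpx zpy => /andP[zx1 zx2] /andP[zy1 zy2].
pose F w := (w - z)^-1 * (w - p)^-1.
have Fd x y : x <= re p - 2 \/ re p + 2 <= x \/ y <= im p - 2 \/ im p + 2 <= y ->
    cdiff F (x +i* y).
  move=> h; apply: cdiffM; apply: cdiff_pole; apply/eqP => E; move: h;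
    [have -> : x = re z by rewrite -E | have -> : x = re p by rewrite -E];
    [have -> : y = im z by rewrite -E | have -> : y = im p by rewrite -E];
    by move=> [|[|[|]]]; lra.
have Fb r : 2 <= r -> bcont F (re p - r) (re p + r) (im p - r) (im p + r).
  move=> r2 x y _ _ h; apply: cdiff_cont; apply: Fd.
  by move: h; rewrite -!orbA => /or4P[] /eqP ->; [left|right;left|right;right;left|right;right;right]; lra.
have FR r : 2 <= r -> cmod (rectI F (re p - 2) (re p + 2) (im p - 2) (im p + 2)) <= 32 / r.
  move=> r2; rewrite -(@rectI_shrink _ F (re p - r) (re p + r) (im p - r) (im p + r)) //; try lra.
  have -> : 32 / r = 4 * (2 / r ^+ 2) * ((re p + r - (re p - r)) + (im p + r - (im p - r))).
    by field; rewrite gt_eqF//; lra.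
  apply: cmod_rectI; try lra; first exact: Fb.
  move=> x y _ _ h; have r0 : 0 < r by lra.
  have h1 := cmod_bdry_ge r0 h.
  have h2 : r / 2 <= cmod ((x +i* y) - z).
    have := cmod_distD (x +i* y) z p; lra.
  rewrite /F cmodM !cmodV.
  have -> : 2 / r ^+ 2 = (r / 2)^-1 * r^-1 by field; rewrite gt_eqF.
  rewrite ler_pM ?invr_ge0 ?cmod_ge0// lef_pV2// posrE; lra.
have F0 : rectI F (re p - 2) (re p + 2) (im p - 2) (im p + 2) = 0.
  apply: Normc.eq0_normc; apply/eqP; rewrite eq_le cmod_ge0 andbT.
  apply/ler_addgt0Pr => e e0; rewrite add0r.
  have h : 2 <= Num.max 2 (32 / e) by rewrite le_max lexx.
  apply: (le_trans (FR _ h)); rewrite ler_pdivrMr; last lra.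
  by rewrite mulrC -ler_pdivrMr// le_max lexx orbT.
have px : re p - 2 < re p < re p + 2 by lra.
have py : im p - 2 < im p < im p + 2 by lra.
have zx : re p - 2 < re z < re p + 2 by lra.
have zy : im p - 2 < im z < im p + 2 by lra.
have -> : wind (re p - 2) (re p + 2) (im p - 2) (im p + 2) z =
  rectI (fun w => (w - p)^-1 + (z - p) * F w) (re p - 2) (re p + 2) (im p - 2) (im p + 2).
  apply: eq_rectI; try lra; move=> x y _ _ h.
  have h1 := not_bdry zx zy h; have h2 := not_bdry px py h.
  by rewrite /F; field; rewrite !subr_eq0 h1 h2.
rewrite rectID ?rectIZ ?F0 ?mulr0 ?addr0//; try lra.
- exact: Fb.
- exact: bcont_pole.
- by move=> x y h1 h2 h3; apply: ccontM; [exact: ccont_cst|apply: Fb].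
Qed.

(** The geometric expansion of 1 / (w - p - t) to second order inside Cauchy's formula, on a square of
    half-side 2 around [p]. *)
Lemma Taylor2 f p : entire f -> exists c1 c2 : R[i], exists K : R,
  forall t, cmod t <= 1 -> cmod (f (p + t) - f p - c1 * t - c2 * t ^+ 2) <= K * cmod t ^+ 3.
Proof.
move=> fe.
set a := re p - 2; set b := re p + 2; set c := im p - 2; set d := im p + 2.
have ab : a <= b by rewrite /a /b; lra.
have cd : c <= d by rewrite /c /d; lra.
have px : a < re p < b by rewrite /a /b; lra.
have py : c < im p < d by rewrite /c /d; lra.
set W := wind a b c d p.
have W0 : W != 0.
  apply/eqP => W0; have := @wind_im_ge a b c d p 2 (ltac:(lra)).
  rewrite -/W W0 /= /a /b /c /d.
  by move=> /(_ (ltac:(lra)) (ltac:(lra)) (ltac:(lra)) (ltac:(lra))); lra.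
have [M HM] : exists M : R, forall x y, a <= x <= b -> c <= y <= d -> cmod (f (x +i* y)) <= M.
  by apply: ccont_bounded => // x y _ _; apply: cdiff_cont; exact: fe.
pose G k w := f w * ((w - p)^-1) ^+ k.
have fb : bcont f a b c d by move=> x y _ _ _; apply: cdiff_cont; exact: fe.
have pb : bcont (fun w => (w - p)^-1) a b c d := bcont_pole px py.
have Gb k : bcont (G k) a b c d.
  elim: k => [|k IH] x y h1 h2 h3.
    by rewrite /G; apply: ccontM; [exact: fb|exact: ccont_cst].
  have -> : G k.+1 = (fun w => G k w * (w - p)^-1).
    by apply/funext => w; rewrite /G exprS; ring.
  by apply: ccontM; [exact: IH|exact: pb].
exists (W^-1 * rectI (G 2%N) a b c d), (W^-1 * rectI (G 3%N) a b c d), (cmod W^-1 * (32 * M)).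
move=> t t1.
have zp : cmod (p + t - p) <= 1 by rewrite addrC addKr.
have zpx := le_trans (re_le_cmod _) zp; have zpy := le_trans (im_le_cmod _) zp.
rewrite reD reN ler_norml in zpx; rewrite imD imN ler_norml in zpy.
have zx : a < re (p + t) < b by rewrite /a /b; lra.
have zy : c < im (p + t) < d by rewrite /c /d; lra.
have Cp := Cauchy fe px py; have Cz := Cauchy fe zx zy.
rewrite (wind_cst zp) -/W in Cz; rewrite -/W in Cp.
pose E w := G 3%N w * (w - (p + t))^-1.
have Eb : bcont E a b c d.
  by move=> x y h1 h2 h3; apply: ccontM; [exact: Gb|exact: (bcont_pole zx zy)].
have kb (k : R[i]) F : bcont F a b c d -> bcont (fun w => k * F w) a b c d.
  by move=> h x y h1 h2 h3; apply: ccontM; [exact: ccont_cst|exact: h].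
have db F1 F2 : bcont F1 a b c d -> bcont F2 a b c d -> bcont (fun w => F1 w + F2 w) a b c d.
  by move=> h h' x y h1 h2 h3; apply: ccontD; [exact: h|exact: h'].
have key : f (p + t) * W = f p * W + t * rectI (G 2%N) a b c d + t ^+ 2 * rectI (G 3%N) a b c d
    + t ^+ 3 * rectI E a b c d.
  have G1 : rectI (G 1%N) a b c d = f p * W by rewrite -Cp.
  have B1 := Gb 1%N; have B2 := kb t _ (Gb 2%N); have B3 := kb (t ^+ 2) _ (Gb 3%N).
  have B4 := kb (t ^+ 3) _ Eb; have B12 := db _ _ B1 B2; have B123 := db _ _ B12 B3.
  rewrite -Cz -G1 -(rectIZ t ab cd (Gb 2%N)) -(rectIZ _ ab cd (Gb 3%N)) -(rectIZ _ ab cd Eb).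
  rewrite -(rectID ab cd B1 B2) -(rectID ab cd B12 B3) -(rectID ab cd B123 B4).
  apply: eq_rectI => // x y _ _ h.
  have h1 := not_bdry zx zy h; have h2 := not_bdry px py h.
  by rewrite /E /G; field; rewrite opprD addrA -[_ - p - t]addrA -opprD !subr_eq0 h1 h2.
have M0 : 0 <= M.
  apply: le_trans (HM a c _ _); first exact: cmod_ge0.
  - by rewrite lexx.
  - by rewrite lexx.
have EM : cmod (rectI E a b c d) <= 32 * M.
  have -> : 32 * M = 4 * M * ((b - a) + (d - c)) by rewrite /a /b /c /d; ring.
  apply: cmod_rectI => // x y h1 h2 h.
  have hp := @cmod_bdry_ge p 2 x y (ltac:(lra)) h.
  have hz : 1 <= cmod ((x +i* y) - (p + t)).
    by have := cmod_distD (x +i* y) (p + t) p; lra.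
  rewrite /E /G cmodM cmodM cmodX !cmodV.
  set A := cmod (_ - p) in hp *; set B := cmod (_ - (p + t)) in hz *.
  have Ai : A^-1 ^+ 3 <= 1.
    by rewrite exprn_ile1 ?invr_ge0//; [lra|rewrite invf_le1; lra].
  have A0 : 0 <= A^-1 ^+ 3 by rewrite exprn_ge0 ?invr_ge0; lra.
  have Bi : B^-1 <= 1 by rewrite invf_le1; lra.
  have B0 : 0 <= B^-1 by rewrite invr_ge0; lra.
  have := HM x y h1 h2; have := cmod_ge0 (f (x +i* y)).
  set X := cmod (f _) => X0 XM.
  have P1 : X * A^-1 ^+ 3 <= X by rewrite ler_piMr.
  have P0 : 0 <= X * A^-1 ^+ 3 by rewrite mulr_ge0.
  apply: le_trans XM; apply: le_trans P1; by rewrite ler_piMr.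
have -> : f (p + t) - f p - W^-1 * rectI (G 2%N) a b c d * t - W^-1 * rectI (G 3%N) a b c d * t ^+ 2
    = W^-1 * (t ^+ 3 * rectI E a b c d).
  have -> : t ^+ 3 * rectI E a b c d = f (p + t) * W - f p * W - t * rectI (G 2%N) a b c d
    - t ^+ 2 * rectI (G 3%N) a b c d by rewrite key; ring.
  by field.
rewrite cmodM cmodM cmodX -[leRHS]mulrA; apply: ler_wpM2l; first exact: cmod_ge0.
rewrite [leLHS]mulrC; apply: ler_wpM2r EM; apply: exprn_ge0; exact: cmod_ge0.
Qed.

End Taylor.

(** * Zeros of entire functions *)

Section Division.
Context {R : realType}.
Implicit Types (f S h : R[i] -> R[i]) (z w p l : R[i]).

(** The quotient, completed by the first Taylor coefficient at [l], is differentiable there with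
    derivative the second coefficient. *)
Lemma factor_root f l : entire f -> f l = 0 ->
  exists2 q : R[i] -> R[i], entire q & forall w, f w = (w - l) * q w.
Proof.
move=> fe fl; have [c1 [c2 [K HK]]] := Taylor2 l fe.
pose q w := if w == l then c1 else f w * (w - l)^-1.
exists q; last first.
  move=> w; rewrite /q; have [->|wl] := eqVneq w l; first by rewrite subrr mul0r.
  by field; rewrite subr_eq0.
move=> z; have [->|zl] := eqVneq z l; last first.
  have d0 : 0 < cmod (z - l) by rewrite cmod_gt0 subr_eq0.
  apply: (cdiff_eq (g := fun w => f w * (w - l)^-1) d0).
    by move=> u hu; rewrite /q; case: eqP => // ul; move: hu; rewrite ul cmodC ltxx.
  by apply: cdiffM; [exact: fe|exact: cdiff_pole].
apply/cdiffP; exists c2 => e e0.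
have K0 : 0 <= K.
  have := HK 1; rewrite cmod1 => /(_ (lexx _)); rewrite !expr1n !mulr1 => hK.
  by apply: le_trans hK; exact: cmod_ge0.
exists (Num.min 1 (e / (K + 1))); first by rewrite lt_min ltr01 divr_gt0//; lra.
move=> w; rewrite lt_min => /andP[w1 w2].
have [->|wl] := eqVneq w l; first by rewrite !subrr mulr0 subrr cmod0 mulr0.
rewrite {1 2}/q eqxx (negbTE wl).
set t := w - l in w1 w2 *.
have t0 : t != 0 by rewrite subr_eq0.
have -> : f w * t^-1 - c1 - c2 * t = (f (l + t) - f l - c1 * t - c2 * t ^+ 2) * t^-1.
  by rewrite fl (_ : l + t = w); [field|rewrite /t addrC subrK].
have ct0 : 0 < cmod t by rewrite cmod_gt0.
rewrite cmodM cmodV ler_pdivrMr//.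
apply: (le_trans (HK _ (ltW w1))).
rewrite !exprS expr0 mulr1 !mulrA ler_wpM2r ?(ltW ct0)// ler_wpM2r ?(ltW ct0)//.
move: w2; rewrite ltr_pdivlMr; last lra.
nra.
Qed.

(** Were the cofactor zero at [l], then [S w] would be o(|w - l|). *)
Lemma factor_simple_root (S : R[i] -> R[i]) l : entire S -> S l = 0 ->
  (exists2 k : R, 0 < k & exists2 d : R, 0 < d &
     forall w, cmod (w - l) < d -> k * cmod (w - l) <= cmod (S w)) ->
  exists q : R[i] -> R[i], [/\ entire q, q l != 0 & forall w, S w = (w - l) * q w].
Proof.
move=> Se Sl [k k0 [d d0 Hd]]; have [v ve Sv] := factor_root Se Sl.
exists v; split => //; apply/eqP => vl; have k2 : 0 < k / 2 by lra.
have [r r0 Hr] := cdiff_cont (ve l) k2.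
pose s := Num.min r d / 2.
have s0 : 0 < s by rewrite /s divr_gt0// lt_min r0.
have [sr sd] : s < r /\ s < d.
  have := s0; rewrite /s; set m := Num.min r d => m0.
  have : m <= m by []. rewrite {2}/m le_min => /andP[]; split; lra.
have cs : cmod ((l + s%:C) - l) = s by rewrite addrC addKr cmod_real ger0_norm// ltW.
have := Hr (l + s%:C); rewrite cs vl subr0 => /(_ sr).
have := Hd (l + s%:C); rewrite cs => /(_ sd).
rewrite Sv cmodM cs mulrC ler_pM2l//; lra.
Qed.

(** Away from the zeros of [S] the quotient is holomorphic; at a zero, which is simple, it agrees nearby
    with the quotient of the cofactors of w - l in [f] and in [S]. *)
Lemma divide_entire f S : entire f -> entire S ->
  (forall l, S l = 0 -> f l = 0) ->
  (forall l, S l = 0 -> exists2 k : R, 0 < k & exists2 d : R, 0 < d &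
     forall w, cmod (w - l) < d -> k * cmod (w - l) <= cmod (S w)) ->
  exists2 h : R[i] -> R[i], entire h & forall z, f z = S z * h z.
Proof.
move=> fe Se fS simp.
have loc z : exists u v : R[i] -> R[i], [/\ entire u, entire v, v z != 0 &
    exists2 d : R, 0 < d & forall w, 0 < cmod (w - z) < d -> f w / S w = u w / v w].
  have [Sz|Sz] := eqVneq (S z) 0; last first.
    by exists f, S; split => //; exists 1.
  have [u ue fu] := factor_root fe (fS _ Sz).
  have [v [ve vz Sv]] := factor_simple_root Se Sz (simp _ Sz).
  exists u, v; split => //; exists 1 => // w; rewrite cmod_gt0 => /andP[w0 _].
  have [vw|vw] := eqVneq (v w) 0; first by rewrite Sv vw mulr0 !invr0 !mulr0.
  by rewrite fu Sv; field; rewrite vw w0.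
have /choice[U /choice[V HUV]] := loc.
pose h z := if S z == 0 then U z z / V z z else f z / S z.
exists h.
  move=> z; have [ue ve vz [d d0 Hd]] := HUV z.
  have V0 : 0 < cmod (V z z) / 2 by rewrite divr_gt0// cmod_gt0.
  have [Sz|Sz] := eqVneq (S z) 0; last first.
    have S0 : 0 < cmod (S z) / 2 by rewrite divr_gt0// cmod_gt0.
    have [r r0 Hr] := cdiff_cont (Se z) S0.
    apply: (cdiff_eq (g := fun w => f w / S w) r0); last first.
      by apply: cdiffM; [exact: fe|apply: cdiffV => //; exact: Se].
    move=> w /Hr hw; rewrite /h; case: eqP => // Sw; exfalso.
    by move: hw; rewrite Sw sub0r cmodN; lra.
  have [k k0 [r r0 Hr]] := simp _ Sz.
  have dr0 : 0 < Num.min d r by rewrite lt_min d0.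
  apply: (cdiff_eq (g := fun w => U z w / V z w) dr0); last first.
    by apply: cdiffM; [exact: ue|apply: cdiffV => //; exact: ve].
  move=> w; rewrite lt_min => /andP[wd wr]; rewrite /h.
  have [->|wz] := eqVneq w z; first by rewrite Sz eqxx.
  have wz0 : 0 < cmod (w - z) by rewrite cmod_gt0 subr_eq0.
  case: eqP => Sw; last by rewrite Hd// wz0.
  exfalso; have := Hr _ wr; rewrite Sw cmod0.
  by have := mulr_gt0 k0 wz0; lra.
move=> z; rewrite /h; case: eqP => Sz; first by rewrite Sz mul0r fS.
by field; exact/eqP.
Qed.

Lemma prod4_dist (B e : R) (x1 x2 x3 x4 y1 y2 y3 y4 : R[i]) :
  cmod x1 <= B -> cmod x2 <= B -> cmod x3 <= B ->
  cmod y2 <= B -> cmod y3 <= B -> cmod y4 <= B ->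
  cmod (x1 - y1) <= e -> cmod (x2 - y2) <= e -> cmod (x3 - y3) <= e -> cmod (x4 - y4) <= e ->
  cmod (x1 * x2 * x3 * x4 - y1 * y2 * y3 * y4) <= 4 * B ^+ 3 * e.
Proof.
move=> h1 h2 h3 g2 g3 g4 e1 e2 e3 e4.
have -> : x1 * x2 * x3 * x4 - y1 * y2 * y3 * y4 = (x1 * x2 * x3) * (x4 - y4) +
  (x1 * x2 * y4) * (x3 - y3) + (x1 * y3 * y4) * (x2 - y2) + (y2 * y3 * y4) * (x1 - y1) by ring.
have B3 (a b c d : R[i]) : cmod a <= B -> cmod b <= B -> cmod c <= B -> cmod d <= e ->
  cmod (a * b * c * d) <= B ^+ 3 * e.
  move=> ha hb hc hd; rewrite !cmodM !exprS expr0 mulr1 mulrA.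
  by rewrite !ler_pM ?mulr_ge0 ?cmod_ge0.
have := B3 _ _ _ _ h1 h2 h3 e4; have := B3 _ _ _ _ h1 h2 g4 e3.
have := B3 _ _ _ _ h1 g3 g4 e2; have := B3 _ _ _ _ g2 g3 g4 e1.
have := cmodD ((x1 * x2 * x3) * (x4 - y4) + (x1 * x2 * y4) * (x3 - y3) + (x1 * y3 * y4) * (x2 - y2))
 ((y2 * y3 * y4) * (x1 - y1)).
have := cmodD ((x1 * x2 * x3) * (x4 - y4) + (x1 * x2 * y4) * (x3 - y3)) ((x1 * y3 * y4) * (x2 - y2)).
have := cmodD ((x1 * x2 * x3) * (x4 - y4)) ((x1 * x2 * y4) * (x3 - y3)).
by clear; lra.
Qed.

(** A finite-difference form of the harmonicity of log |S|: in the product over the four neighbours of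
    [p] the terms of order t and t^2 of the Taylor expansion cancel. *)
Lemma four_point S p : entire S -> S p != 0 -> exists K : R, forall t : R, 0 <= t <= 1 ->
  cmod (S (p + t%:C)) * cmod (S (p - t%:C)) * cmod (S (p + t *i)) * cmod (S (p - t *i))
    <= cmod (S p) ^+ 4 * (1 + K * t ^+ 3).
Proof.
move=> Se Sp; have [c1 [c2 [K HK]]] := Taylor2 p Se.
have K0 : 0 <= K.
  have := HK 1; rewrite cmod1 => /(_ (lexx _)); rewrite !expr1n !mulr1 => hK.
  by apply: le_trans hK; exact: cmod_ge0.
pose a := c1 / S p; pose b := c2 / S p; pose k := K / cmod (S p).
have Sp0 : 0 < cmod (S p) by rewrite cmod_gt0.
have k0 : 0 <= k by rewrite divr_ge0// ltW.
pose A (u : R[i]) := 1 + a * u + b * u ^+ 2.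
pose g u := S (p + u) / S p.
pose B := 1 + cmod a + cmod b + k.
have gA u : cmod u <= 1 -> cmod (g u - A u) <= k * cmod u ^+ 3.
  move=> u1; have -> : g u - A u = (S (p + u) - S p - c1 * u - c2 * u ^+ 2) / S p.
    by rewrite /g /A /a /b; field.
  rewrite cmodM cmodV /k mulrAC ler_pM2r ?invr_gt0//; exact: HK.
have AB u : cmod u <= 1 -> cmod (A u) <= B - k.
  move=> u1; have := cmodD (1 + a * u) (b * u ^+ 2); have := cmodD 1 (a * u).
  rewrite cmod1 (cmodM a) (cmodM b) cmodX /B.
  have ha := cmod_ge0 a; have hb := cmod_ge0 b; have hu := cmod_ge0 u.
  have : cmod a * cmod u <= cmod a by rewrite ler_piMr.
  have : cmod b * cmod u ^+ 2 <= cmod b by rewrite ler_piMr// exprn_ile1.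
  rewrite /A; lra.
have gB u : cmod u <= 1 -> cmod (g u) <= B.
  move=> u1; have := cmodD (A u) (g u - A u); rewrite addrC subrK.
  have := AB _ u1; have := gA _ u1.
  have : k * cmod u ^+ 3 <= k by rewrite ler_piMr// exprn_ile1// cmod_ge0.
  lra.
pose C := cmod (2 * b ^+ 2 - (2 * b - a ^+ 2) ^+ 2) + cmod (b ^+ 4).
exists (C + 4 * B ^+ 3 * k) => t /andP[t0 t1].
have ct : cmod t%:C = t by rewrite cmod_real ger0_norm.
have cti : cmod (t *i) = t by rewrite cmod_imag ger0_norm.
have cnt : cmod (- t%:C) = t by rewrite cmodN.
have cnti : cmod (- (t *i)) = t by rewrite cmodN.
have ineq : cmod (g t%:C * g (- t%:C) * g (t *i) * g (- (t *i))) <= 1 + (C + 4 * B ^+ 3 * k) * t ^+ 3.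
  have P : cmod (A t%:C * A (- t%:C) * A (t *i) * A (- (t *i))) <= 1 + C * t ^+ 3.
    have -> : A t%:C * A (- t%:C) * A (t *i) * A (- (t *i)) =
       1 + ((2 * b ^+ 2 - (2 * b - a ^+ 2) ^+ 2) * t%:C ^+ 4 + b ^+ 4 * t%:C ^+ 8).
      have ii : t *i = imag_unit * t%:C by rewrite /imag_unit; apply: complexP => /=; ring.
      have i2 : (imag_unit : R[i]) ^+ 2 = -1 by rewrite /imag_unit; apply: complexP => /=; ring.
      have i4 : (imag_unit : R[i]) ^+ 4 = 1 by rewrite (exprM imag_unit 2 2) i2; ring.
      rewrite ii /A; move: i2 i4; set j := imag_unit => i2 i4.
      have -> : (1 + a * t%:C + b * t%:C ^+ 2) * (1 + a * - t%:C + b * (- t%:C) ^+ 2) *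
        (1 + a * (j * t%:C) + b * (j * t%:C) ^+ 2) * (1 + a * - (j * t%:C) + b * (- (j * t%:C)) ^+ 2) =
        ((1 + b * t%:C ^+ 2) ^+ 2 - a ^+ 2 * t%:C ^+ 2) *
        (1 + (2 * b - a ^+ 2) * j ^+ 2 * t%:C ^+ 2 + b ^+ 2 * j ^+ 4 * t%:C ^+ 4) by ring.
      by rewrite i2 i4; ring.
    have t4 : t ^+ 4 <= t ^+ 3 by rewrite (exprS t 3) ler_piMl// exprn_ge0.
    have t8 : t ^+ 8 <= t ^+ 3 by rewrite -[8%N]/(5 + 3)%N exprD ler_piMl ?exprn_ge0// exprn_ile1.
    have t3 : 0 <= t ^+ 3 by rewrite exprn_ge0.
    apply: (le_trans (cmodD _ _)); rewrite cmod1 lerD2l; apply: (le_trans (cmodD _ _)).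
    rewrite (cmodM (_ - _)) (cmodM (b ^+ 4)) (cmodX t%:C 4) (cmodX t%:C 8) ct /C [leRHS]mulrDl; apply: lerD.
      by rewrite ler_wpM2l ?cmod_ge0.
    by rewrite ler_wpM2l ?cmod_ge0.
  have D : cmod (g t%:C * g (- t%:C) * g (t *i) * g (- (t *i)) -
                 A t%:C * A (- t%:C) * A (t *i) * A (- (t *i))) <= 4 * B ^+ 3 * (k * t ^+ 3).
    have AB' u : cmod u <= 1 -> cmod (A u) <= B by move=> /AB; lra.
    apply: prod4_dist; try (apply: gB; lra); try (apply: AB'; lra).
    - by have := gA (t%:C); rewrite ct; apply.
    - by have := gA (- t%:C); rewrite cnt; apply.
    - by have := gA (t *i); rewrite cti; apply.
    - by have := gA (- (t *i)); rewrite cnti; apply.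
  have := cmodD (A t%:C * A (- t%:C) * A (t *i) * A (- (t *i)))
    (g t%:C * g (- t%:C) * g (t *i) * g (- (t *i)) - A t%:C * A (- t%:C) * A (t *i) * A (- (t *i))).
  rewrite [X in cmod X <= _]addrC subrK; move: P D; lra.
rewrite [leRHS]mulrC -ler_pdivrMr ?exprn_gt0//.
apply: le_trans ineq.
rewrite !cmodM !cmodV -/(cmod (S p)) le_eqVlt; apply/orP; left; apply/eqP.
by field; rewrite gt_eqF.
Qed.

End Division.

(** * Area mean inequality on square annuli *)

Section PlaneMeasure.
Context {R : realType}.
Local Notation mu := (@lebesgue_measure R).
Local Notation mu2 := (mu \x mu)%E.
Implicit Types (u : R[i] -> R) (z w : R[i]).

Definition toC (p : R * R) : R[i] := p.1 +i* p.2.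

Definition ucont u z := forall e : R, 0 < e -> exists2 d : R, 0 < d &
  forall w, cmod (w - z) < d -> `|u w - u z| <= e.

(** The set where [u] exceeds [t] is a union of squares with rational centres and sizes. *)
Lemma ucont_measurable u : (forall z, ucont u z) ->
  measurable_fun [set: R * R] (fun p => u (toC p)).
Proof.
move=> uc; apply: (measurability _ (RGenOInfty.measurableE R)) => //.
move=> _ [_ [t ->] <-]; rewrite setTI.
pose Q (q : rat * rat * rat) : set (R * R) :=
  `](ratr q.1.1 - ratr q.2), (ratr q.1.1 + ratr q.2)[ `*` `](ratr q.1.2 - ratr q.2), (ratr q.1.2 + ratr q.2)[.
pose A := [set p : R * R | t < u (toC p)].
have -> : (fun p => u (toC p)) @^-1` `]t, +oo[ = A.
  by apply/seteqP; split => p; rewrite /A /= in_itv /= andbT.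
have -> : A = \bigcup_(q in [set q | Q q `<=` A]) Q q.
  apply/seteqP; split; last by move=> p [q] /= H /H.
  move=> [x y] Axy; rewrite /A /= in Axy.
  have e0 : 0 < (u (x +i* y) - t) / 2 by rewrite divr_gt0// subr_gt0.
  have [d d0 Hd] := uc (x +i* y) _ e0.
  have [s /andP[s0 sd]] : exists s : rat, 0 < (ratr s : R) < d / 8.
    have : (`]0, d / 8[ `&` (@ratr R @` setT)) !=set0.
      by apply: dense_rat; [exists (d / 16) => /=; rewrite in_itv /=; apply/andP; split; lra|exact: interval_open].
    by move=> [x0 [/= h [s _ E]]]; exists s; rewrite E; move: h; rewrite in_itv.
  have near (v : R) : exists q : rat, v - ratr s < ratr q < v + ratr s.
    have : (`](v - ratr s), (v + ratr s)[ `&` (@ratr R @` setT)) !=set0.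
      by apply: dense_rat; [exists v => /=; rewrite in_itv /=; apply/andP; split; lra|exact: interval_open].
    by move=> [x0 [/= h [q _ E]]]; exists q; rewrite E; move: h; rewrite in_itv.
  have [qx /andP[x1 x2]] := near x; have [qy /andP[y1 y2]] := near y.
  exists (qx, qy, s).
  - move=> [x' y'] [] /=; rewrite !in_itv /= => /andP[x3 x4] /andP[y3 y4]; rewrite /A /=.
    have : `|u (toC (x', y')) - u (x +i* y)| <= (u (x +i* y) - t) / 2.
      apply: Hd; apply: le_lt_trans (cmod_le_ReIm _) _; rewrite reD reN imD imN /=.
      have : `|x' - x| < d / 4 by rewrite ltr_norml; apply/andP; split; lra.
      have : `|y' - y| < d / 4 by rewrite ltr_norml; apply/andP; split; lra.
      lra.
    by rewrite ler_norml => /andP[]; lra.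
  - by split => /=; rewrite in_itv /=; apply/andP; split; lra.
rewrite bigcup_mkcond; apply: countable_bigcupT_measurable; first exact: countableP.
by move=> q; case: ifP => // _; apply: measurableX; exact: measurable_itv.
Qed.

Lemma cmod_ucont f z : ccont f z -> ucont (fun w => cmod (f w)) z.
Proof.
move=> H e e0; have [d d0 Hd] := H _ e0; exists d => // w /Hd h.
exact: le_trans (cmod_dist_dist _ _) h.
Qed.

Lemma ucontB u v z : ucont u z -> ucont v z -> ucont (fun w => u w - v w) z.
Proof.
move=> Hu Hv e e0; have e2 : 0 < e / 2 by lra.
have [d1 d10 H1] := Hu _ e2; have [d2 d20 H2] := Hv _ e2.
exists (Num.min d1 d2); first by rewrite lt_min d10.
move=> w; rewrite lt_min => /andP[/H1 k1 /H2 k2].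
have -> : u w - v w - (u z - v z) = (u w - u z) - (v w - v z) by ring.
by apply: le_trans (ler_normB _ _) _; lra.
Qed.

Lemma rect_integral_gel (v : R * R -> R) (A B : set R) (t : R) :
  measurable A -> measurable B -> measurable_fun setT v -> (forall p, 0 <= v p) -> 0 <= t ->
  (forall x, A x -> (t%:E <= \int[mu]_(y in B) (v (x, y))%:E)%E) ->
  (t%:E * mu A <= \int[mu2]_(p in A `*` B) (v p)%:E)%E.
Proof.
move=> mA mB mv v0 t0 H.
have mAB : measurable (A `*` B) by exact: measurableX.
have mr : measurable_fun setT ((fun p => (v p)%:E) \_ (A `*` B)).
  have := (measurable_restrictT (fun p => (v p)%:E) mAB).1. apply; apply/measurable_EFinP; exact: measurable_funTS.
have r0 p : (0 <= ((fun p => (v p)%:E) \_ (A `*` B)) p)%E.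
  by apply: erestrict_ge0 => q _; rewrite lee_fin.
have mF := measurable_fun_fubini_tonelli_F (m2 := mu) _ mr r0.
rewrite integral_mkcond fubini_tonelli1// -integral_cst//.
have E x : A x -> (\int[mu]_y ((fun p => (v p)%:E) \_ (A `*` B)) (x, y) = \int[mu]_(y in B) (v (x, y))%:E)%E.
  move=> Ax; rewrite [RHS]integral_mkcond; apply: eq_integral => y _.
  by rewrite /patch; congr (if _ then _ else _); apply/idP/idP; rewrite !inE /=; [case|split].
apply: (@le_trans _ _ (\int[mu]_(x in A) \int[mu]_y ((fun p => (v p)%:E) \_ (A `*` B)) (x, y))%E); last first.
  by apply: ge0_subset_integral => // x _; exact: integral_ge0.
apply: ge0_le_integral => //; first exact: measurable_funTS.
by move=> x Ax; rewrite E//; exact: H.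
Qed.

Lemma rect_integral_ger (v : R * R -> R) (A B : set R) (t : R) :
  measurable A -> measurable B -> measurable_fun setT v -> (forall p, 0 <= v p) -> 0 <= t ->
  (forall y, B y -> (t%:E <= \int[mu]_(x in A) (v (x, y))%:E)%E) ->
  (t%:E * mu B <= \int[mu2]_(p in A `*` B) (v p)%:E)%E.
Proof.
move=> mA mB mv v0 t0 H.
have mAB : measurable (A `*` B) by exact: measurableX.
have mr : measurable_fun setT ((fun p => (v p)%:E) \_ (A `*` B)).
  have := (measurable_restrictT (fun p => (v p)%:E) mAB).1. apply; apply/measurable_EFinP; exact: measurable_funTS.
have r0 p : (0 <= ((fun p => (v p)%:E) \_ (A `*` B)) p)%E.
  by apply: erestrict_ge0 => q _; rewrite lee_fin.
have mF := measurable_fun_fubini_tonelli_G (m1 := mu) _ mr r0.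
rewrite integral_mkcond fubini_tonelli2// -integral_cst//.
have E y : B y -> (\int[mu]_x ((fun p => (v p)%:E) \_ (A `*` B)) (x, y) = \int[mu]_(x in A) (v (x, y))%:E)%E.
  move=> By; rewrite [RHS]integral_mkcond; apply: eq_integral => x _.
  by rewrite /patch; congr (if _ then _ else _); apply/idP/idP; rewrite !inE /=; [case|split].
apply: (@le_trans _ _ (\int[mu]_(y in B) \int[mu]_x ((fun p => (v p)%:E) \_ (A `*` B)) (x, y))%E); last first.
  by apply: ge0_subset_integral => // y _; exact: integral_ge0.
apply: ge0_le_integral => //; first exact: measurable_funTS.
by move=> y By; rewrite E//; exact: H.
Qed.

End PlaneMeasure.

Section AreaMean.
Context {R : realType}.
Local Notation mu := (@lebesgue_measure R).
Local Notation mu2 := (mu \x mu)%E.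

(** An annulus in the sup norm, in which the rectangles of the contour integrals fit. *)
Definition sqann (z : R[i]) (r : R) : set (R * R) :=
  [set p | r <= Num.max `|p.1 - re z| `|p.2 - im z| <= 2 * r].

Definition supdist (z w : R[i]) : R := Num.max `|re w - re z| `|im w - im z|.

Lemma supdist_ucont z w : ucont (supdist z) w.
Proof.
move=> e e0; exists e => // w' h.
have h1 := le_lt_trans (re_le_cmod _) h; have h2 := le_lt_trans (im_le_cmod _) h.
move: h1 h2; rewrite reD reN imD imN !ltr_norml => /andP[h1 h2] /andP[h3 h4].
have k1 : `| `|re w' - re z| - `|re w - re z| | <= e.
  by apply: le_trans (ler_dist_dist _ _) _; rewrite ler_norml; apply/andP; split; lra.
have k2 : `| `|im w' - im z| - `|im w - im z| | <= e.
  by apply: le_trans (ler_dist_dist _ _) _; rewrite ler_norml; apply/andP; split; lra.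
move: k1 k2; rewrite /supdist !ler_norml => /andP[k1 k2] /andP[k3 k4].
by apply/andP; split; rewrite /Num.max; case: ifP; case: ifP; lra.
Qed.

Lemma measurable_sqann (z : R[i]) (r : R) : measurable (sqann z r).
Proof.
have -> : sqann z r = (fun p => supdist z (toC p)) @^-1` `[r, 2 * r].
  by apply/seteqP; split => p; rewrite /sqann /= in_itv.
by rewrite -[X in measurable X]setTI; apply: (ucont_measurable (supdist_ucont z)).
Qed.

Lemma within_cmod a b (g : R -> R[i]) : lcont a b g -> {within `[a, b], continuous (fun x => cmod (g x))}.
Proof. by apply: lcont_comp => z w; exact: cmod_dist_dist. Qed.

Lemma cmod_cint_le a b (g : R -> R[i]) : lcont a b g ->
  cmod (cint a b g) <= 2 * \int[mu]_(x in `[a, b]) cmod (g x).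
Proof.
move=> H; have E (u : R -> R) : mu.-integrable `[a, b] (EFin \o u) -> (forall x, `|u x| <= cmod (g x)) ->
    `|\int[mu]_(x in `[a, b]) u x| <= \int[mu]_(x in `[a, b]) cmod (g x).
  move=> iu ug; apply: (le_trans (le_normr_Rintegral _ iu)) => //.
  apply: le_Rintegral => //; first exact: integrable_norm iu.
  exact: within_integrable (within_cmod H).
have h1 := E _ (lcont_ire H) (fun x => re_le_cmod _).
have h2 := E _ (lcont_iim H) (fun x => im_le_cmod _).
apply: (le_trans (cmod_le_ReIm _)); rewrite mulrDl mul1r; exact: lerD.
Qed.

(** One side of the rectangle in Cauchy's formula, parametrized at unit speed by [g] and at distance
    at least [r] from the pole; the integral bound is known on a longer side. *)
Lemma cmod_cint_pole_le (f : R[i] -> R[i]) z (r t u v u' v' : R) (g : R -> R[i]) :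
  entire f -> 0 < r -> (forall s s', cmod (g s - g s') = `|s - s'|) ->
  (forall s, u <= s <= v -> r <= cmod (g s - z)) ->
  lcont u v (fun s => f (g s) * (g s - z)^-1) -> u' <= u -> v <= v' ->
  (\int[mu]_(s in `[u', v']) (cmod (f (g s)))%:E < t%:E)%E ->
  cmod (cint u v (fun s => f (g s) * (g s - z)^-1)) <= 2 / r * t.
Proof.
move=> fe r0 giso gr gF uu vv gt; apply: (le_trans (cmod_cint_le gF)).
rewrite -mulrA ler_pM2l//.
have gf : lcont u' v' (fun s => f (g s)).
  move=> s _ e e0; have [d d0 Hd] := cdiff_cont (fe (g s)) e0.
  by exists d => // s' h; apply: Hd; rewrite giso.
have if' : mu.-integrable `[u', v'] (EFin \o (fun s => cmod (f (g s)))).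
  exact: within_integrable (within_cmod gf).
have if2 : mu.-integrable `[u, v] (EFin \o (fun s => cmod (f (g s)))).
  by apply: integrableS if' => //; apply: subset_itv; rewrite bnd_simp.
have if3 : mu.-integrable `[u, v] (EFin \o (fun s => r^-1 * cmod (f (g s)))).
  exact: integrableZl_R.
apply: (@le_trans _ _ (\int[mu]_(s in `[u, v]) (r^-1 * cmod (f (g s))))).
  apply: le_Rintegral => //; first exact: within_integrable (within_cmod gF).
  move=> s /=; rewrite in_itv /= => hs; rewrite cmodM cmodV mulrC ler_wpM2r ?cmod_ge0//.
  by rewrite lef_pV2 ?posrE//; [exact: gr|apply: lt_le_trans r0 (gr _ hs)].
rewrite RintegralZl// ler_pM2l ?invr_gt0//.
apply: (@le_trans _ _ (\int[mu]_(s in `[u', v']) (cmod (f (g s))))).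
  rewrite /Rintegral fine_le//; try exact: integrable_fin_num.
  apply: ge0_subset_integral => //; first by case/integrableP: if'.
  - by move=> s _; rewrite lee_fin cmod_ge0.
  - by apply: subset_itv; rewrite bnd_simp.
by rewrite -lee_fin /Rintegral fineK ?(ltW gt)//; exact: integrable_fin_num.
Qed.

Lemma dist_le_normr (u v k : R) : (u <= v - k) || (v + k <= u) -> k <= `|u - v|.
Proof. by rewrite ler_normr => /orP[h|h]; apply/orP; [right|left]; lra. Qed.

(** In Cauchy's formula the winding factor has modulus at least 1/4 and each side contributes at
    most [2 * t / r]. *)
Lemma cmod_le_sides (f : R[i] -> R[i]) z (r t a b c d : R) : entire f -> 0 < r ->
  re z - 2 * r <= a <= re z - r -> re z + r <= b <= re z + 2 * r ->
  im z - 2 * r <= c <= im z - r -> im z + r <= d <= im z + 2 * r ->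
  (\int[mu]_(y in `[(im z - 2 * r)%R, (im z + 2 * r)%R]) (cmod (f (a +i* y)))%:E < t%:E)%E ->
  (\int[mu]_(y in `[(im z - 2 * r)%R, (im z + 2 * r)%R]) (cmod (f (b +i* y)))%:E < t%:E)%E ->
  (\int[mu]_(x in `[(re z - 2 * r)%R, (re z + 2 * r)%R]) (cmod (f (x +i* c)))%:E < t%:E)%E ->
  (\int[mu]_(x in `[(re z - 2 * r)%R, (re z + 2 * r)%R]) (cmod (f (x +i* d)))%:E < t%:E)%E ->
  cmod (f z) * r <= 32 * t.
Proof.
move=> fe r0 /andP[a1 a2] /andP[b1 b2] /andP[c1 c2] /andP[d1 d2] Ia Ib Ic Id.
pose F w := f w * (w - z)^-1.
have [hx hy ab cd] : [/\ a < re z < b, c < im z < d, a <= b & c <= d].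
  by clear - r0 a1 a2 b1 b2 c1 c2 d1 d2; split; lra.
have Fb : bcont F a b c d.
  move=> x y h1 h2 h3; apply: ccontM; first by apply: cdiff_cont; exact: fe.
  exact: (bcont_pole hx hy).
have [uA vA uB vB] : [/\ im z - 2 * r <= c, d <= im z + 2 * r, re z - 2 * r <= a & b <= re z + 2 * r].
  by [].
have SC : cmod (cint a b (fun x => F (x +i* c))) <= 2 / r * t.
  apply: (cmod_cint_pole_le (g := fun x => x +i* c) fe r0 _ _ _ uB vB Ic).
  - by move=> s s'; exact: cmod_hor.
  - move=> s _; apply: le_trans (im_le_cmod _); rewrite imD imN /=.
    by apply: dist_le_normr; rewrite lerBrDr -lerBrDr c2.
  - exact: (bcont_bottom cd Fb).
have SD : cmod (cint a b (fun x => F (x +i* d))) <= 2 / r * t.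
  apply: (cmod_cint_pole_le (g := fun x => x +i* d) fe r0 _ _ _ uB vB Id).
  - by move=> s s'; exact: cmod_hor.
  - move=> s _; apply: le_trans (im_le_cmod _); rewrite imD imN /=.
    by apply: dist_le_normr; rewrite d1 orbT.
  - exact: (bcont_top cd Fb).
have SA : cmod (cint c d (fun y => F (a +i* y))) <= 2 / r * t.
  apply: (cmod_cint_pole_le (g := fun y => a +i* y) fe r0 _ _ _ uA vA Ia).
  - by move=> s s'; exact: cmod_ver.
  - move=> s _; apply: le_trans (re_le_cmod _); rewrite reD reN /=.
    by apply: dist_le_normr; rewrite a2.
  - exact: (bcont_left ab Fb).
have SB : cmod (cint c d (fun y => F (b +i* y))) <= 2 / r * t.
  apply: (cmod_cint_pole_le (g := fun y => b +i* y) fe r0 _ _ _ uA vA Ib).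
  - by move=> s s'; exact: cmod_ver.
  - move=> s _; apply: le_trans (re_le_cmod _); rewrite reD reN /=.
    by apply: dist_le_normr; rewrite b1 orbT.
  - exact: (bcont_right ab Fb).
have W : 4^-1 <= cmod (wind a b c d z).
  apply: le_trans (im_le_cmod _); apply: le_trans (ler_norm _).
  by apply: (wind_im_ge r0); clear - r0 a1 a2 b1 b2 c1 c2 d1 d2; lra.
have : cmod (f z) * 4^-1 <= 8 / r * t.
  apply: (@le_trans _ _ (cmod (rectI F a b c d))).
    by rewrite (Cauchy fe hx hy) cmodM ler_wpM2l// cmod_ge0.
  have -> : 8 / r * t = 2 / r * t + 2 / r * t + 2 / r * t + 2 / r * t by field; rewrite gt_eqF.
  move: SC SB SD SA; rewrite /rectI; clear.
  set A := cint _ _ _; set B := cint _ _ _; set C := cint _ _ _; set D := cint _ _ _.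
  have k1 := cmodD (A + imag_unit * B - C) (- (imag_unit * D)).
  have k2 := cmodD (A + imag_unit * B) (- C).
  have k3 := cmodD A (imag_unit * B).
  rewrite ?cmodN ?cmodM ?cmod_imag_unit ?mul1r in k1 k2 k3; move: k1 k2 k3.
  move: (2 / r * t) (cmod (A + _ - _ - _)) (cmod (A + _ - _)) (cmod (A + _)).
  move: (cmod A) (cmod B) (cmod C) (cmod D) => *; lra.
rewrite mulrAC ler_pdivlMr//; clear; lra.
Qed.

(** If the claim failed, then in each of the four strips of the annulus some line would carry a small
    integral of |f|, and Cauchy's formula on the rectangle bounded by these lines would make |f z|
    too small. *)
Lemma area_mean (f : R[i] -> R[i]) z (r : R) : entire f -> 0 < r ->
  ((r ^+ 2 / 64 * cmod (f z))%:E <= \int[mu2]_(p in sqann z r) (cmod (f (toC p)))%:E)%E.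
Proof.
move=> fe r0; set m := cmod (f z).
have m0 : 0 <= m := cmod_ge0 _.
set x0 := re z; set y0 := im z; set t := m * r / 64.
have t0 : 0 <= t by rewrite /t; nra.
have ufc (w : R[i]) : ucont (fun w => cmod (f w)) w by apply: cmod_ucont; apply: cdiff_cont; exact: fe.
have mf := ucont_measurable ufc.
have mann := measurable_sqann z r.
have sub (A B : set R) : A `*` B `<=` sqann z r -> measurable A -> measurable B ->
    (\int[mu2]_(p in A `*` B) (cmod (f (toC p)))%:E <= \int[mu2]_(p in sqann z r) (cmod (f (toC p)))%:E)%E.
  move=> AB mA mB; apply: ge0_subset_integral => //; first exact: measurableX.
  - by apply/measurable_EFinP; exact: measurable_funTS.
  - by move=> p _; rewrite lee_fin cmod_ge0.
have tr : t * r = r ^+ 2 / 64 * m by rewrite /t; field.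
have mitv (a : R) : mu `[a, (a + r)] = r%:E.
  by rewrite lebesgue_measure_itv /= lte_fin ltrDl r0 -EFinB addrAC subrr add0r.
pose B x := (\int[mu]_(y in `[(y0 - 2 * r)%R, (y0 + 2 * r)%R]) (cmod (f (x +i* y)))%:E)%E.
pose T y := (\int[mu]_(x in `[(x0 - 2 * r)%R, (x0 + 2 * r)%R]) (cmod (f (x +i* y)))%:E)%E.
have absle (u v k : R) : v - k <= u <= v + k -> `|u - v| <= k.
  by move=> /andP[h1 h2]; rewrite ler_norml; apply/andP; split; lra.
have goB a : (forall x, a <= x <= a + r -> r <= `|x - x0| <= 2 * r) ->
    (forall x, a <= x <= a + r -> (t%:E <= B x)%E) ->
    ((r ^+ 2 / 64 * m)%:E <= \int[mu2]_(p in sqann z r) (cmod (f (toC p)))%:E)%E.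
  move=> hsub hB; apply: (le_trans _ (sub `[a, (a + r)]%classic `[(y0 - 2 * r), (y0 + 2 * r)]%classic _ _ _)) => //; last first.
    move=> [x y] []; rewrite /sqann /= !in_itv /= le_max ge_max => /hsub/andP[-> ->] /absle.
    by rewrite -/y0 => ->.
  rewrite -tr EFinM -(mitv a); apply: rect_integral_gel => //; try by move=> p; exact: cmod_ge0.
have goT c : (forall y, c <= y <= c + r -> r <= `|y - y0| <= 2 * r) ->
    (forall y, c <= y <= c + r -> (t%:E <= T y)%E) ->
    ((r ^+ 2 / 64 * m)%:E <= \int[mu2]_(p in sqann z r) (cmod (f (toC p)))%:E)%E.
  move=> hsub hB; apply: (le_trans _ (sub `[(x0 - 2 * r), (x0 + 2 * r)]%classic `[c, (c + r)]%classic _ _ _)) => //; last first.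
    move=> [x y] []; rewrite /sqann /= !in_itv /= le_max ge_max => /absle hx /hsub/andP[-> ->].
    by rewrite -/x0 hx orbT.
  rewrite -tr EFinM -(mitv c); apply: rect_integral_ger => //; try by move=> p; exact: cmod_ge0.
have far v x : v + r <= x <= v + r + r -> r <= `|x - v| <= 2 * r.
  by move=> /andP[h1 h2]; rewrite dist_le_normr ?h1 ?orbT// absle//; apply/andP; split; lra.
have far' v x : v - 2 * r <= x <= v - 2 * r + r -> r <= `|x - v| <= 2 * r.
  move=> /andP[h1 h2]; rewrite absle; last by apply/andP; split; lra.
  by rewrite dist_le_normr//; apply/orP; left; lra.
have [hb|hb] := pselect (forall x, x0 + r <= x <= x0 + r + r -> (t%:E <= B x)%E).
  exact: goB (far x0) hb.
have [ha|ha] := pselect (forall x, x0 - 2 * r <= x <= x0 - 2 * r + r -> (t%:E <= B x)%E).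
  exact: goB (far' x0) ha.
have [hd|hd] := pselect (forall y, y0 + r <= y <= y0 + r + r -> (t%:E <= T y)%E).
  exact: goT (far y0) hd.
have [hc|hc] := pselect (forall y, y0 - 2 * r <= y <= y0 - 2 * r + r -> (t%:E <= T y)%E).
  exact: goT (far' y0) hc.
exfalso.
have pick (g : R -> \bar R) u v : ~ (forall x, u <= x <= v -> (t%:E <= g x)%E) ->
    exists2 x, u <= x <= v & (g x < t%:E)%E.
  move=> /existsNP[x /not_implyP[h1 h2]]; exists x => //.
  by rewrite ltNge; apply/negP.
have [b /andP[b1 b2] Bb] := pick _ _ _ hb; have [a /andP[a1 a2] Ba] := pick _ _ _ ha.
have [d /andP[d1 d2] Td] := pick _ _ _ hd; have [c /andP[c1 c2] Tc] := pick _ _ _ hc.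
have m_le : m * r <= 32 * t.
  apply: (cmod_le_sides fe r0 _ _ _ _ Ba Bb Tc Td); rewrite -/x0 -/y0.
  - by clear - r0 a1 a2; lra.
  - by clear - r0 b1 b2; lra.
  - by clear - r0 c1 c2; lra.
  - by clear - r0 d1 d2; lra.
have mr0 : 0 <= m * r by rewrite mulr_ge0// ltW.
have t_le0 : t <= 0 by move: m_le mr0; rewrite /t; clear; lra.
move: Bb; apply/negP; rewrite -leNgt; apply: (@le_trans _ _ 0%E); first by rewrite lee_fin.
by apply: integral_ge0 => y _; rewrite lee_fin cmod_ge0.
Qed.

End AreaMean.

(** * Radial weights and the slow variation of rho *)

Section RadialLaplacian.
Context {R : realType}.
Implicit Types (a b t x y r : R).

Definition hypot a b t : R := Num.sqrt ((a + t) ^+ 2 + b ^+ 2).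

Lemma is_derive_addl a t : is_derive t 1 (fun s : R => a + s) 1.
Proof. by have := is_deriveD (is_derive_cst a t 1) (is_derive_id t (1 : R)); rewrite add0r. Qed.

Lemma is_derive_hypot a b t : 0 < hypot a b t -> is_derive t 1 (hypot a b) ((a + t) / hypot a b t).
Proof.
move=> h0; have q0 : 0 < (a + t) ^+ 2 + b ^+ 2 by rewrite -sqrtr_gt0.
have := is_derive1_sqrt q0; rewrite -/(hypot a b t) => Hs.
have Hq : is_derive t 1 (fun t => (a + t) ^+ 2 + b ^+ 2) (2 * (a + t)).
  have H1 := is_derive_addl a t.
  have H2 := is_deriveX 2%N H1.
  have H3 := is_deriveD H2 (is_derive_cst (b ^+ 2) t 1).
  set d3 := (X in is_derive _ _ _ X) in H3.
  have <- : d3 = 2 * (a + t) by rewrite /d3 /GRing.scale /=; ring.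
  exact: H3.
have -> : (a + t) / hypot a b t = (2 * hypot a b t)^-1 * (2 * (a + t)) by field; rewrite gt_eqF.
exact: (@is_derive1_comp _ Num.sqrt (fun t => (a + t) ^+ 2 + b ^+ 2) t _ _ Hs Hq).
Qed.

Lemma is_derive_radial (phi phi1 : R -> R) a b t :
  (forall s : R, 0 < s -> is_derive s 1 phi (phi1 s)) -> 0 < hypot a b t ->
  is_derive t 1 (fun t => phi (hypot a b t)) (phi1 (hypot a b t) * ((a + t) / hypot a b t)).
Proof.
by move=> H h0; apply: (@is_derive1_comp _ phi (hypot a b)); [exact: H|exact: is_derive_hypot].
Qed.

Lemma is_derive_radial2 (phi1 : R -> R) a b (c : R) (r := hypot a b 0) :
  0 < r -> is_derive r 1 phi1 c ->
  is_derive (0 : R) 1 (fun t => phi1 (hypot a b t) * ((a + t) / hypot a b t))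
    (c * (a / r) ^+ 2 + phi1 r * (r^-1 - a ^+ 2 / r ^+ 3)).
Proof.
move=> r0 H; have hr := is_derive_hypot r0; rewrite addr0 -/r in hr.
have H1 : is_derive (0:R) 1 (fun t => phi1 (hypot a b t)) (c * (a / r)).
  exact: (@is_derive1_comp _ phi1 (hypot a b) 0 _ _ H hr).
have H2 := is_derive_addl a (0:R).
have rn : hypot a b 0 != 0 by rewrite gt_eqF.
have H3 := is_deriveV rn hr.
have H4 := is_deriveM H1 (is_deriveM H2 H3).
set d4 := (X in is_derive _ _ _ X) in H4.
have <- : d4 = c * (a / r) ^+ 2 + phi1 r * (r^-1 - a ^+ 2 / r ^+ 3).
  have -> : d4 = phi1 r * ((a + 0) * (- r ^- 2 * (a / r)) + r^-1 * 1) + ((a + 0) * r^-1) * (c * (a / r)) by [].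
  by rewrite addr0; field; rewrite gt_eqF.
exact: H4.
Qed.

End RadialLaplacian.

Section Weight.
Context {R : realType}.
Variable phi : R -> R.
Local Notation u := (radial phi : R[i] -> R).
Hypothesis uC2 : C2 u.

Lemma cmod_hypot_x (x y t : R) : cmod ((x +i* y) + t%:C) = hypot x y t.
Proof. by rewrite /hypot /= addr0. Qed.
Lemma cmod_hypot_y (x y t : R) : cmod ((x +i* y) + t *i) = hypot y x t.
Proof. by rewrite /hypot /= addr0 addrC. Qed.

Lemma derivable_line (g : R -> R) (t : R) : derivable (fun h => g (t + h)) 0 1 ->
  is_derive t 1 g (derive1 (fun h => g (t + h)) 0).
Proof.
move=> H; have H1 : is_derive (0 : R) 1 (fun h => g (t + h)) (derive1 (fun h => g (t + h)) 0).
  by rewrite derive1E; exact: DeriveDef.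
have H2 : is_derive t 1 (fun s : R => s - t) 1.
  by have := is_deriveB (is_derive_id t 1) (is_derive_cst t t 1); rewrite subr0.
have E : (fun h => g (t + h)) \o (fun s => s - t) = g.
  by apply/funext => s /=; rewrite addrC subrK.
have := @is_derive1_comp _ (fun h => g (t + h)) (fun s => s - t) t (derive1 (fun h => g (t + h)) 0) 1.
by rewrite E /= subrr mulr1 => /(_ H1 H2).
Qed.

(** The first two derivatives of [phi], read off on the positive real axis. *)
Definition phi1 (r : R) := partial_x u r%:C.
Definition phi2 (r : R) := partial_x (partial_x u) r%:C.

Lemma horizontal_line (v : R[i] -> R) (c r : R) :
  (fun h : R => v (r +i* c + h%:C)) = (fun h => (fun s => v (s +i* c)) (r + h)).
Proof. by apply/funext => h; congr v; apply: complexP => /=; ring. Qed.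

Lemma vertical_line (v : R[i] -> R) (c r : R) :
  (fun h : R => v (c +i* r + h *i)) = (fun h => (fun s => v (c +i* s)) (r + h)).
Proof. by apply/funext => h; congr v; apply: complexP => /=; ring. Qed.

Lemma partial_x_is_derive (v : R[i] -> R) (x y : R) : C1 v ->
  is_derive x 1 (fun s : R => v (s +i* y)) (partial_x v (x +i* y)).
Proof.
move=> [H _ _ _]; have := H (x +i* y); rewrite horizontal_line => h.
have := @derivable_line (fun s => v (s +i* y)) x h; by rewrite /partial_x horizontal_line.
Qed.

Lemma partial_y_is_derive (v : R[i] -> R) (x y : R) : C1 v ->
  is_derive y 1 (fun s : R => v (x +i* s)) (partial_y v (x +i* y)).
Proof.
move=> [_ H _ _]; have := H (x +i* y); rewrite vertical_line => h.
have := @derivable_line (fun s => v (x +i* s)) y h; by rewrite /partial_y vertical_line.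
Qed.

Lemma phi_is_derive (s : R) : 0 < s -> is_derive s 1 phi (phi1 s).
Proof.
move=> s0; case: uC2 => /partial_x_is_derive - /(_ s 0) H _ _.
apply: (near_eq_is_derive _ H).
near=> t; rewrite /radial /= expr0n addr0 sqrtr_sqr ger0_norm// ltW//.
by near: t; exact: lt_nbhsr.
Unshelve. all: by end_near. Qed.

Lemma phi1_is_derive (s : R) : is_derive s 1 phi1 (phi2 s).
Proof. by case: uC2 => _ /partial_x_is_derive - /(_ s 0). Qed.

Lemma partial_x_radial (x y : R) : 0 < hypot x y 0 ->
  partial_x u (x +i* y) = phi1 (hypot x y 0) * (x / hypot x y 0).
Proof.
move=> h0; have := is_derive_radial phi_is_derive h0; rewrite addr0 => H.
have E : (fun t : R => u (x +i* y + t%:C)) = (fun t => phi (hypot x y t)).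
  by apply/funext => t; rewrite /radial cmod_hypot_x.
by rewrite /partial_x E derive1E; exact: (@derive_val _ _ _ _ _ _ _ H).
Qed.

Lemma partial_y_radial (x y : R) : 0 < hypot y x 0 ->
  partial_y u (x +i* y) = phi1 (hypot y x 0) * (y / hypot y x 0).
Proof.
move=> h0; have := is_derive_radial phi_is_derive h0; rewrite addr0 => H.
have E : (fun t : R => u (x +i* y + t *i)) = (fun t => phi (hypot y x t)).
  by apply/funext => t; rewrite /radial cmod_hypot_y.
by rewrite /partial_y E derive1E; exact: (@derive_val _ _ _ _ _ _ _ H).
Qed.

Lemma hypot_add (a b t : R) : hypot (a + t) b 0 = hypot a b t.
Proof. by rewrite /hypot addr0. Qed.

Lemma hypot_near (a b : R) : 0 < hypot a b 0 -> \forall t \near (0 : R), 0 < hypot a b t.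
Proof.
move=> h0; have H := is_derive_hypot h0.
have /differentiable_continuous/cvgr_gt : differentiable (hypot a b) (0 : R).
  by apply/derivable1_diffP; case: H.
by apply.
Qed.

Lemma laplacian_polar (x y : R) (r := hypot x y 0) : 0 < r ->
  laplacian u (x +i* y) = phi2 r + phi1 r / r.
Proof.
move=> r0; have ry : hypot y x 0 = r by rewrite /r /hypot !addr0 addrC.
have X : partial_x (partial_x u) (x +i* y) = phi2 r * (x / r) ^+ 2 + phi1 r * (r^-1 - x ^+ 2 / r ^+ 3).
  have H := is_derive_radial2 r0 (phi1_is_derive r).
  rewrite /partial_x derive1E; have := @derive_val _ _ _ _ _ _ _ H => <-.
  apply: near_eq_derive.
  have := hypot_near r0; apply: filterS => t t0.
  by rewrite -hypot_add in t0 *; rewrite -partial_x_radial//; congr partial_x; apply: complexP => /=; ring.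
have Y : partial_y (partial_y u) (x +i* y) = phi2 r * (y / r) ^+ 2 + phi1 r * (r^-1 - y ^+ 2 / r ^+ 3).
  have ry0 : 0 < hypot y x 0 by rewrite ry.
  have H := is_derive_radial2 ry0 (phi1_is_derive _); rewrite ry in H.
  rewrite /partial_y derive1E; have := @derive_val _ _ _ _ _ _ _ H => <-.
  apply: near_eq_derive.
  have := hypot_near ry0; apply: filterS => t t0.
  by rewrite -hypot_add in t0 *; rewrite -partial_y_radial//; congr partial_y; apply: complexP => /=; ring.
have rE : r ^+ 2 = x ^+ 2 + y ^+ 2.
  by rewrite /r /hypot addr0 sqr_sqrtr// addr_ge0// sqr_ge0.
have -> : laplacian u (x +i* y) = (phi2 r - phi1 r / r) * ((x ^+ 2 + y ^+ 2) / r ^+ 2) + 2 * (phi1 r / r).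
  by rewrite /laplacian X Y; field; rewrite gt_eqF.
rewrite -rE divff; last by rewrite expf_neq0// gt_eqF.
by ring.
Qed.

(** Away from the origin both sides are given by the polar formula. *)
Lemma laplacian_radial (z : R[i]) : laplacian u z = laplacian u (cmod z)%:C.
Proof.
have [->|z0] := eqVneq z 0; first by rewrite cmod0.
case: z z0 => x y z0; have r0 : 0 < hypot x y 0.
  by rewrite -cmod_hypot_x addr0 cmod_gt0.
have rE : cmod (x +i* y) = hypot x y 0 by rewrite -cmod_hypot_x addr0.
have E : hypot (hypot x y 0) 0 0 = hypot x y 0.
  by rewrite {1}/hypot addr0 expr0n addr0 sqrtr_sqr ger0_norm// ltW.
have r0' : 0 < hypot (hypot x y 0) 0 0 by rewrite E.
by rewrite (laplacian_polar r0) rE (laplacian_polar r0') E.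
Qed.

Lemma rho_radial (z : R[i]) : rho phi z = rho phi (cmod z)%:C.
Proof. by rewrite /rho laplacian_radial. Qed.

Lemma laplacian_ucont (z : R[i]) : ucont (laplacian u) z.
Proof.
case: uC2 => _ [_ _ H1 _] [_ _ _ H2] e e0.
have /cvgrPdist_le/(_ e e0) H : {for (z : R[i]^o), continuous (laplacian u : R[i]^o -> R)}.
  by apply: continuousD; [exact: H1|exact: H2].
have H' : nbhs (z : R[i]^o) [set w | `|laplacian u z - laplacian u w| <= e] by exact: H.
have [d d0 Hd] := (nbhs_cP z _).1 H'.
exists d; first exact: d0.
move=> w wd; rewrite distrC; exact: Hd w wd.
Qed.

Lemma phi_ucont (z : R[i]) : ucont u z.
Proof.
move=> e e0; case: uC2 => /partial_x_is_derive - /(_ (cmod z) 0) H _ _.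
have /differentiable_continuous/cvgrPdist_le/(_ e e0) :
    differentiable (fun s : R => u (s +i* 0)) (cmod z).
  by apply/derivable1_diffP; case: H.
move=> /nbhs_ballP[d /= d0 Hd]; exists d => // w wz.
have uE v : u v = u (cmod v +i* 0).
  by rewrite /radial [cmod (_ +i* 0)]cmod_real ger0_norm// cmod_ge0.
have hd : ball (cmod z) d (cmod w).
  rewrite /ball /= ltr_norml; apply/andP; split.
    by have := cmod_lerB w z; lra.
  by have := cmod_lerB z w; rewrite cmodC; lra.
by have := Hd _ hd; rewrite distrC -!uE.
Qed.

Lemma ucont_comp (v : R[i] -> R) (k : R -> R) (z : R[i]) :
  ucont v z -> {for v z, continuous k} -> ucont (fun w => k (v w)) z.
Proof.
move=> H /cvgrPdist_le Hk e e0; have /nbhs_ballP[d /= d0 Hd] := Hk e e0.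
have d2 : 0 < d / 2 by lra.
have [r r0 Hr] := H _ d2; exists r => // w /Hr h; rewrite distrC.
by apply: Hd; rewrite /ball /= distrC; lra.
Qed.

Hypothesis lap_gt0 : forall z, 0 < laplacian u z.

Lemma rho_gt0 z : 0 < rho phi z.
Proof. by rewrite invr_gt0 sqrtr_gt0. Qed.

Lemma rhoV2 z : (rho phi z) ^- 2 = laplacian u z.
Proof. by rewrite /rho -exprVn invrK sqr_sqrtr// ltW. Qed.

Lemma rho_ucont z : ucont (rho phi) z.
Proof.
apply: (ucont_comp (k := fun l => (Num.sqrt l)^-1)); first exact: laplacian_ucont.
by apply: cvgV; [rewrite gt_eqF// sqrtr_gt0|exact: sqrt_continuous].
Qed.

End Weight.

Section UniformRegularity.
Context {R : realType}.
Variable psi : R -> R.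
Hypothesis psi_gt0 : forall x, 0 < psi x.
Hypothesis psi_cont : continuous psi.
Hypothesis psi_reg : forall C : R, exists2 c : R, 0 < c &
  forall x, 0 < x -> psi (x + C * psi x) <= c * psi x /\ psi x <= c * psi (x + C * psi x).

(** The absolute value makes the condition meaningful for all real [C], so that the category argument
    takes place on a complete space. *)
Definition reg_at (n : nat) (C : R) := forall x : R, 0 < x ->
  psi (x + `|C| * psi x) <= n%:R * psi x /\ psi x <= n%:R * psi (x + `|C| * psi x).

(** The closed sets of those [C] whose comparison constant is at most [n] cover the line. By Baire one of
    them has interior points, which may be taken positive as the condition is even in [C]. *)
Lemma reg_interval : exists n a b, [/\ 0 < a, a < b &
  forall C, a < C < b -> reg_at n C].
Proof.
have [n [c [e [e0 He]]]] : exists n c, exists e : R, 0 < e /\ forall C, `|C - c| < e -> reg_at n C.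
  apply: contrapT => H.
  have opn n : open (~` [set C | reg_at n C]).
    have -> : [set C | reg_at n C] = \bigcap_(x in [set x | 0 < x])
       ([set C | psi (x + `|C| * psi x) - n%:R * psi x <= 0] `&`
        [set C | psi x - n%:R * psi (x + `|C| * psi x) <= 0]).
      apply/seteqP; split => C /= HC x x0; have [h1 h2] := HC x x0; split; move: h1 h2 => /=; lra.
    apply: closed_openC; apply: closed_bigI => x _.
    have cC : continuous (fun C : R => psi (x + `|C| * psi x)).
      move=> C; apply: continuous_comp; last exact: psi_cont.
      apply: cvgD; first exact: cvg_cst.
      by apply: cvgM; [exact: norm_continuous|exact: cvg_cst].
    apply: closedI.
    - apply: (@closed_comp _ _ (fun C => psi (x + `|C| * psi x) - n%:R * psi x) [set y | y <= 0]); last exact: closed_le.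
      by move=> C _; apply: cvgB; [exact: cC|exact: cvg_cst].
    - apply: (@closed_comp _ _ (fun C => psi x - n%:R * psi (x + `|C| * psi x)) [set y | y <= 0]); last exact: closed_le.
      by move=> C _; apply: cvgB; [exact: cvg_cst|apply: cvgM; [exact: cvg_cst|exact: cC]].
  have den n : dense (~` [set C | reg_at n C]).
    move=> O [c Oc] oO; apply: contrapT => O0.
    have /nbhs_ballP[e /= e0 He] : nbhs c O by exact: open_nbhs_nbhs.
    apply: H; exists n, c, e; split => // C Ce; apply: contrapT => nC.
    by apply: O0; exists C; split => //; apply: He; rewrite /ball /= distrC.
  have /(_ setT) [||C [_ HC]] := @Baire _ R^o _ (fun n => conj (opn n) (den n)).
  - by exists 0.
  - exact: openT.
  have [k k0 Hk] := psi_reg `|C|.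
  apply: (HC (Num.bound k) I) => x x0 /=; have [h1 h2] := Hk x x0.
  have kb := ltW (archi_boundP (ltW k0)).
  split.
  - by apply: le_trans h1 _; rewrite ler_wpM2r// ltW.
  - by apply: le_trans h2 _; rewrite ler_wpM2r// ltW.
have c0 := normr_ge0 c.
exists n, (`|c| + e / 4), (`|c| + e); split; [lra|lra|].
move=> C /andP[C1 C2].
have C0 : 0 <= C by lra.
have R1 (D : R) : `|D| = C -> reg_at n D -> reg_at n C.
  by move=> DC H x x0; have := H x x0; rewrite DC (ger0_norm C0).
have [c_ge0|c_lt0] := lerP 0 c.
- apply: He; rewrite ger0_norm// in C1 C2 *; rewrite ltr_norml; apply/andP; split; lra.
- apply: (R1 (- C)); first by rewrite normrN ger0_norm.
  apply: He; rewrite (ltr0_norm c_lt0) in C1 C2; rewrite ltr_norml; apply/andP; split; lra.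
Qed.

(** For large [y] write y = x + c * psi x, with [c] in the middle of the interval given by Baire: the
    points [v] near [y] are x + C * psi x with [C] in the same interval, so that both [psi y] and [psi v]
    compare with [psi x]. Small [y] stay in a compact segment. *)
Lemma uniform_regularity : exists eps K : R, [/\ 0 < eps, 1 <= K &
  forall y v, 0 <= y -> `|v - y| <= eps * psi y -> psi v <= K * psi y /\ psi y <= K * psi v].
Proof.
have [n [a [b [a0 ab Hn]]]] := reg_interval.
pose c := (a + b) / 2; pose h := (b - a) / 4; pose N : R := n%:R.
have hc C : `|C - c| <= h -> reg_at n C.
  by rewrite ler_norml /c /h => /andP[h1 h2]; apply: Hn; apply/andP; split; lra.
have c0 : 0 < c by rewrite /c; lra.
have h0 : 0 < h by rewrite /h; lra.
have hcc : reg_at n c by apply: hc; rewrite subrr normr0 ltW.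
have N1 : 1 <= N.
  rewrite /N ler1n lt0n; apply/eqP => n0; have [_] := hcc 1 ltr01.
  by rewrite n0 mul0r leNgt psi_gt0.
pose Y := c * psi 0.
have Y0 : 0 < Y by rewrite mulr_gt0.
have wc : {within `[(-1), (Y + 1)], continuous psi} by exact: continuous_subspaceT.
have Y1 : -1 <= Y + 1 by lra.
have [q _ Hq] := EVT_max Y1 wc; have [p _ Hp] := EVT_min Y1 wc.
pose M := psi q; pose m := psi p.
have M0 : 0 < M := psi_gt0 _; have m0 : 0 < m := psi_gt0 _.
exists (Num.min (h / N) M^-1), (Num.max (N ^+ 2) (M / m)); split.
- by rewrite lt_min invr_gt0 M0 divr_gt0//; lra.
- by rewrite le_max expr_ge1//; lra.
move=> y v y0 hv.
have py := psi_gt0 y; have pv := psi_gt0 v.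
have hv1 : `|v - y| <= h / N * psi y.
  by apply: le_trans hv _; rewrite ler_wpM2r ?(ltW py)// ge_min lexx.
have hv2 : `|v - y| <= M^-1 * psi y.
  by apply: le_trans hv _; rewrite ler_wpM2r ?(ltW py)// ge_min lexx orbT.
have fin K : psi v <= K * psi y -> psi y <= K * psi v -> K <= Num.max (N ^+ 2) (M / m) ->
   psi v <= Num.max (N ^+ 2) (M / m) * psi y /\ psi y <= Num.max (N ^+ 2) (M / m) * psi v.
  move=> k1 k2 KK; split.
  - by apply: le_trans k1 _; rewrite ler_wpM2r// ltW.
  - by apply: le_trans k2 _; rewrite ler_wpM2r// ltW.
have [yY|yY] := lerP y Y.
  have yM : psi y <= M by apply: Hq; rewrite in_itv /=; apply/andP; split; lra.
  have ym : m <= psi y by apply: Hp; rewrite in_itv /=; apply/andP; split; lra.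
  have : `|v - y| <= 1.
    by apply: le_trans hv2 _; rewrite mulrC ler_pdivrMr// mul1r.
  rewrite ler_norml => /andP[v1 v2].
  have vM : psi v <= M by apply: Hq; rewrite in_itv /=; apply/andP; split; lra.
  have vm : m <= psi v by apply: Hp; rewrite in_itv /=; apply/andP; split; lra.
  apply: (fin (M / m)); last by rewrite le_max lexx orbT.
  - by apply: le_trans vM _; rewrite mulrAC ler_pdivlMr// ler_wpM2l// ltW.
  - by apply: le_trans yM _; rewrite mulrAC ler_pdivlMr// ler_wpM2l// ltW.
have [x x0y gx] : exists2 x, x \in `[0, y]%R & x + c * psi x = y.
  apply: (@IVT _ (fun x => x + c * psi x)) => //.
  - apply: continuous_subspaceT => x; apply: cvgD; first exact: cvg_id.
    by apply: cvgM; [exact: cvg_cst|exact: psi_cont].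
  - rewrite add0r -/Y ge_min le_max (ltW yY) /= ; apply/orP; right.
    by rewrite lerDl mulr_ge0// ltW.
rewrite in_itv /= in x0y; case/andP: x0y => x_ge0 _.
have x0 : 0 < x.
  by rewrite lt_neqAle x_ge0 andbT eq_sym; apply/eqP => xx; move: gx; rewrite xx add0r -/Y; lra.
have px := psi_gt0 x.
have [r1 r2] := hcc x x0; rewrite (ger0_norm (ltW c0)) gx -/N in r1 r2.
have Cc : `|(v - x) / psi x - c| <= h.
  have -> : (v - x) / psi x - c = (v - y) / psi x by rewrite -gx; field; rewrite gt_eqF.
  rewrite normrM normfV (ger0_norm (ltW px)) ler_pdivrMr//.
  apply: le_trans hv1 _; rewrite -mulrA ler_pM2l// ler_pdivrMl; last lra.
  exact: r1.
have hC := hc _ Cc.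
have C0 : 0 <= (v - x) / psi x by move: Cc; rewrite ler_norml /c /h => /andP[]; lra.
have [q1 q2] := hC x x0; rewrite (ger0_norm C0) in q1 q2.
have E : x + (v - x) / psi x * psi x = v by field; rewrite gt_eqF.
rewrite E -/N in q1 q2.
have N0 : 0 <= N by lra.
apply: (fin (N ^+ 2)); last by rewrite le_max lexx.
- by apply: le_trans q1 _; rewrite expr2 -mulrA ler_wpM2l.
- by apply: le_trans r1 _; rewrite expr2 -mulrA ler_wpM2l.
Qed.

End UniformRegularity.

Section SlowVariation.
Context {R : realType}.
Variable phi : R -> R.
Hypothesis hphi : fock_weight phi.
Local Notation rho := (rho phi).

Lemma weight_C2 : C2 (radial phi : R[i] -> R). Proof. by case: hphi. Qed.

Lemma weight_lap_gt0 z : 0 < laplacian (radial phi : R[i] -> R) z. Proof. by case: hphi. Qed.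

Lemma rho_pos z : 0 < rho z. Proof. exact: rho_gt0 weight_lap_gt0 z. Qed.

Lemma rho_slow : exists eps K : R, [/\ 0 < eps, 1 <= K &
  forall z w, cmod (w - z) <= eps * rho z -> rho w <= K * rho z /\ rho z <= K * rho w].
Proof.
have [|||eps [K [e0 K1 H]]] := @uniform_regularity R (fun x => rho x%:C).
- by move=> x; exact: rho_pos.
- move=> x; apply/cvgrPdist_le => e e0.
  have [d d0 Hd] := rho_ucont weight_C2 weight_lap_gt0 x%:C e0.
  apply/nbhs_ballP; exists d => //= y; rewrite /ball /= => hy.
  by rewrite distrC; apply: Hd; rewrite -rmorphB cmod_real distrC.
- by case: hphi => _ _ _ _ _ H C; have [c c0 Hc] := H C; exists c.
exists eps, K; split; [exact: e0|exact: K1|move=> z w hw].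
rewrite (rho_radial weight_C2 z) in hw; rewrite (rho_radial weight_C2 z) (rho_radial weight_C2 w).
apply: H; first exact: cmod_ge0.
exact: le_trans (cmod_dist_dist _ _) hw.
Qed.

End SlowVariation.

(** * Four-point Laplacians and the logarithmic barrier *)

Section SecondDifference.
Context {R : realType}.

(** By the mean value theorem: the derivative of g(h) + g(-h) - 2 g(0) - g2 h^2 is o(h). *)
Lemma second_diff (g g1 : R -> R) (g2 : R) :
  (forall t : R, is_derive t 1 g (g1 t)) -> is_derive (0 : R) 1 g1 g2 ->
  forall e : R, 0 < e -> exists2 d : R, 0 < d &
    forall h, 0 < h < d -> `|g h + g (- h) - 2 * g 0 - g2 * h ^+ 2| <= e * h ^+ 2.
Proof.
move=> H1 H2 e e0.
have e2 : 0 < e / 2 by lra.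
have [d d0 Hd] : exists2 d : R, 0 < d & forall t, `|t| < d -> `|g1 t - g1 0 - g2 * t| <= e / 2 * `|t|.
  case: H2 => /cvg_ex[l Hl] E.
  have lg2 : l = g2 by rewrite -E; apply/esym/cvg_lim.
  move: Hl; rewrite lg2 => /cvgrPdist_le/(_ _ e2).
  rewrite /prop_near1 /= => /nbhs_ballP[d /= d0 Hd].
  exists d => // t td; have [->|t0] := eqVneq t 0.
    by rewrite subrr mulr0 subr0 normr0 mulr0.
  have := Hd t; rewrite /ball /= sub0r normrN => /(_ td t0).
  rewrite addr0 [t%:A]mulr1 /GRing.scale /= => h.
  have -> : g1 t - g1 0 - g2 * t = - ((g2 - t^-1 * (g1 t - g1 0)) * t) by field.
  by rewrite normrN normrM ler_wpM2r.
exists d => // h /andP[h0 hd].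
pose k t := g t + g (- t) - 2 * g 0 - g2 * t ^+ 2.
pose k1 t := g1 t - g1 (- t) - g2 * (2 * t).
have kd (t : R) : is_derive t 1 k (k1 t).
  have N : is_derive t 1 (fun s : R => - s) (-1) by exact: is_deriveNid.
  have A := H1 t.
  have B : is_derive t 1 (fun s : R => g (- s)) (g1 (- t) * -1).
    exact: (@is_derive1_comp _ g (fun s => - s) t _ _ (H1 (- t)) N).
  have D := is_deriveZ g2 (is_deriveX 2%N (is_derive_id t (1 : R))).
  have E := is_deriveB (is_deriveB (is_deriveD A B) (is_derive_cst (2 * g 0) t 1)) D.
  set kk := (X in is_derive _ _ _ X) in E.
  have <- : kk = k1 t by rewrite /kk /k1 /GRing.scale /=; ring.
  exact: E.
have kc : {within `[0, h], continuous k}.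
  apply: continuous_subspaceT => t; apply: differentiable_continuous.
  by apply/derivable1_diffP; case: (kd t).
have [c] := MVT h0 (fun t _ => kd t) kc.
rewrite in_itv /= => /andP[c0 ch].
have -> : k 0 = 0 by rewrite /k oppr0 expr0n /= mulr0; ring.
rewrite !subr0 -/(k h) => ->.
have c1 := Hd c; have c2 := Hd (- c).
rewrite normrN in c2; rewrite (gtr0_norm c0) in c1 c2.
have cd : c < d by lra.
have -> : k1 c = (g1 c - g1 0 - g2 * c) - (g1 (- c) - g1 0 - g2 * - c) by rewrite /k1; ring.
rewrite normrM (gtr0_norm h0) expr2 mulrA ler_pM2r//.
apply: le_trans (ler_normB _ _) _; move: (c1 cd) (c2 cd).
set X := `|_|; set Y := `|_| => h1 h2; nra.
Qed.

Definition diff4 (v : R[i] -> R) (p : R[i]) (h : R) : R :=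
  v (p + h%:C) + v (p - h%:C) + v (p + h *i) + v (p - h *i) - 4 * v p.

(** The Laplacian as a limit of four-point differences; this is the form that the maximum principle
    uses, as log |S| is controlled by four-point products. *)
Definition has_lap (v : R[i] -> R) (p : R[i]) (D : R) := forall e : R, 0 < e ->
  exists2 d : R, 0 < d & forall h, 0 < h < d -> `|diff4 v p h - D * h ^+ 2| <= e * h ^+ 2.

Lemma has_lap_lines (v : R[i] -> R) (x y : R) (fx fy : R -> R) (fx2 fy2 : R) :
  (forall t : R, is_derive t 1 (fun s : R => v ((x + s) +i* y)) (fx t)) ->
  is_derive (0 : R) 1 fx fx2 ->
  (forall t : R, is_derive t 1 (fun s : R => v (x +i* (y + s))) (fy t)) ->
  is_derive (0 : R) 1 fy fy2 -> has_lap v (x +i* y) (fx2 + fy2).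
Proof.
move=> X1 X2 Y1 Y2 e e0; have e2 : 0 < e / 2 by lra.
have [dx dx0 Hx] := second_diff X1 X2 e2; have [dy dy0 Hy] := second_diff Y1 Y2 e2.
exists (Num.min dx dy); first by rewrite lt_min dx0.
move=> h; rewrite lt_min => /and3P[h0 hx hy].
have := Hx h; rewrite h0 hx => /(_ isT) kx; have := Hy h; rewrite h0 hy => /(_ isT) ky.
have -> : diff4 v (x +i* y) h - (fx2 + fy2) * h ^+ 2 =
  (v ((x + h) +i* y) + v ((x - h) +i* y) - 2 * v ((x + 0) +i* y) - fx2 * h ^+ 2) +
  (v (x +i* (y + h)) + v (x +i* (y - h)) - 2 * v (x +i* (y + 0)) - fy2 * h ^+ 2).
  rewrite /diff4 !addr0.
  have -> : x +i* y + h%:C = (x + h) +i* y by apply: complexP => /=; ring.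
  have -> : x +i* y - h%:C = (x - h) +i* y by apply: complexP => /=; ring.
  have -> : x +i* y + h *i = x +i* (y + h) by apply: complexP => /=; ring.
  have -> : x +i* y - h *i = x +i* (y - h) by apply: complexP => /=; ring.
  by ring.
by apply: le_trans (ler_normD _ _) _; lra.
Qed.

Lemma is_derive_shift (g : R -> R) (x t l : R) :
  is_derive (x + t) 1 g l -> is_derive t 1 (fun s : R => g (x + s)) l.
Proof.
move=> H; have A := is_derive_addl x t.
by have := @is_derive1_comp _ g (fun s => x + s) t _ _ H A; rewrite mulr1.
Qed.

Lemma has_lap_laplacian (v : R[i] -> R) p : C2 v -> has_lap v p (laplacian v p).
Proof.
case: p => x y [H1 H2 H3].
apply: (@has_lap_lines v x y (fun t => partial_x v ((x + t) +i* y)) (fun t => partial_y v (x +i* (y + t)))).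
- move=> t; apply: (@is_derive_shift (fun s => v (s +i* y))); exact: partial_x_is_derive.
- apply: (@is_derive_shift (fun s => partial_x v (s +i* y))); rewrite addr0; exact: partial_x_is_derive.
- move=> t; apply: (@is_derive_shift (fun s => v (x +i* s))); exact: partial_y_is_derive.
- apply: (@is_derive_shift (fun s => partial_y v (x +i* s))); rewrite addr0; exact: partial_y_is_derive.
Qed.

Lemma has_lapB v1 v2 p D1 D2 : has_lap v1 p D1 -> has_lap v2 p D2 ->
  has_lap (fun w => v1 w - v2 w) p (D1 - D2).
Proof.
move=> H1 H2 e e0; have e2 : 0 < e / 2 by lra.
have [dx dx0 Hx] := H1 _ e2; have [dy dy0 Hy] := H2 _ e2.
exists (Num.min dx dy); first by rewrite lt_min dx0.
move=> h; rewrite lt_min => /and3P[h0 hx hy].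
have := Hx h; rewrite h0 hx => /(_ isT) kx; have := Hy h; rewrite h0 hy => /(_ isT) ky.
have -> : diff4 (fun w => v1 w - v2 w) p h - (D1 - D2) * h ^+ 2 =
  (diff4 v1 p h - D1 * h ^+ 2) - (diff4 v2 p h - D2 * h ^+ 2) by rewrite /diff4; ring.
by apply: le_trans (ler_normB _ _) _; lra.
Qed.

Lemma has_lap_shift v z p D : has_lap v (p - z) D -> has_lap (fun w => v (w - z)) p D.
Proof.
move=> H e e0; have [d d0 Hd] := H e e0; exists d => // h hh; have := Hd h hh; rewrite /diff4.
have -> : p + h%:C - z = p - z + h%:C by ring.
have -> : p - h%:C - z = p - z - h%:C by ring.
have -> : p + h *i - z = p - z + h *i by ring.
by have -> : p - h *i - z = p - z - h *i by ring.
Qed.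

End SecondDifference.

Section LogBarrier.
Context {R : realType}.
Implicit Types (k s a b t : R).

(** A barrier growing faster than any multiple of log, with Laplacian O(1/(s^2+|w|^2)). *)
Definition barrier k s (w : R[i]) : R := k * ln (1 + cmod w ^+ 2 / s ^+ 2) ^+ 2.

Definition barrier_arg s a b t : R := 1 + ((a + t) ^+ 2 + b ^+ 2) / s ^+ 2.

Lemma barrier_arg_gt0 s a b t : 0 < barrier_arg s a b t.
Proof. by rewrite ltr_wpDr// divr_ge0 ?sqr_ge0// addr_ge0// sqr_ge0. Qed.

Lemma is_derive_barrier_arg s a b t : is_derive t 1 (barrier_arg s a b) (2 * (a + t) / s ^+ 2).
Proof.
have H1 := is_derive_addl a t.
have H2 := is_deriveD (is_deriveX 2%N H1) (is_derive_cst (b ^+ 2) t 1).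
have H3 := is_deriveD (is_derive_cst (1 : R) t 1) (is_deriveM H2 (is_derive_cst ((s ^+ 2)^-1) t 1)).
set kk := (X in is_derive _ _ _ X) in H3.
have <- : kk = 2 * (a + t) / s ^+ 2 by rewrite /kk /GRing.scale /=; ring.
exact: H3.
Qed.

Lemma is_derive_ln_barrier_arg s a b t :
  is_derive t 1 (fun t => ln (barrier_arg s a b t)) ((barrier_arg s a b t)^-1 * (2 * (a + t) / s ^+ 2)).
Proof.
exact: (@is_derive1_comp _ (@ln R) (barrier_arg s a b) t _ _ (is_derive1_ln (barrier_arg_gt0 s a b t)) (is_derive_barrier_arg s a b t)).
Qed.

Definition barrier_d1 k s a b t := 2 * k * ln (barrier_arg s a b t) * ((barrier_arg s a b t)^-1 * (2 * (a + t) / s ^+ 2)).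

Lemma is_derive_barrier k s a b t :
  is_derive t 1 (fun t => k * ln (barrier_arg s a b t) ^+ 2) (barrier_d1 k s a b t).
Proof.
have H := is_deriveZ k (is_deriveX 2%N (is_derive_ln_barrier_arg s a b t)).
set kk := (X in is_derive _ _ _ X) in H.
have <- : kk = barrier_d1 k s a b t by rewrite /kk /GRing.scale /= /barrier_d1; ring.
exact: H.
Qed.

Definition barrier_d2 k s a b (q := barrier_arg s a b 0) :=
  2 * k * (4 * a ^+ 2 / s ^+ 4 / q ^+ 2 + ln q * (2 / (s ^+ 2 * q) - 4 * a ^+ 2 / s ^+ 4 / q ^+ 2)).

Lemma is_derive_barrier2 k s a b : 0 < s -> is_derive (0 : R) 1 (barrier_d1 k s a b) (barrier_d2 k s a b).
Proof.
move=> s0; have q0 : barrier_arg s a b 0 != 0 by rewrite gt_eqF// barrier_arg_gt0.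
have H1 := is_derive_addl a (0 : R).
have H2 := is_deriveM (is_deriveZ (2 : R) H1) (is_derive_cst ((s ^+ 2)^-1) (0 : R) 1).
have H3 := is_deriveM (is_deriveV q0 (is_derive_barrier_arg s a b 0)) H2.
have H4 := is_deriveM (is_deriveZ (2 * k) (is_derive_ln_barrier_arg s a b 0)) H3.
set kk := (X in is_derive _ _ _ X) in H4.
pose q := barrier_arg s a b 0.
have <- : kk = barrier_d2 k s a b.
  have -> : kk = (2 * k * ln q) * (q^-1 * ((2 * (a + 0)) * 0 + (s ^+ 2)^-1 * (2 * 1))
    + (2 * (a + 0) * (s ^+ 2)^-1) * (- q ^- 2 * (2 * (a + 0) / s ^+ 2)))
    + (q^-1 * (2 * (a + 0) * (s ^+ 2)^-1)) * (2 * k * (q^-1 * (2 * (a + 0) / s ^+ 2))) by [].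
  rewrite /barrier_d2 -/q addr0; field; rewrite /q q0 gt_eqF//.
exact: H4.
Qed.

Lemma barrier_ucont k s z w : ucont (fun v => barrier k s (v - z)) w.
Proof.
apply: (ucont_comp (v := fun v => cmod (v - z)) (k := fun t => k * ln (1 + t ^+ 2 / s ^+ 2) ^+ 2)).
  by apply: (@cmod_ucont _ (fun v => v - z)); apply: ccontD; [exact: ccont_id|exact: ccont_cst].
have D : differentiable (fun t : R => k * ln (barrier_arg s 0 0 t) ^+ 2) (cmod (w - z)).
  by apply/derivable1_diffP; case: (is_derive_barrier k s 0 0 (cmod (w - z))).
have E : (fun t : R => k * ln (barrier_arg s 0 0 t) ^+ 2) = (fun t => k * ln (1 + t ^+ 2 / s ^+ 2) ^+ 2).
  by apply/funext => t; rewrite /barrier_arg add0r expr0n addr0.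
rewrite E in D; exact: differentiable_continuous D.
Qed.

Lemma barrier_lap k s p : 0 < k -> 0 < s -> exists2 D : R, has_lap (fun w => barrier k s w) p D &
  D <= 16 * k / (s ^+ 2 * (1 + cmod p ^+ 2 / s ^+ 2)).
Proof.
case: p => x y k0 s0; exists (barrier_d2 k s x y + barrier_d2 k s y x).
- have E (u v : R) : cmod (u +i* v) ^+ 2 = u ^+ 2 + v ^+ 2 by rewrite sqr_cmod.
  apply: (@has_lap_lines R (fun w => barrier k s w) x y (barrier_d1 k s x y) (barrier_d1 k s y x) (barrier_d2 k s x y) (barrier_d2 k s y x)).
  + move=> t; have F : (fun u : R => barrier k s ((x + u) +i* y)) = (fun t => k * ln (barrier_arg s x y t) ^+ 2).
      apply/funext => u; rewrite /barrier /barrier_arg E. reflexivity.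
    by rewrite F; exact: is_derive_barrier.
  + exact: is_derive_barrier2.
  + move=> t; have F : (fun u : R => barrier k s (x +i* (y + u))) = (fun t => k * ln (barrier_arg s y x t) ^+ 2).
      apply/funext => u; rewrite /barrier /barrier_arg E [x ^+ 2 + _]addrC. reflexivity.
    by rewrite F; exact: is_derive_barrier.
  + exact: is_derive_barrier2.
have qE : barrier_arg s x y 0 = 1 + cmod (x +i* y) ^+ 2 / s ^+ 2.
  rewrite /barrier_arg addr0 sqr_cmod; reflexivity.
have qE' : barrier_arg s y x 0 = 1 + cmod (x +i* y) ^+ 2 / s ^+ 2.
  rewrite /barrier_arg addr0 sqr_cmod [y ^+ 2 + _]addrC; reflexivity.
rewrite /barrier_d2 qE' qE; rewrite -qE; set q := barrier_arg s x y 0 in qE *.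
have q0 : 0 < q := barrier_arg_gt0 _ _ _ _.
have xy : x ^+ 2 + y ^+ 2 = (q - 1) * s ^+ 2.
  by rewrite /q /barrier_arg addr0; field; rewrite gt_eqF.
set L := ln q.
have L1 : L <= q - 1.
  have := @le_ln1Dx R (q - 1); rewrite (_ : 1 + (q - 1) = q); [apply; lra|ring].
have -> : 2 * k * (4 * x ^+ 2 / s ^+ 4 / q ^+ 2 + L * (2 / (s ^+ 2 * q) - 4 * x ^+ 2 / s ^+ 4 / q ^+ 2))
  + 2 * k * (4 * y ^+ 2 / s ^+ 4 / q ^+ 2 + L * (2 / (s ^+ 2 * q) - 4 * y ^+ 2 / s ^+ 4 / q ^+ 2))
  = 2 * k * (4 * (x ^+ 2 + y ^+ 2) / s ^+ 4 / q ^+ 2 * (1 - L) + L * (4 / (s ^+ 2 * q))).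
  by field; rewrite !gt_eqF.
rewrite xy.
have -> : 2 * k * (4 * ((q - 1) * s ^+ 2) / s ^+ 4 / q ^+ 2 * (1 - L) + L * (4 / (s ^+ 2 * q)))
  = (8 * k / (s ^+ 2 * q)) * ((q - 1 + L) / q).
  by field; rewrite !gt_eqF.
have -> : 16 * k / (s ^+ 2 * q) = (8 * k / (s ^+ 2 * q)) * 2 by field; rewrite !gt_eqF.
rewrite ler_pM2l; last by rewrite divr_gt0 ?mulr_gt0 ?exprn_gt0//.
by rewrite ler_pdivrMr//; lra.
Qed.

End LogBarrier.

(** * Distance to a set and the maximum principle *)

Section Dist.
Context {R : realType}.
Implicit Types (z w : R[i]) (L : set R[i]).

Lemma dist_has_lb z L : has_lbound [set cmod (z - w) | w in L].
Proof. by exists 0 => _ [w _ <-]; exact: cmod_ge0. Qed.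

Lemma dist_le z w L : L w -> dist z L <= cmod (z - w).
Proof. by move=> Lw; apply: (ge_inf (dist_has_lb z L)); exists w. Qed.

Lemma dist_ge z L t : L !=set0 -> (forall w, L w -> t <= cmod (z - w)) -> t <= dist z L.
Proof.
move=> [w0 Lw0] H; apply: lb_le_inf; first by exists (cmod (z - w0)), w0.
by move=> _ [w Lw <-]; exact: H.
Qed.

Lemma dist_ge0 z L : 0 <= dist z L.
Proof.
have [->|/set0P L0] := eqVneq L set0; first by rewrite /dist image_set0 inf0.
by apply: dist_ge => // w _; exact: cmod_ge0.
Qed.

Lemma dist_lip z w L : dist z L <= cmod (z - w) + dist w L.
Proof.
have [->|/set0P L0] := eqVneq L set0.
  by rewrite /dist !image_set0 inf0 addr0 cmod_ge0.
rewrite -lerBlDl; apply: dist_ge => // v Lv; rewrite lerBlDl.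
by apply: (le_trans (dist_le z Lv)); exact: cmod_distD.
Qed.

Lemma dist_lt z L t : L !=set0 -> dist z L < t -> exists2 w, L w & cmod (z - w) < t.
Proof.
move=> L0 H; apply: contrapT => nH; move: H; rewrite ltNge => /negP; apply.
apply: dist_ge => // w Lw; rewrite leNgt; apply/negP => h; apply: nH; by exists w.
Qed.

Lemma dist_ucont z L : ucont (fun w => dist w L) z.
Proof.
move=> e e0; exists e => // w h; rewrite ler_norml; apply/andP; split.
- by have := dist_lip z w L; rewrite cmodC; lra.
- by have := dist_lip w z L; lra.
Qed.

End Dist.

Section MaxSquare.
Context {R : realType}.

Lemma ucont_max_square (v : R[i] -> R) (z : R[i]) (r : R) : 0 < r ->
  (forall x y, `|x - re z| <= r -> `|y - im z| <= r -> ucont v (x +i* y)) ->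
  exists p, [/\ `|re p - re z| <= r, `|im p - im z| <= r &
    forall x y, `|x - re z| <= r -> `|y - im z| <= r -> v (x +i* y) <= v p].
Proof.
move=> r0 H.
pose A : set (R * R) := `[re z - r, re z + r]%classic `*` `[im z - r, im z + r]%classic.
have AE (x y : R) : A (x, y) <-> `|x - re z| <= r /\ `|y - im z| <= r.
  rewrite /A /= !in_itv /= !ler_norml; split => [[/andP[h1 h2] /andP[h3 h4]]|[/andP[h1 h2] /andP[h3 h4]]].
    by split; apply/andP; split; lra.
  by split; apply/andP; split; lra.
have A0 : A !=set0.
  by exists (re z, im z); apply/AE; rewrite !subrr normr0; split; exact: ltW.
have cA : compact A by apply: compact_setX; exact: segment_compact.
have cv : {within A, continuous (fun p : R * R => v (toC p))}.
  apply: continuous_in_subspaceT => -[x y]; rewrite inE => /AE[hx hy].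
  apply/cvgrPdist_le => e e0; have [d d0 Hd] := H x y hx hy e e0.
  have d2 : 0 < d / 2 by lra.
  exists (ball x (d / 2), ball y (d / 2)); first by split; exact: nbhsx_ballx.
  move=> [x' y'] [/= bx by'].
  rewrite distrC; apply: Hd; apply: le_lt_trans (cmod_le_ReIm _) _; rewrite reD reN imD imN /=.
  by move: bx by'; rewrite /ball /= !(distrC x) !(distrC y); lra.
have [[x y] /set_mem /AE[hx hy] Hp] := compact_EVT_max A0 cA cv.
exists (x +i* y); split => // x' y' hx' hy'.
by apply: (Hp (x', y')); apply/mem_set/AE.
Qed.

Lemma four_point_ln (S : R[i] -> R[i]) p : entire S -> S p != 0 ->
  exists2 K : R, 0 < K & forall h : R, 0 < h <= 1 ->
    S (p + h%:C) != 0 -> S (p - h%:C) != 0 -> S (p + h *i) != 0 -> S (p - h *i) != 0 ->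
    ln (cmod (S (p + h%:C))) + ln (cmod (S (p - h%:C))) + ln (cmod (S (p + h *i))) + ln (cmod (S (p - h *i)))
      <= 4 * ln (cmod (S p)) + K * h ^+ 3.
Proof.
move=> Se Sp; have [K HK] := four_point Se Sp.
have K0 : 0 < `|K| + 1 by rewrite ltr_wpDl.
exists (`|K| + 1) => // h /andP[h0 h1] S1 S2 S3 S4.
have Cs : 0 < cmod (S p) by rewrite cmod_gt0.
have h3 : 0 <= h ^+ 3 by rewrite exprn_ge0// ltW.
have Kh : K * h ^+ 3 <= (`|K| + 1) * h ^+ 3.
  by rewrite ler_wpM2r//; apply: le_trans (ler_norm K) _; rewrite lerDl.
have Kh0 : 0 <= (`|K| + 1) * h ^+ 3 by rewrite mulr_ge0// ltW.
have P1 : 0 < 1 + (`|K| + 1) * h ^+ 3 by rewrite ltr_pwDl.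
rewrite -!lnM ?posrE ?mulr_gt0 ?cmod_gt0//.
apply: (@le_trans _ _ (ln (cmod (S p) ^+ 4 * (1 + (`|K| + 1) * h ^+ 3)))).
  rewrite ler_ln ?posrE ?mulr_gt0 ?exprn_gt0 ?cmod_gt0//.
  have h01 : 0 <= h <= 1 by rewrite (ltW h0).
  by apply: le_trans (HK h h01) _; rewrite ler_wpM2l ?exprn_ge0 ?(ltW Cs)// lerD2l.
rewrite lnM ?posrE ?exprn_gt0// lnXn// mulr_natl lerD2l.
by apply: le_ln1Dx; apply: lt_le_trans Kh0; rewrite ltrN10.
Qed.

(** The four-point difference of [ln |S|] is O(h^3), that of [H] a positive multiple of h^2: the
    value of [H - ln |S|] at one of the four neighbours of [p] exceeds the value at [p]. *)
Lemma ln_cmod_no_local_max (S : R[i] -> R[i]) (H : R[i] -> R) p (D r : R) :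
  entire S -> 0 < r -> 0 < D -> has_lap H p D ->
  (forall u v : R, `|u| <= r -> `|v| <= r -> S (p + (u +i* v)) != 0 /\
     H (p + (u +i* v)) - ln (cmod (S (p + (u +i* v)))) <= H p - ln (cmod (S p))) -> False.
Proof.
move=> Se r0 D0 HD HG.
have nr0 : `|0 : R| <= r by rewrite normr0 ltW.
have Sp : S p != 0 by have [] := HG 0 0 nr0 nr0; rewrite addr0.
have [K K0 HK] := four_point_ln Se Sp.
have D2 : 0 < D / 2 by rewrite divr_gt0.
have [d d0 Hd] := HD _ D2.
pose h := Num.min (Num.min (d / 2) 1) (Num.min r (D / (4 * K))).
have h0 : 0 < h by rewrite /h !lt_min r0 ltr01 !divr_gt0// mulr_gt0.
have : h <= h by []; rewrite {2}/h !le_min => /andP[/andP[hd h1] /andP[hr hK]].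
have hh : `|h| <= r by rewrite gtr0_norm.
have hN : `|- h| <= r by rewrite normrN.
have := HG h 0 hh nr0; rewrite (_ : p + (h +i* 0) = p + h%:C)// => -[S1 G1].
have := HG (- h) 0 hN nr0; rewrite (_ : p + (- h +i* 0) = p - h%:C); last first.
  by congr (_ + _); apply: complexP => /=; rewrite ?oppr0.
move=> -[S2 G2].
have := HG 0 h nr0 hh; rewrite (_ : p + (0 +i* h) = p + h *i)// => -[S3 G3].
have := HG 0 (- h) nr0 hN; rewrite (_ : p + (0 +i* - h) = p - h *i); last first.
  by congr (_ + _); apply: complexP => /=; rewrite ?oppr0.
move=> -[S4 G4].
have h01 : 0 < h <= 1 by rewrite h0.
have L := HK h h01 S1 S2 S3 S4.
have hdd : 0 < h < d by rewrite h0 (le_lt_trans hd)//; clear - d0; lra.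
have := Hd h hdd; rewrite ler_norml => /andP[Hd1 _].
have hK3 : K * h ^+ 3 <= D / 4 * h ^+ 2.
  rewrite (exprS h 2) mulrA ler_wpM2r ?sqr_ge0//.
  by move: hK; rewrite ler_pdivlMr ?mulr_gt0//; clear; lra.
have h2 : 0 < D * h ^+ 2 by rewrite mulr_gt0// exprn_gt0.
move: Hd1 G1 G2 G3 G4 L hK3 h2; rewrite /diff4.
move: (ln _) (ln _) (ln _) (ln _) (ln _) (H _) (H _) (H _) (H _) (H _) (K * _).
by clear => *; lra.
Qed.

(** A maximum of [H - ln |S|] over the square exists by compactness, and cannot be an interior point. *)
Lemma max_principle (S : R[i] -> R[i]) (H : R[i] -> R) (z : R[i]) (r : R) :
  entire S -> 0 < r ->
  (forall x y, `|x - re z| <= r -> `|y - im z| <= r -> S (x +i* y) != 0) ->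
  (forall w, ucont H w) -> (forall w, exists2 D : R, 0 < D & has_lap H w D) ->
  exists w, [/\ `|re w - re z| <= r, `|im w - im z| <= r, r <= cmod (w - z) &
    H z - ln (cmod (S z)) <= H w - ln (cmod (S w))].
Proof.
move=> Se r0 S0 Hc Hl.
pose G w := H w - ln (cmod (S w)).
have Gc x y : `|x - re z| <= r -> `|y - im z| <= r -> ucont G (x +i* y).
  move=> hx hy; apply: ucontB => //.
  apply: (ucont_comp (k := @ln R) (v := fun w => cmod (S w))).
    by apply: cmod_ucont; apply: cdiff_cont; exact: Se.
  by apply: continuous_ln; rewrite cmod_gt0; exact: S0.
have [p [px py pmax]] := ucont_max_square r0 Gc.
exists p; split => //; last first.
  have := pmax (re z) (im z); rewrite !subrr normr0 => /(_ (ltW r0) (ltW r0)).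
  by case: (z).
rewrite leNgt; apply/negP => pr.
have lx := le_lt_trans (re_le_cmod _) pr; have ly := le_lt_trans (im_le_cmod _) pr.
rewrite reD reN in lx; rewrite imD imN in ly.
have [D D0 HD] := Hl p.
pose s := Num.min (r - `|re p - re z|) (r - `|im p - im z|).
have s0 : 0 < s by rewrite /s lt_min !subr_gt0 lx.
have : s <= s by []; rewrite {2}/s le_min => /andP[sx sy].
apply: (ln_cmod_no_local_max Se s0 D0 HD) => u v hu hv.
have -> : p + (u +i* v) = (re p + u) +i* (im p + v) by case: (p).
have kx : `|re p + u - re z| <= r.
  rewrite addrAC; apply: le_trans (ler_normD _ _) _; rewrite -lerBrDl; exact: le_trans sx.
have ky : `|im p + v - im z| <= r.
  rewrite addrAC; apply: le_trans (ler_normD _ _) _; rewrite -lerBrDl; exact: le_trans sy.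
by split; [exact: S0|exact: pmax].
Qed.

End MaxSquare.

(** * The zeros of S are relatively dense at the scale of rho *)

Section LogComparison.
Context {R : realType}.

(** The quantities in the final comparison of [dist_le_rho]: [d] and [dw] are the distances to the zero
    set at the centre and at the point given by the maximum principle, [s] and [rw] the values of [rho],
    [cz] and [cw] the moduli, and [t * s] is the distance between the two points. *)
Lemma log_comparison (k C g M N d dw s rw t cz cw : R) :
  0 < g -> 1 <= M -> 1 <= N -> 0 < d -> d / 2 <= dw -> 0 < s -> 0 < rw -> 0 <= t -> 0 <= cz -> 0 <= cw ->
  rw <= M * (s + t * s) -> s <= N * (1 + cz) -> cw - cz <= t * s ->
  k * ln (1 + t ^+ 2) ^+ 2 <= 2 * C + (ln d - ln dw) + (ln rw - ln s) + g * (ln (1 + cw) - ln (1 + cz)) ->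
  k * ln (1 + t ^+ 2) ^+ 2 <= (2 * C + ln 2 + ln M + ln 2 + g * (ln N + ln 2)) + (1 + g) * ln (1 + t ^+ 2).
Proof.
move=> g0 M1 N1 d0 dwd s0 rw0 t0 cz0 cw0 rwM sN cwz main.
have p2 : 0 < (2 : R) by [].
have M0 : 0 < M by exact: lt_le_trans M1.
have N0 : 0 < N by exact: lt_le_trans N1.
have dw0 : 0 < dw by apply: lt_le_trans dwd; rewrite divr_gt0.
have pt : 0 < 1 + t by rewrite ltr_pwDl.
have pq : 0 < 1 + t ^+ 2 by rewrite ltr_pwDl// sqr_ge0.
have pz : 0 < 1 + cz by rewrite ltr_pwDl.
have pw : 0 < 1 + cw by rewrite ltr_pwDl.
set Q := ln (1 + t ^+ 2) in main *.
have ln1t : ln (1 + t) <= ln 2 + Q.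
  rewrite /Q -lnM ?posrE// ler_ln ?posrE ?mulr_gt0//.
  by have := sqr_ge0 (t - 1); clear; rewrite !expr2; nra.
have Ld : ln d <= ln dw + ln 2.
  by rewrite -lnM ?posrE// ler_ln ?posrE ?mulr_gt0// -ler_pdivrMr.
have Lr : ln rw <= ln M + ln s + ln (1 + t).
  rewrite -!lnM ?posrE ?mulr_gt0// ler_ln ?posrE ?mulr_gt0//.
  by apply: (le_trans rwM); clear; lra.
have Lw : ln (1 + cw) <= ln (1 + cz) + ln N + ln (1 + t).
  rewrite -!lnM ?posrE ?mulr_gt0// ler_ln ?posrE ?mulr_gt0//.
  have h1 : t * s <= t * (N * (1 + cz)) by rewrite ler_wpM2l.
  have h2 : 1 + cz <= (1 + cz) * N by rewrite ler_peMr// ltW.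
  by move: cwz h1 h2; clear; lra.
have gw := ler_wpM2l (ltW g0) Lw; have gt := ler_wpM2l (ltW g0) ln1t.
move: main Ld Lr ln1t gw gt; rewrite !mulrDr !mulrN.
move: (ln d) (ln dw) (ln rw) (ln s) (ln M) (ln N) (ln 2) (ln (1 + t)) (ln (1 + cw)) (ln (1 + cz)).
by move: (k * Q ^+ 2) => *; lra.
Qed.

Lemma quadratic_le_linear (k A B Q : R) : 0 < k -> 0 <= A ->
  k * Q ^+ 2 <= A + B * Q -> Q <= Num.max 1 ((A + B) / k).
Proof.
move=> k0 A0 main; have [Q1|Q1] := lerP Q 1; first by rewrite le_max Q1.
rewrite le_max; apply/orP; right; rewrite ler_pdivlMr//.
have AQ : A <= A * Q by rewrite ler_peMr// ltW.
have Q0 : 0 < Q by exact: lt_trans Q1.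
rewrite -(ler_pM2l Q0); move: main AQ; rewrite expr2; clear; lra.
Qed.

Lemma le_expR_of_ln1Dsqr (t T : R) : ln (1 + t ^+ 2) <= T -> t <= expR T.
Proof.
move=> h; have pq : 0 < 1 + t ^+ 2 by rewrite ltr_pwDl// sqr_ge0.
have e1 : 1 + t ^+ 2 <= expR T by rewrite -(lnK (x := 1 + t ^+ 2)) ?posrE// ler_expR.
by have := sqr_ge0 (t - 1); have := sqr_ge0 t; move: e1; clear; rewrite !expr2; lra.
Qed.

End LogComparison.

Section ClassS.
Context {R : realType}.
Variables (phi : R -> R) (rho : R[i] -> R) (gamma : R) (S : R[i] -> R[i]).
Local Notation L := (zero_set S).
Hypothesis rho_pos : forall z, 0 < rho z.
Hypothesis rho_slow : exists eps K : R, [/\ 0 < eps, 1 <= K &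
  forall z w, cmod (w - z) <= eps * rho z -> rho w <= K * rho z /\ rho z <= K * rho w].
Hypothesis phi_uc : forall z, ucont (radial phi) z.
Hypothesis phi_lap : forall z, has_lap (radial phi) z ((rho z) ^- 2).
Hypothesis Sent : entire S.
Hypothesis Sbound : exists2 c : R, 0 < c & forall z,
  cmod (S z) <= c * (expR (phi (cmod z)) * (dist z L / rho z) * (1 / (1 + cmod z) `^ gamma)) /\
  expR (phi (cmod z)) * (dist z L / rho z) * (1 / (1 + cmod z) `^ gamma) <= c * cmod (S z).

(* [lra] is sensitive to the size of the context *)
Local Ltac fresh_context := clear - rho_pos rho_slow phi_uc phi_lap Sent Sbound.

(** Within [eps * rho w] of [w] the values of [rho] are comparable; farther away the distance itself
    dominates [rho w]. *)
Lemma rho_growth : exists2 M : R, 1 <= M & forall z w, rho w <= M * (rho z + cmod (w - z)).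
Proof.
have [eps [K [e0 K1 H]]] := rho_slow.
exists (Num.max K eps^-1); first by rewrite le_max K1.
move=> z w; have rz := rho_pos z; have rw := rho_pos w.
have cz := cmod_ge0 (w - z).
have K0 : 0 <= K by lra.
have M1 : K <= Num.max K eps^-1 by rewrite le_max lexx.
have M2 : eps^-1 <= Num.max K eps^-1 by rewrite le_max lexx orbT.
have [h|h] := lerP (cmod (z - w)) (eps * rho w).
- have [_ h2] := H _ _ h; apply: (le_trans h2).
  apply: (@le_trans _ _ (Num.max K eps^-1 * rho z)); first by rewrite ler_pM2r.
  by rewrite ler_pM2l ?lerDl//; lra.
- apply: (@le_trans _ _ (eps^-1 * cmod (w - z))).
    by rewrite ler_pdivlMl// cmodC ltW.
  have e1 : 0 < eps^-1 by rewrite invr_gt0.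
  apply: (@le_trans _ _ (Num.max K eps^-1 * cmod (w - z))); first by rewrite ler_wpM2r.
  by rewrite ler_pM2l ?lerDr ?(ltW rz)//; lra.
Qed.

(** The upper bound makes [S] vanish wherever [dist z L] is 0, and this happens on the whole plane when
    [L] is empty. *)
Lemma class_dist_gt0 z : S z != 0 -> 0 < dist z L.
Proof.
move=> Sz; rewrite lt_neqAle dist_ge0 andbT eq_sym; apply/eqP => d0.
have [c c0 H] := Sbound; have [h _] := H z.
by move: h; rewrite d0 mul0r mulr0 mul0r mulr0 leNgt cmod_gt0 Sz.
Qed.

Lemma class_lnE z : 0 < dist z L ->
  ln (expR (phi (cmod z)) * (dist z L / rho z) * (1 / (1 + cmod z) `^ gamma)) =
  phi (cmod z) + ln (dist z L) - ln (rho z) - gamma * ln (1 + cmod z).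
Proof.
move=> d0; have r0 := rho_pos z.
have z0 : 0 < 1 + cmod z by rewrite ltr_wpDr// cmod_ge0.
have p0 : 0 < (1 + cmod z) `^ gamma by rewrite powR_gt0.
have dr0 : 0 < dist z L / rho z by rewrite divr_gt0.
have i0 : 0 < 1 / (1 + cmod z) `^ gamma by rewrite divr_gt0.
have E0 := expR_gt0 (phi (cmod z)).
have P0 := mulr_gt0 E0 dr0.
rewrite lnM ?posrE// lnM ?posrE// expRK ln_div ?posrE// ln_div ?posrE// ln1 ln_powR.
by ring.
Qed.

Lemma class_ln : exists C : R, forall z, S z != 0 ->
  `|ln (cmod (S z)) - (phi (cmod z) + ln (dist z L) - ln (rho z) - gamma * ln (1 + cmod z))| <= C.
Proof.
have [c c0 H] := Sbound; exists (ln c) => z Sz.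
have d0 := class_dist_gt0 Sz; have Sc : 0 < cmod (S z) by rewrite cmod_gt0.
rewrite -(class_lnE d0); have [h1 h2] := H z.
have r0 := rho_pos z.
have z0 : 0 < 1 + cmod z by rewrite ltr_wpDr// cmod_ge0.
have p0 : 0 < (1 + cmod z) `^ gamma by rewrite powR_gt0.
have E0 : 0 < expR (phi (cmod z)) * (dist z L / rho z) * (1 / (1 + cmod z) `^ gamma).
  by rewrite !mulr_gt0 ?expR_gt0 ?invr_gt0.
set E := _ * (1 / _) in E0 h1 h2 *.
have cE := mulr_gt0 c0 E0; have cS := mulr_gt0 c0 Sc.
have k1 : ln (cmod (S z)) <= ln c + ln E by rewrite -lnM ?posrE// ler_ln ?posrE.
have k2 : ln E <= ln c + ln (cmod (S z)) by rewrite -lnM ?posrE// ler_ln ?posrE.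
by rewrite ler_norml; apply/andP; split; lra.
Qed.

(** The comparison on a zero-free square: [phi - ln |S|] minus the barrier obeys the maximum
    principle, so it grows from the centre to some point at distance comparable to [dist z L]. As it
    equals [ln rho - ln dist] plus [gamma] times a logarithm, up to constants, its growth is at most
    logarithmic in the distance measured in units of [rho z], whereas the barrier is the square of
    such a logarithm. *)
Lemma dist_le_rho : 0 < gamma -> exists2 A : R, 0 < A & forall z, dist z L <= A * rho z.
Proof.
move=> g0; have [M M1 HM] := rho_growth; have [C HC] := class_ln.
have M0 : 0 < M by exact: lt_le_trans M1.
(* small enough for the Laplacian of the barrier to stay below [rho ^- 2] *)
pose k := (64 * M ^+ 2)^-1.
have k0 : 0 < k by rewrite invr_gt0 mulr_gt0// exprn_gt0.
pose N := M * (rho 0 + 1) + 1.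
have r00 := rho_pos 0.
have MN : 0 <= M * rho 0 by rewrite mulr_ge0// ltW.
have N1 : 1 <= N by rewrite /N lerDr mulr_ge0 ?addr_ge0// ltW.
pose C1 := 2 * C + ln 2 + ln M + ln 2 + gamma * (ln N + ln 2).
pose T := Num.max 1 ((C1 + (1 + gamma)) / k).
exists (4 * expR T); first by rewrite mulr_gt0// expR_gt0.
move=> z; have rz := rho_pos z.
have [d0|d0] := lerP (dist z L) 0.
  by apply: (le_trans d0); rewrite !mulr_ge0 ?expR_ge0// ltW.
set d := dist z L in d0 *; pose r := d / 4.
have r0 : 0 < r by rewrite divr_gt0.
pose H w := radial phi w - barrier k (rho z) (w - z).
have zfree x y : `|x - re z| <= r -> `|y - im z| <= r -> S (x +i* y) != 0.
  move=> hx hy; apply/eqP => S0; have := dist_le z (L := L) S0; rewrite cmodC -/d.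
  have := cmod_le_ReIm ((x +i* y) - z); rewrite reD reN imD imN /=.
  by move: hx hy d0; rewrite /r; fresh_context; lra.
have Hc w : ucont H w by apply: ucontB => //; exact: barrier_ucont.
have Hl w : exists2 D : R, 0 < D & has_lap H w D.
  have [D HD DD] := barrier_lap (w - z) k0 rz.
  exists ((rho w) ^- 2 - D); last by apply: has_lapB => //; exact: has_lap_shift.
  have rw := rho_pos w; have G := HM z w.
  set s := rho z in rz G DD *; set t := cmod (w - z) in G DD *.
  have t0 : 0 <= t := cmod_ge0 _.
  rewrite subr_gt0; apply: le_lt_trans DD _.
  have q0 : 0 < s ^+ 2 * (1 + t ^+ 2 / s ^+ 2).
    by rewrite mulr_gt0 ?exprn_gt0// ltr_wpDr// divr_ge0 ?sqr_ge0.
  rewrite ltr_pdivrMr// [ltRHS]mulrC ltr_pdivlMr ?exprn_gt0//.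
  have -> : s ^+ 2 * (1 + t ^+ 2 / s ^+ 2) = s ^+ 2 + t ^+ 2 by field; rewrite gt_eqF.
  have G2 : (rho w) ^+ 2 <= 2 * M ^+ 2 * (s ^+ 2 + t ^+ 2).
    apply: (@le_trans _ _ ((M * (s + t)) ^+ 2)).
      by rewrite ler_pXn2r ?nnegrE ?mulr_ge0 ?addr_ge0 ?(ltW rw) ?(ltW rz) ?(ltW M0).
    by have := mulr_ge0 (sqr_ge0 M) (sqr_ge0 (s - t)); fresh_context; rewrite !expr2; nra.
  have kM : 64 * M ^+ 2 * k = 1 by rewrite mulfV// gt_eqF// mulr_gt0// exprn_gt0.
  have st : 0 < s ^+ 2 + t ^+ 2 by rewrite ltr_pwDl ?exprn_gt0 ?sqr_ge0.
  have : 16 * k * rho w ^+ 2 <= 16 * k * (2 * M ^+ 2 * (s ^+ 2 + t ^+ 2)).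
    by rewrite ler_wpM2l// mulr_ge0// ltW.
  have -> : 16 * k * (2 * M ^+ 2 * (s ^+ 2 + t ^+ 2)) = (64 * M ^+ 2 * k) * (s ^+ 2 + t ^+ 2) / 2 by field.
  by rewrite kM; move: st; fresh_context; lra.
have [w [wx wy wr Hw]] := max_principle Sent r0 zfree Hc Hl.
have Sz : S z != 0.
  by have := zfree (re z) (im z); rewrite !subrr normr0 => /(_ (ltW r0) (ltW r0)); case: (z).
have Sw : S w != 0 by have := zfree (re w) (im w) wx wy; case: (w).
have := HC z Sz; have := HC w Sw; rewrite !ler_norml => /andP[w1 w2] /andP[z1 z2].
have dw : d / 2 <= dist w L.
  have := dist_lip z w L; have := cmod_le_ReIm (z - w).
  rewrite reD reN imD imN /= (distrC (re z)) (distrC (im z)) -/d.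
  by move: wx wy; rewrite /r; fresh_context; lra.
set s := rho z in rz z1 z2 Hw *; set t := cmod (w - z) / s.
have ct : cmod (w - z) = t * s by rewrite /t; field; rewrite gt_eqF.
have t0 : 0 <= t by rewrite divr_ge0 ?cmod_ge0// ltW.
have sN : s <= N * (1 + cmod z).
  have := HM 0 z; have cz := cmod_ge0 z; rewrite subr0 -/s.
  have := mulr_ge0 MN cz; rewrite /N; move: (ltW M0) cz; fresh_context; nra.
have rwM : rho w <= M * (s + t * s) by rewrite -ct; exact: HM.
have cwz : cmod w - cmod z <= t * s by rewrite -ct; exact: cmod_lerB.
have BQ : barrier k s (w - z) = k * ln (1 + t ^+ 2) ^+ 2.
  by rewrite /barrier ct exprMn mulfK// gt_eqF// exprn_gt0.
have B0 : barrier k s (z - z) = 0.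
  by rewrite /barrier subrr cmod0 expr0n mul0r addr0 ln1 expr0n mulr0.
have main : k * ln (1 + t ^+ 2) ^+ 2 <= C1 + (1 + gamma) * ln (1 + t ^+ 2).
  apply: (log_comparison g0 M1 N1 d0 dw rz (rho_pos w) t0 (cmod_ge0 z) (cmod_ge0 w) rwM sN cwz).
  by move: Hw w1 z2; rewrite /H /radial BQ B0 -/d -/s; fresh_context; lra.
have C0 : 0 <= C by move: w1 w2; fresh_context; lra.
have C10 : 0 <= C1.
  have l2 : 0 <= ln (2 : R) by rewrite ln_ge0// ler1n.
  have lM : 0 <= ln M by rewrite ln_ge0.
  have lN : 0 <= ln N by rewrite ln_ge0.
  by rewrite !addr_ge0// mulr_ge0 ?addr_ge0// ltW.
have tT : t <= expR T := le_expR_of_ln1Dsqr (quadratic_le_linear k0 C10 main).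
have rd : d = 4 * r by rewrite /r; field.
rewrite rd -mulrA ler_pM2l//; apply: le_trans wr _.
by rewrite ct ler_pM2r.
Qed.

End ClassS.

(** * A Liouville theorem with a degenerate weight *)

Section PlaneLebesgue.
Context {R : realType}.
Local Notation mu := (@lebesgue_measure R).

(** The product measure under a name that carries its sigma-finiteness, as products of the plane with
    itself require. *)
Definition plane_lebesgue := (mu \x mu)%E.

HB.instance Definition _ := Measure.on plane_lebesgue.

Lemma plane_lebesgue_sigma_finite : sigma_finite setT plane_lebesgue.
Proof.
exists (fun n => `[(- (n%:R : R))%R, (n%:R : R)]%classic `*` `[(- (n%:R : R))%R, (n%:R : R)]%classic).
  apply/esym/seteqP; split => // -[x y] _.
  pose n := Num.bound (Num.max `|x| `|y|).
  have hn : Num.max `|x| `|y| < n%:R by apply: archi_boundP; rewrite le_max normr_ge0.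
  exists n => //; move: hn; rewrite gt_max !ltr_norml => /andP[/andP[h1 h2] /andP[h3 h4]].
  by split; rewrite /= in_itv /=; apply/andP; split; exact: ltW.
move=> n; have I : (mu `[(- (n%:R : R))%R, (n%:R : R)]%classic < +oo)%E.
  by rewrite lebesgue_measure_itv /=; case: ifP => // _; rewrite -EFinB ltry.
split; first exact: measurableX.
by rewrite /plane_lebesgue product_measure1E//; apply: lte_mul_pinfty => //; rewrite ge0_fin_numE.
Qed.

HB.instance Definition _ := @Measure_isSigmaFinite.Build _ _ _ plane_lebesgue
  plane_lebesgue_sigma_finite.

End PlaneLebesgue.

Section PlaneTonelli.
Context {R : realType}.
Local Notation mu := (@lebesgue_measure R).

Lemma plane_tonelli (f : (R * R) * (R * R) -> \bar R) :
  measurable_fun setT f -> (forall q, (0 <= f q)%E) ->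
  (\int[mu \x mu]_x \int[mu \x mu]_y f (x, y) = \int[mu \x mu]_y \int[mu \x mu]_x f (x, y))%E.
Proof.
by move=> mf f0; exact: (@fubini_tonelli _ _ _ _ _ (@plane_lebesgue R) (@plane_lebesgue R) f mf f0).
Qed.

Lemma plane_tonelli_measurable (f : (R * R) * (R * R) -> \bar R) :
  measurable_fun setT f -> (forall q, (0 <= f q)%E) ->
  measurable_fun setT (fun x => \int[mu \x mu]_y f (x, y))%E.
Proof.
by move=> mf f0; exact: (@measurable_fun_fubini_tonelli_F _ _ _ _ _ (@plane_lebesgue R) f mf f0).
Qed.

End PlaneTonelli.

Section KeyLemma.
Context {R : realType}.
Local Notation mu := (@lebesgue_measure R).
Local Notation mu2 := (mu \x mu)%E.
Variables (rho : R[i] -> R) (L : set R[i]) (h : R[i] -> R[i]).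
Hypothesis rho_pos : forall z, 0 < rho z.
Hypothesis rho_slow : exists eps K : R, [/\ 0 < eps, 1 <= K &
  forall z w, cmod (w - z) <= eps * rho z -> rho w <= K * rho z /\ rho z <= K * rho w].
Hypothesis rho_uc : forall z, ucont rho z.
Hypothesis L0 : L !=set0.
Hypothesis sep : exists2 delta : R, 0 < delta & forall l m, L l -> L m -> l <> m ->
  delta * Num.min (rho l) (rho m) <= cmod (l - m).
Hypothesis hent : entire h.

Lemma sqann_cmod (w : R[i]) (r x y : R) : sqann w r (x, y) ->
  [/\ `|x - re w| <= 2 * r, `|y - im w| <= 2 * r, r <= cmod ((x +i* y) - w) & cmod ((x +i* y) - w) <= 4 * r].
Proof.
rewrite /sqann /= le_max ge_max => /andP[h1 /andP[h2 h3]]; split => //.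
- case/orP: h1 => h1; apply: (le_trans h1).
    by apply: le_trans (re_le_cmod _); rewrite reD reN.
  by apply: le_trans (im_le_cmod _); rewrite imD imN.
- by apply: le_trans (cmod_le_ReIm _) _; rewrite reD reN imD imN /=; lra.
Qed.

(** At the scale of [rho] each point is surrounded by a square annulus that stays away from [L]: a small
    one if the point is far from [L], and otherwise one that encloses the nearby point of [L] and, by
    separation, no other. *)
Lemma good_annulus : exists t k K : R, [/\ 0 < t, 0 < k, 1 <= K & forall w, exists s,
  [/\ t / 8 * rho w <= s, s <= 2 * t * rho w &
   forall x y, sqann w s (x, y) ->
    [/\ k <= dist (x +i* y) L / rho (x +i* y), rho (x +i* y) <= K * rho w & rho w <= K * rho (x +i* y)]]].
Proof.
have [eps [K [e0 K1 H]]] := rho_slow; have [delta d0 Hs] := sep.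
have K0 : 0 < K by lra.
(* [t <= eps / 9] keeps the annuli where [rho] is comparable to [rho w]; [10 * K * t <= delta] lets at
   most one point of [L] into the larger annulus or its hole *)
pose t := Num.min (eps / 9) (delta / (10 * K)).
have t1 : t <= eps / 9 by rewrite /t ge_min lexx.
have t2 : 10 * K * t <= delta.
  by rewrite mulrC -ler_pdivlMr ?mulr_gt0// /t ge_min lexx orbT.
have t0 : 0 < t.
  have i1 : 0 < eps / 9 by lra.
  have i2 : 0 < delta / (10 * K) by rewrite divr_gt0// mulr_gt0.
  by rewrite /t lt_min i1 i2.
exists t, (t / (2 * K)), K; split => //; first by rewrite divr_gt0// mulr_gt0.
move=> w; have rw := rho_pos w.
have trw : 0 < t * rho w by rewrite mulr_gt0.
have near u : cmod (u - w) <= 9 * (t * rho w) -> rho u <= K * rho w /\ rho w <= K * rho u.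
  move=> hu; apply: H; apply: (le_trans hu).
  have : t * rho w <= eps / 9 * rho w by rewrite ler_pM2r.
  have : 0 < eps * rho w by rewrite mulr_gt0.
  lra.
have conc u : rho u <= K * rho w -> t * rho w / 2 <= dist u L -> t / (2 * K) <= dist u L / rho u.
  move=> h1 h2; have ru := rho_pos u; rewrite ler_pdivlMr//.
  apply: (@le_trans _ _ (t / (2 * K) * (K * rho w))); last first.
    apply: le_trans h2; rewrite le_eqVlt; apply/orP; left; apply/eqP; field; rewrite gt_eqF//.
  by rewrite ler_pM2l// divr_gt0// mulr_gt0.
have [dw|dw] := lerP (t * rho w) (dist w L).
- exists (t / 8 * rho w); split; [by []|lra|].
  move=> x y /sqann_cmod[_ _ h1 h2]; set u := x +i* y in h1 h2 *.
  have [n1 n2] : rho u <= K * rho w /\ rho w <= K * rho u by apply: near; lra.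
  split => //; apply: conc => //.
  by have := dist_lip w u L; rewrite cmodC; lra.
- have [l Ll wl] := dist_lt L0 dw.
  exists (2 * t * rho w); split; [lra|by []|].
  move=> x y /sqann_cmod[_ _ h1 h2]; set u := x +i* y in h1 h2 *.
  have [n1 n2] : rho u <= K * rho w /\ rho w <= K * rho u by apply: near; lra.
  split => //; apply: conc => //; apply: dist_ge => // m Lm.
  have [->|ml] := eqVneq m l.
    by have := cmod_distD u l w; rewrite (cmodC l); lra.
  rewrite leNgt; apply/negP => hm.
  have wm := cmod_distD m u w; have wm' := cmod_distD m w l; rewrite (cmodC m u) in wm.
  have [m1 m2] : rho m <= K * rho w /\ rho w <= K * rho m by apply: near; lra.
  have [l1 l2] : rho l <= K * rho w /\ rho w <= K * rho l by apply: near; rewrite cmodC; lra.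
  have mn : rho w <= K * Num.min (rho m) (rho l).
    by rewrite /Num.min; case: ifP.
  have := Hs m l Lm Ll (elimN eqP ml).
  have mn0 : 0 < Num.min (rho m) (rho l) by rewrite lt_min !rho_pos.
  have : 10 * K * t * Num.min (rho m) (rho l) <= delta * Num.min (rho m) (rho l) by rewrite ler_pM2r.
  have : t * rho w <= t * (K * Num.min (rho m) (rho l)) by rewrite ler_pM2l.
  by move: mn0; set q := Num.min _ _; lra.
Qed.

Definition wt (u : R[i]) : R := ((1 + cmod u) ^+ 2)^-1.
(** For h = f / S this density is |f|^2 exp(- 2 phi), up to constants and a power of 1 + |u|. *)
Definition gwt (u : R[i]) : R := cmod (h u) ^+ 2 * (dist u L / rho u) ^+ 2 * wt u.

Lemma one_cmod_gt0 (u : R[i]) : 0 < 1 + cmod u. Proof. by rewrite ltr_wpDr// cmod_ge0. Qed.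
Lemma wt_gt0 u : 0 < wt u. Proof. by rewrite invr_gt0 exprn_gt0// one_cmod_gt0. Qed.
Lemma gwt_ge0 u : 0 <= gwt u.
Proof.
have w0 := ltW (wt_gt0 u); have c0 := cmod_ge0 (h u).
have q0 : 0 <= dist u L / rho u by rewrite divr_ge0 ?dist_ge0// ltW.
by rewrite /gwt mulr_ge0// mulr_ge0// exprn_ge0.
Qed.

Lemma measurable_cmod : measurable_fun [set: R * R] (fun p => cmod (h (toC p))).
Proof. by apply: (@ucont_measurable _ (fun w => cmod (h w))) => z; apply: cmod_ucont; apply: cdiff_cont; exact: hent. Qed.
Lemma measurable_rho : measurable_fun [set: R * R] (fun p => rho (toC p)).
Proof. exact: ucont_measurable. Qed.
Lemma measurable_wt : measurable_fun [set: R * R] (fun p => wt (toC p)).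
Proof.
apply: (@ucont_measurable _ wt) => z.
have C : {for cmod z, continuous (fun x : R => ((1 + x) ^+ 2)^-1)}.
  apply: cvgV; first by rewrite gt_eqF// exprn_gt0// one_cmod_gt0.
  have D := is_derive_addl (1 : R) (cmod z).
  have D2 := is_deriveX 2%N D.
  have D3 : differentiable ((fun x : R => 1 + x) ^+ 2) (cmod z) by apply/derivable1_diffP; case: D2.
  exact: differentiable_continuous D3.
have U : ucont (fun w : R[i] => cmod w) z by exact: (@cmod_ucont _ (fun w => w) z (ccont_id z)).
by move=> e e0; have := ucont_comp U C e0.
Qed.
Lemma measurable_rhoV : measurable_fun [set: R * R] (fun p => (rho (toC p))^-1).
Proof.
apply: (@ucont_measurable _ (fun w => (rho w)^-1)) => z.
by apply: (ucont_comp (v := rho) (k := fun x => x^-1)) => //; apply: cvgV => //; rewrite gt_eqF.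
Qed.
Lemma measurable_gwt : measurable_fun [set: R * R] (fun p => gwt (toC p)).
Proof.
rewrite /gwt; apply: measurable_funM; last exact: measurable_wt.
apply: measurable_funM; first by apply: measurable_funX; exact: measurable_cmod.
apply: measurable_funX; apply: measurable_funM; last exact: measurable_rhoV.
by apply: (@ucont_measurable _ (fun w => dist w L)) => z; exact: dist_ucont.
Qed.

(** The mass at [u], averaged over a square of side proportional to [rho u] around [u]; as a function of
    [w] it vanishes outside this square. *)
Definition avg_kernel (b : R) (w u : R * R) : R :=
  if (`|u.1 - w.1| <= b * rho (toC u)) && (`|u.2 - w.2| <= b * rho (toC u))
  then gwt (toC u) * (rho (toC u)) ^- 2 else 0.

Lemma avg_kernel_ge0 b w u : 0 <= avg_kernel b w u.
Proof.
by rewrite /avg_kernel; case: ifP => // _; rewrite mulr_ge0 ?gwt_ge0// invr_ge0 exprn_ge0// ltW.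
Qed.

Lemma measurable_avg_kernel b C :
  measurable_fun [set: (R * R) * (R * R)] (fun q => (C * avg_kernel b q.1 q.2)%:E).
Proof.
apply/measurable_EFinP; apply: measurable_funM; first exact: measurable_cst.
have m2 := @measurable_snd _ _ (R * R)%type (R * R)%type.
have m1 := @measurable_fst _ _ (R * R)%type (R * R)%type.
have mr : measurable_fun [set: (R * R) * (R * R)] (fun q => b * rho (toC q.2)).
  apply: measurable_funM; first exact: measurable_cst.
  exact: (measurableT_comp measurable_rho m2).
have n1 : measurable_fun [set: (R * R) * (R * R)] (fun q => `|q.2.1 - q.1.1|).
  apply: measurableT_comp; first exact: normr_measurable.
  by apply: measurable_funB; [exact: (measurableT_comp measurable_fst m2)|exact: (measurableT_comp measurable_fst m1)].
have n2 : measurable_fun [set: (R * R) * (R * R)] (fun q => `|q.2.2 - q.1.2|).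
  apply: measurableT_comp; first exact: normr_measurable.
  by apply: measurable_funB; [exact: (measurableT_comp measurable_snd m2)|exact: (measurableT_comp measurable_snd m1)].
apply: measurable_fun_ifT.
- by apply: measurable_and; apply: measurable_fun_ler.
- have mv : measurable_fun [set: R * R] (fun u => gwt (toC u) * (rho (toC u)) ^- 2).
    apply: measurable_funM; first exact: measurable_gwt.
    rewrite (_ : (fun u => _) = (fun u => ((rho (toC u))^-1) ^+ 2)); last by apply/funext => u; rewrite exprVn.
    by apply: measurable_funX; exact: measurable_rhoV.
  exact: (measurableT_comp mv m2).
- exact: measurable_cst.
Qed.

(** The area mean inequality for [h ^+ 2] on the good annulus around [w], on which dist / rho is bounded
    below while [rho] and 1 + |u| are comparable to their values at [w]. *)
Lemma kernel_bound : exists b C : R, [/\ 0 < b, 0 < C & forall w : R * R,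
  ((wt (toC w) * cmod (h (toC w)) ^+ 2)%:E <= \int[mu2]_u (C * avg_kernel b w u)%:E)%E].
Proof.
have [t [k [K [t0 k0 K1 H]]]] := good_annulus.
have [M M1 HM] := rho_growth rho_pos rho_slow.
have K0 : 0 < K by lra.
have M0 : 0 < M by lra.
(* [w] lies in the square of half-side [b * rho u] around every point [u] of its annulus *)
pose b := 4 * t * K.
have b0 : 0 < b by rewrite !mulr_gt0.
(* 1 + |u| <= A * (1 + |w|) on the annulus *)
pose A := 1 + 8 * t * M * (rho 0 + 1).
have r00 := rho_pos 0.
have A0 : 0 < A by rewrite /A ltr_pwDl// !mulr_ge0//; lra.
pose N : R := 64.
have N0 : 0 < N by rewrite /N; lra.
pose C := (N * K * A / (t * k)) ^+ 2.
have C0 : 0 < C.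
  have i1 := mulr_gt0 t0 k0; have i2 := mulr_gt0 (mulr_gt0 N0 K0) A0.
  by rewrite exprn_gt0// divr_gt0.
exists b, C; split; [exact: b0|exact: C0|move=> -[x0 y0]]; set w := toC (x0, y0).
have [s [s1 s2 Hs]] := H w.
have rw := rho_pos w.
have s0 : 0 < s by apply: lt_le_trans s1; rewrite mulr_gt0// divr_gt0.
have h2e : entire (fun z => h z * h z) by move=> z; apply: (@cdiffM _ h h z); exact: hent.
have am := area_mean w h2e s0.
pose a := wt w * (N / s ^+ 2).
have a0 : 0 < a by rewrite mulr_gt0 ?wt_gt0// divr_gt0// exprn_gt0.
have mh2 : measurable_fun [set: R * R] (fun p => cmod (h (toC p) * h (toC p))).
  rewrite (_ : (fun p => _) = (fun p => cmod (h (toC p)) ^+ 2)); last first.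
    by apply/funext => p; rewrite cmodM expr2.
  by apply: measurable_funX; exact: measurable_cmod.
have man := measurable_sqann w s.
apply: (@le_trans _ _ (a%:E * \int[mu2]_(p in sqann w s) (cmod (h (toC p) * h (toC p)))%:E)%E).
  have -> : wt w * cmod (h w) ^+ 2 = a * (s ^+ 2 / 64 * cmod (h w * h w)).
    by rewrite /a /N cmodM; field; rewrite gt_eqF.
  by rewrite EFinM; apply: lee_wpmul2l => //; rewrite lee_fin ltW.
rewrite -ge0_integralZl//; last 3 first.
- by apply/measurable_EFinP; exact: measurable_funTS.
- by move=> p _; rewrite lee_fin cmod_ge0.
- by rewrite lee_fin ltW.
have mker1 : measurable_fun [set: R * R] (fun p => (C * avg_kernel b (x0, y0) p)%:E).
  exact: (measurableT_comp (measurable_avg_kernel b C) (pair1_measurable (x0, y0))).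
apply: (@le_trans _ _ (\int[mu2]_(p in sqann w s) (C * avg_kernel b (x0, y0) p)%:E)%E); last first.
  apply: ge0_subset_integral; [exact: man|exact: measurableT|exact: mker1| |by []].
  by move=> p _; rewrite lee_fin mulr_ge0 ?avg_kernel_ge0// ltW.
apply: ge0_le_integral.
- exact: man.
- by move=> p _; rewrite -EFinM lee_fin mulr_ge0 ?cmod_ge0// ltW.
- apply: measurable_funTS; apply/measurable_EFinP; apply: measurable_funM; last exact: mh2.
  exact: measurable_cst.
- by apply: measurable_funTS; exact: mker1.
move=> [x y] hxy; rewrite -EFinM lee_fin.
have [i1 i2 i3 i4] := sqann_cmod hxy; have [j1 j2 j3] := Hs _ _ hxy.
set u := toC (x, y); rewrite -[x +i* y]/u in i3 i4 j1 j2 j3.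
have ru := rho_pos u.
have bs : 2 * s <= b * rho u.
  have : 4 * t * rho w <= 4 * t * (K * rho u) by rewrite ler_pM2l// mulr_gt0.
  by rewrite /b; lra.
rewrite /avg_kernel /= -/u (le_trans i1 bs) (le_trans i2 bs) /=.
rewrite cmodM /gwt.
set X := cmod (h u); set q := dist u L / rho u in j1 *.
have cu := one_cmod_gt0 u; have cw := one_cmod_gt0 w.
have cuw : 1 + cmod u <= A * (1 + cmod w).
  have c1 := cmod_distD u w 0; rewrite !subr0 in c1.
  have w0 := cmod_ge0 w.
  have g := HM 0 w; rewrite subr0 in g.
  have : t * rho w <= t * (M * (rho 0 + cmod w)) by rewrite ler_pM2l.
  have tM : 0 < t * M by rewrite mulr_gt0.
  have e1 : 0 <= t * M * (rho 0 * cmod w) by rewrite mulr_ge0 ?(ltW tM)// mulr_ge0// ltW.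
  have e2 : 0 <= t * M * cmod w by rewrite mulr_ge0// ltW.
  have e3 : 0 <= t * M * rho 0 by rewrite mulr_ge0// ltW.
  by rewrite /A; move: e1 e2 e3; rewrite -/(t * M); lra.
have X0 : 0 <= X := cmod_ge0 _.
have q0 : 0 <= q by apply: le_trans j1; exact: ltW.
have b1' : 8 / s <= N * K / (t * rho u).
  rewrite ler_pdivrMr// mulrAC ler_pdivlMr; last by rewrite mulr_gt0.
  have : t * rho u <= t * (K * rho w) by rewrite ler_pM2l.
  have : K * (t / 8 * rho w) <= K * s by rewrite ler_pM2l.
  by rewrite /N; lra.
have b2' : (1 + cmod w)^-1 <= A / (1 + cmod u).
  by rewrite ler_pdivlMr// ler_pdivrMl// mulrC.
have b3' : 1 <= q / k by rewrite ler_pdivlMr// mul1r.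
have p1 : 0 <= 8 / s by rewrite divr_ge0// ltW.
have p2 : 0 <= (1 + cmod w)^-1 by rewrite invr_ge0 ltW.
have b12 := ler_pM p1 p2 b1' b2'.
have b123 := ler_pM (mulr_ge0 p1 p2) ler01 b12 b3'.
have b4 := ler_wpM2l X0 b123.
have -> : a * (X * X) = (X * (8 / s * (1 + cmod w)^-1 * 1)) ^+ 2.
  by rewrite /a /wt /N; field; rewrite !gt_eqF.
have -> : C * (X ^+ 2 * q ^+ 2 * wt u * rho u ^- 2) =
    (X * (N * K / (t * rho u) * (A / (1 + cmod u)) * (q / k))) ^+ 2.
  by rewrite /C /wt; field; rewrite !gt_eqF.
rewrite ler_pXn2r ?nnegrE//; first exact: mulr_ge0 X0 (mulr_ge0 (mulr_ge0 p1 p2) ler01).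
apply: le_trans b4; exact: mulr_ge0 X0 (mulr_ge0 (mulr_ge0 p1 p2) ler01).
Qed.

Lemma avg_kernel_integral (b C : R) (u : R * R) : 0 < b -> 0 < C ->
  (\int[mu2]_w (C * avg_kernel b w u)%:E = (4 * b ^+ 2 * C * gwt (toC u))%:E)%E.
Proof.
move=> b0 C0; case: u => x y; set z := toC (x, y); have rz := rho_pos z.
pose s := b * rho z; have s0 : 0 < s by rewrite mulr_gt0.
pose Q : set (R * R) := `[x - s, x + s]%classic `*` `[y - s, y + s]%classic.
have mQ : measurable Q by exact: measurableX.
have QE (w : R * R) : (w \in Q) = (`|x - w.1| <= s) && (`|y - w.2| <= s).
  case: w => a c /=; apply/idP/idP.
    rewrite inE /Q /= !in_itv /= => -[/andP[h1 h2] /andP[h3 h4]].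
    by rewrite !ler_norml; apply/andP; split; apply/andP; split; lra.
  rewrite !ler_norml => /andP[/andP[h1 h2] /andP[h3 h4]].
  by rewrite inE /Q /= !in_itv /=; split; apply/andP; split; lra.
pose v := C * (gwt z * rho z ^- 2).
have E : (fun w => (C * avg_kernel b w (x, y))%:E) = (fun w => v%:E) \_ Q.
  by apply/funext => w; rewrite /patch QE /avg_kernel /= -/z -/s; case: ifP => // _; rewrite mulr0.
have P : (mu2 Q = mu `[(x - s)%R, (x + s)%R] * mu `[(y - s)%R, (y + s)%R])%E.
  by apply: product_measure1E.
rewrite E -integral_mkcond integral_cst//.
have I (a : R) : mu `[(a - s)%R, (a + s)%R] = (2 * s)%:E.
  rewrite lebesgue_measure_itv /= lte_fin.
  have -> : a - s < a + s by lra.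
  by rewrite -EFinB; congr EFin; ring.
rewrite !I -EFinM in P.
transitivity (v%:E * (2 * s * (2 * s))%:E)%E; first by rewrite -P.
by rewrite -EFinM; congr EFin; rewrite /v /s; field; rewrite gt_eqF.
Qed.

(** The factor (dist / rho)^2 is removed by integrating the kernel bound in [w] first. *)
Lemma weight_integral_fin : (\int[mu2]_u (gwt (toC u))%:E < +oo)%E ->
  (\int[mu2]_w (wt (toC w) * cmod (h (toC w)) ^+ 2)%:E < +oo)%E.
Proof.
move=> fin; have [b [C [b0 C0 H]]] := kernel_bound.
have mk := measurable_avg_kernel b C.
have c0 : 0 <= 4 * b ^+ 2 * C.
  by rewrite mulr_ge0 ?(ltW C0)// mulr_ge0 ?sqr_ge0.
have k0 q : (0 <= (C * avg_kernel b q.1 q.2)%:E)%E.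
  by rewrite lee_fin mulr_ge0 ?avg_kernel_ge0// ltW.
have mF : measurable_fun [set: R * R] (fun w => \int[mu2]_u (C * avg_kernel b w u)%:E)%E.
  exact: (plane_tonelli_measurable mk k0).
apply: (@le_lt_trans _ _ (\int[mu2]_w \int[mu2]_u (C * avg_kernel b w u)%:E)%E).
  apply: ge0_le_integral.
  - exact: measurableT.
  - by move=> w _; rewrite lee_fin mulr_ge0 ?exprn_ge0 ?cmod_ge0// ltW// wt_gt0.
  - apply/measurable_EFinP; apply: measurable_funM; first exact: measurable_wt.
    by apply: measurable_funX; exact: measurable_cmod.
  - exact: mF.
  - by move=> w _; exact: H.
have FT : (\int[mu2]_w \int[mu2]_u (C * avg_kernel b w u)%:E = \int[mu2]_u \int[mu2]_w (C * avg_kernel b w u)%:E)%E.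
  exact: (plane_tonelli mk k0).
rewrite FT.
under eq_integral => u _ do rewrite (avg_kernel_integral u b0 C0) EFinM.
rewrite ge0_integralZl.
- by rewrite lte_mul_pinfty// lee_fin.
- exact: measurableT.
- by apply/measurable_EFinP; exact: measurable_gwt.
- by move=> u _; rewrite lee_fin gwt_ge0.
- by rewrite lee_fin.
Qed.

(** A nonzero value [h z] forces a fixed amount of mass on every large square annulus around [z], by the
    area mean inequality; infinitely many of these annuli are disjoint. *)
Lemma entire_L2_weight_eq0 : (\int[mu2]_u (gwt (toC u))%:E < +oo)%E -> forall z, h z = 0.
Proof.
move=> /weight_integral_fin fin z; apply/eqP; apply: contraT => hz.
pose G p := wt (toC p) * cmod (h (toC p)) ^+ 2.
have G0 p : 0 <= G p by rewrite mulr_ge0 ?exprn_ge0 ?cmod_ge0// ltW// wt_gt0.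
have mG : measurable_fun [set: R * R] (fun p => (G p)%:E).
  apply/measurable_EFinP; apply: measurable_funM; first exact: measurable_wt.
  by apply: measurable_funX; exact: measurable_cmod.
(* 64 comes from the area mean inequality, 25 from 1 + |u| <= 5 * r on the annulus *)
pose N : R := 1600.
pose e := cmod (h z) ^+ 2 / N.
have N0 : 0 < N by rewrite /N; lra.
have e0 : 0 < e by rewrite divr_gt0// exprn_gt0// cmod_gt0.
pose R0 := 1 + cmod z; have R00 : 0 < R0 := one_cmod_gt0 z.
have ann r : R0 <= r -> (e%:E <= \int[mu2]_(p in sqann z r) (G p)%:E)%E.
  move=> Rr; have r0 : 0 < r by apply: lt_le_trans Rr.
  have h2e : entire (fun z => h z * h z) by move=> v; apply: (@cdiffM _ h h v); exact: hent.
  have am := area_mean z h2e r0.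
  have man := measurable_sqann z r.
  pose c := 25 * r ^+ 2; have c0 : 0 < c by rewrite mulr_gt0 ?exprn_gt0.
  have : ((r ^+ 2 / 64 * cmod (h z * h z))%:E <= c%:E * \int[mu2]_(p in sqann z r) (G p)%:E)%E.
    apply: (le_trans am); rewrite -ge0_integralZl; last 4 first.
    - exact: man.
    - exact: measurable_funTS.
    - by move=> p _; rewrite lee_fin.
    - by rewrite lee_fin ltW.
    apply: ge0_le_integral.
    - exact: man.
    - by move=> p _; rewrite lee_fin cmod_ge0.
    - rewrite (_ : (fun p => _) = (fun p => (cmod (h (toC p)) ^+ 2)%:E)); last first.
        by apply/funext => p; rewrite cmodM expr2.
      by apply: measurable_funTS; apply/measurable_EFinP; apply: measurable_funX; exact: measurable_cmod.
    - apply: measurable_funTS; apply/measurable_EFinP; apply: measurable_funM; first exact: measurable_cst.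
      by apply/measurable_EFinP; exact: mG.
    move=> [x y] hxy; rewrite -EFinM lee_fin cmodM -expr2 /G.
    have [_ _ _ i4] := sqann_cmod hxy; set u := toC (x, y); rewrite -[x +i* y]/u in i4.
    have cu := one_cmod_gt0 u.
    have c1 : 1 + cmod u <= 5 * r.
      by have := cmod_distD u z 0; rewrite !subr0; move: Rr; rewrite /R0; lra.
    have c2 : (1 + cmod u) ^+ 2 <= c.
      have -> : c = (5 * r) ^+ 2 by rewrite /c; ring.
      by rewrite ler_pXn2r ?nnegrE//; lra.
    rewrite mulrA ler_peMl ?exprn_ge0 ?cmod_ge0//.
    by rewrite /wt ler_pdivlMr ?exprn_gt0// mul1r.
  rewrite -lee_pdivrMl//; apply: le_trans; rewrite -EFinM lee_fin le_eqVlt; apply/orP; left; apply/eqP.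
  by rewrite /e /c /N cmodM; field; rewrite gt_eqF.
pose D n := [set p : R * R | supdist z (toC p) < R0 * 3 ^+ n].
have mD n : measurable (D n).
  have -> : D n = (fun p => supdist z (toC p)) @^-1` `]-oo, R0 * 3 ^+ n[.
    by apply/seteqP; split => p; rewrite /D /= in_itv.
  by rewrite -[X in measurable X]setTI; apply: (ucont_measurable (supdist_ucont z)).
have grow n : ((n%:R * e)%:E <= \int[mu2]_(p in D n) (G p)%:E)%E.
  elim: n => [|n IH].
    by rewrite mul0r; apply: integral_ge0 => p _; rewrite lee_fin.
  pose r := R0 * 3 ^+ n.
  have p3 : (1 : R) <= 3 ^+ n by rewrite exprn_ege1//; lra.
  have Rr : R0 <= r by rewrite /r ler_peMr// ltW.
  have sub : D n `|` sqann z r `<=` D n.+1.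
    rewrite /D /sqann => p [] /=; rewrite exprS => hp.
      apply: lt_trans hp _; rewrite -/r; have -> : R0 * (3 * 3 ^+ n) = 3 * r by rewrite /r; ring.
      lra.
    case/andP: hp => _ hp; have -> : R0 * (3 * 3 ^+ n) = 3 * r by rewrite /r; ring.
    by apply: le_lt_trans hp _; lra.
  have disj : [disjoint D n & sqann z r].
    rewrite disj_set2E; apply/eqP/seteqP; split => // p [].
    by rewrite /D /sqann /= -/r => h1 /andP[h2 _]; move: h1; rewrite ltNge h2.
  have man := measurable_sqann z r.
  apply: (@le_trans _ _ (\int[mu2]_(p in D n `|` sqann z r) (G p)%:E)%E); last first.
    apply: ge0_subset_integral.
    - by apply: measurableU; [exact: mD|exact: man].
    - exact: mD.
    - exact: measurable_funTS.
    - by move=> p _; rewrite lee_fin.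
    - exact: sub.
  rewrite ge0_integral_setU; last 5 first.
  - exact: mD.
  - exact: man.
  - exact: measurable_funTS.
  - by move=> p _; rewrite lee_fin.
  - exact: disj.
  have -> : n.+1%:R * e = n%:R * e + e by rewrite -natr1; ring.
  by rewrite EFinD; apply: leeD => //; exact: ann.
have bnd n : ((n%:R * e)%:E <= \int[mu2]_p (G p)%:E)%E.
  apply: (le_trans (grow n)); apply: ge0_subset_integral;
    [exact: mD|exact: measurableT|exact: mG| |by []].
  by move=> p _; rewrite lee_fin.
have I0 : (0 <= \int[mu2]_p (G p)%:E)%E by apply: integral_ge0 => p _; rewrite lee_fin.
have If : (\int[mu2]_p (G p)%:E)%E \is a fin_num by rewrite ge0_fin_numE.
exfalso.
set I := fine (\int[mu2]_p (G p)%:E)%E.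
have bI n : n%:R * e <= I by rewrite -lee_fin /I fineK.
have I0' : 0 <= I / e by rewrite divr_ge0 ?(ltW e0)// /I fine_ge0.
have := archi_boundP I0'; rewrite ltr_pdivrMr// => h1.
by have := bI (Num.bound (I / e)); rewrite leNgt h1.
Qed.

End KeyLemma.

(** * Integrability of negative powers *)

Section Decay.
Context {R : realType}.
Local Notation mu := (@lebesgue_measure R).
Local Notation mu2 := (mu \x mu)%E.
Variable b : R.
Hypothesis b1 : 1 < b.

Definition decay (x : R) : R := (1 + `|x|) `^ (- b).

Lemma is_derive_powR_shift (a x : R) : 0 < 1 + x ->
  is_derive x 1 (fun t => (1 + t) `^ a) (a * (1 + x) `^ (a - 1)).
Proof.
move=> x0.
have A := is_derive_addl (1 : R) x.
have P := is_derive1_powR a x0.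
by have := @is_derive1_comp _ (fun y => y `^ a) (fun s => 1 + s) x _ _ P A; rewrite mulr1.
Qed.

Lemma decay_continuous : continuous decay.
Proof.
move=> x; have x0 : 0 < 1 + `|x| by rewrite ltr_wpDr.
have H : {for `|x|, continuous (fun t : R => (1 + t) `^ (- b))}.
  apply: differentiable_continuous; apply/derivable1_diffP.
  by case: (is_derive_powR_shift (- b) x0).
apply: (@continuous_comp _ _ _ (fun x : R => `|x|) (fun t => (1 + t) `^ (- b))).
  exact: norm_continuous.
exact: H.
Qed.

Lemma powR_cvg0 (a : R) : 0 < a -> (1 + x) `^ (- a) @[x --> +oo%R] --> (0 : R).
Proof.
move=> a0; apply/cvgrPdist_le => e e0; near=> x.
have x0 : 0 < x by near: x; apply: nbhs_pinfty_gt; rewrite num_real.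
have hx : (e^-1) `^ (a^-1) <= 1 + x.
  have : (e^-1) `^ (a^-1) <= x by near: x; apply: nbhs_pinfty_ge; rewrite num_real.
  lra.
rewrite sub0r normrN ger0_norm ?powR_ge0// powRN.
have e1 : 0 < e^-1 by rewrite invr_gt0.
rewrite -[leRHS]invrK lef_pV2 ?posrE ?powR_gt0//; last lra.
have -> : e^-1 = ((e^-1) `^ (a^-1)) `^ a.
  by rewrite -powRrM mulVf ?gt_eqF// powRr1// ltW.
by apply: ge0_ler_powR; rewrite ?nnegrE ?powR_ge0 ?(ltW a0)//; lra.
Unshelve. all: by end_near. Qed.

Lemma decay_integral : (\int[mu]_x (decay x)%:E < +oo)%E.
Proof.
rewrite ge0_symfun_integralT; last 3 first.
- by move=> x; exact: powR_ge0.
- exact: decay_continuous.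
- by move=> x; rewrite /decay /= normrN.
apply: lte_mul_pinfty => //.
pose F x : R := (1 + x) `^ (1 - b) / (1 - b).
have bn : 1 - b < 0 by rewrite subr_lt0.
have b0 : 1 - b != 0 by rewrite lt_eqF.
have dF (x : R) : 0 <= x -> is_derive x 1 F ((1 + x) `^ (- b)).
  move=> x0; have x1 : 0 < 1 + x by lra.
  have D := is_deriveM (is_derive_powR_shift (1 - b) x1) (is_derive_cst ((1 - b)^-1) x 1).
  set kk := (X in is_derive _ _ _ X) in D.
  have <- : kk = (1 + x) `^ (- b).
    have -> : kk = (1 + x) `^ (1 - b) * 0 + (1 - b)^-1 * ((1 - b) * (1 + x) `^ (1 - b - 1)) by [].
    by rewrite mulr0 add0r mulKf//; congr (_ `^ _); ring.
  exact: D.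
rewrite -set_itvcy (@ge0_continuous_FTC2y _ decay F 0 0).
- by rewrite -EFinB ltry.
- by move=> x _; exact: powR_ge0.
- by apply: continuous_subspaceT; exact: decay_continuous.
- have : (1 + x) `^ (- (b - 1)) / (1 - b) @[x --> +oo%R] --> (0 / (1 - b) : R).
    by apply: cvgMr_tmp; apply: powR_cvg0; rewrite subr_gt0.
  by rewrite mul0r opprB.
- by move=> x x0; case: (dF x (ltW x0)).
- have /differentiable_continuous : differentiable F 0 by apply/derivable1_diffP; case: (dF 0 (lexx _)).
  exact: cvg_at_right_filter.
- move=> x; rewrite in_itv /= andbT => x0; rewrite derive1E.
  have D := dF x (ltW x0); by rewrite (@derive_val _ _ _ _ _ _ _ D) /decay ger0_norm// ltW.
Qed.

Lemma measurable_decay2 : measurable_fun [set: R * R] (fun p => (decay p.1 * decay p.2)%:E).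
Proof.
have md : measurable_fun [set: R] decay by exact: (continuous_measurable_fun decay_continuous).
apply/measurable_EFinP; apply: measurable_funM.
  exact: (measurableT_comp md measurable_fst).
exact: (measurableT_comp md measurable_snd).
Qed.

(** The plane integrals of negative powers of 1 + |z| reduce to the line by a product majorant. *)
Lemma decay_integral2 : (\int[mu2]_p (decay p.1 * decay p.2)%:E < +oo)%E.
Proof.
have md : measurable_fun [set: R] decay by exact: (continuous_measurable_fun decay_continuous).
have d0 x : 0 <= decay x by exact: powR_ge0.
have m2 := measurable_decay2.
rewrite fubini_tonelli1//; last by move=> p; rewrite lee_fin mulr_ge0.
have I0 : (0 <= \int[mu]_x (decay x)%:E)%E by apply: integral_ge0 => x _; rewrite lee_fin.
have If : (\int[mu]_x (decay x)%:E)%E \is a fin_num by rewrite ge0_fin_numE// decay_integral.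
have mE : measurable_fun [set: R] (fun x => (decay x)%:E) by apply/measurable_EFinP.
have E x : (\int[mu]_y (decay x * decay y)%:E = (decay x)%:E * \int[mu]_y (decay y)%:E)%E.
  rewrite -ge0_integralZl; [|exact: measurableT|exact: mE|by move=> y _; rewrite lee_fin|by rewrite lee_fin].
  by apply: eq_integral => y _; rewrite EFinM.
apply: (@le_lt_trans _ _ (\int[mu]_x ((decay x)%:E * \int[mu]_y (decay y)%:E))%E).
  rewrite le_eqVlt; apply/orP; left; apply/eqP; apply: eq_integral => x _; exact: E.
rewrite ge0_integralZr; [|exact: measurableT|exact: mE|by move=> y _; rewrite lee_fin|exact: I0].
by apply: lte_mul_pinfty => //; exact: decay_integral.
Qed.

Lemma decay_cmod (z : R[i]) : ((1 + cmod z) `^ (- b)) ^+ 2 <= decay (re z) * decay (im z).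
Proof.
have c := cmod_ge0 z; have b0 : 0 <= b by exact: le_trans ler01 (ltW b1).
have H t : 0 <= t -> t <= cmod z -> (1 + cmod z) `^ (- b) <= (1 + t) `^ (- b).
  move=> t0 tz; rewrite !powRN lef_pV2 ?posrE ?powR_gt0; try lra.
  by apply: ge0_ler_powR; rewrite ?nnegrE; lra.
rewrite expr2; apply: ler_pM; rewrite ?powR_ge0//.
- by apply: H; [exact: normr_ge0|exact: re_le_cmod].
- by apply: H; [exact: normr_ge0|exact: im_le_cmod].
Qed.

End Decay.

(** * Division by S in the Fock space *)

Section FockClass.
Context {R : realType}.
Local Notation mu := (@lebesgue_measure R).
Local Notation mu2 := (mu \x mu)%E.
Variables (phi : R -> R) (rho : R[i] -> R) (gamma : R) (S : R[i] -> R[i]).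
Local Notation L := (zero_set S).
Hypothesis rho_pos : forall z, 0 < rho z.
Hypothesis rho_slow : exists eps K : R, [/\ 0 < eps, 1 <= K &
  forall z w, cmod (w - z) <= eps * rho z -> rho w <= K * rho z /\ rho z <= K * rho w].
Hypothesis rho_uc : forall z, ucont rho z.
Hypothesis phi_uc : forall z, ucont (radial phi) z.
Hypothesis phi_ge : forall z, phi 0 <= phi (cmod z).
Hypothesis phi_lap : forall z, has_lap (radial phi) z ((rho z) ^- 2).
Hypothesis Sent : entire S.
Hypothesis Sbound : exists2 c : R, 0 < c & forall z,
  cmod (S z) <= c * (expR (phi (cmod z)) * (dist z L / rho z) * (1 / (1 + cmod z) `^ gamma)) /\
  expR (phi (cmod z)) * (dist z L / rho z) * (1 / (1 + cmod z) `^ gamma) <= c * cmod (S z).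
Hypothesis sep : exists2 delta : R, 0 < delta & forall l m, L l -> L m -> l <> m ->
  delta * Num.min (rho l) (rho m) <= cmod (l - m).

(** Separation compares the gap with the smaller of the two values of [rho]; nearby, this one is
    comparable to [rho l]. *)
Lemma isolated_zeros l : L l -> exists2 eta : R, 0 < eta & forall m, L m -> m <> l -> eta <= cmod (m - l).
Proof.
move=> Ll; have [eps [K [e0 K1 H]]] := rho_slow; have [delta d0 Hs] := sep.
have rl := rho_pos l; have K0 : 0 < K by lra.
have i1 : 0 < eps * rho l by rewrite mulr_gt0.
have i2 : 0 < delta * (rho l / K) by rewrite mulr_gt0// divr_gt0.
exists (Num.min (eps * rho l) (delta * (rho l / K))); first by rewrite lt_min i1 i2.
move=> m Lm ml; rewrite ge_min.
have [h|h] := lerP (cmod (m - l)) (eps * rho l); last by rewrite (ltW h).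
apply/orP; right; have [h1 h2] := H _ _ h.
apply: le_trans (Hs m l Lm Ll ml); rewrite ler_pM2l// le_min ler_pdivrMr// (mulrC (rho m)) h2 /=.
by rewrite ler_pdivrMr// ler_peMr// ltW.
Qed.

Lemma expphi_ge z : expR (phi 0) <= expR (phi (cmod z)).
Proof. by rewrite ler_expR. Qed.

(** Near a zero [l] the distance to the zero set is |w - l|, all the zeros being isolated, and the lower
    bound on [S] then forces its growth to be linear there. *)
Lemma simple_zeros l : S l = 0 -> exists2 k : R, 0 < k & exists2 d : R, 0 < d &
  forall w, cmod (w - l) < d -> k * cmod (w - l) <= cmod (S w).
Proof.
move=> Sl; have [eta eta0 Heta] := isolated_zeros Sl.
have [eps [K [e0 K1 H]]] := rho_slow; have [c c0 Hc] := Sbound.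
have rl := rho_pos l; have K0 : 0 < K by lra.
have i1 : 0 < eps * rho l by rewrite mulr_gt0.
have cl := cmod_ge0 l.
pose B := 2 + cmod l; have B1 : 1 <= B by rewrite /B; lra.
have P0 : 0 < B `^ `|gamma| by rewrite powR_gt0//; lra.
pose k := c^-1 * (expR (phi 0) * (K * rho l)^-1 * (B `^ `|gamma|)^-1).
have Kr : 0 < K * rho l by rewrite mulr_gt0.
have E0 := expR_gt0 (phi 0).
have k0 : 0 < k by rewrite !mulr_gt0 ?invr_gt0.
exists k => //.
exists (Num.min (Num.min (eta / 2) 1) (eps * rho l)).
  by rewrite !lt_min i1 ltr01 divr_gt0.
move=> w; rewrite !lt_min => /andP[/andP[w1 w2] w3].
have dw : cmod (w - l) <= dist w L.
  apply: dist_ge; first by exists l.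
  move=> m Lm; have [->//|/eqP ml] := eqVneq m l.
  have := Heta m Lm ml; have := cmod_distD m w l; rewrite (cmodC m w); lra.
have [h1 _] := H _ _ (ltW w3).
have rw := rho_pos w; have cw := cmod_ge0 w.
have wB : 1 + cmod w <= B by have := cmod_lerB w l; rewrite /B; lra.
have c1 : 1 <= 1 + cmod w by lra.
have pw : 0 < (1 + cmod w) `^ gamma by rewrite powR_gt0//; lra.
have p1 : (B `^ `|gamma|)^-1 <= 1 / (1 + cmod w) `^ gamma.
  rewrite div1r lef_pV2 ?posrE//.
  apply: (le_trans (ler_powR c1 (ler_norm gamma))).
  by apply: ge0_ler_powR; rewrite ?nnegrE//; lra.
have [_ h2] := Hc w.
rewrite /k -[leLHS]mulrA ler_pdivrMl//; apply: le_trans h2.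
have q1 : (K * rho l)^-1 * cmod (w - l) <= dist w L / rho w.
  rewrite mulrC; apply: ler_pM => //; rewrite ?cmod_ge0 ?invr_ge0 ?(ltW Kr)//.
  by rewrite lef_pV2 ?posrE.
have q0 : 0 <= (K * rho l)^-1 * cmod (w - l) by rewrite mulr_ge0 ?cmod_ge0// invr_ge0 ltW.
have E1 := expphi_ge w.
have -> : expR (phi 0) / (K * rho l) / B `^ `|gamma| * cmod (w - l) =
   expR (phi 0) * ((K * rho l)^-1 * cmod (w - l)) * (B `^ `|gamma|)^-1 by ring.
apply: ler_pM => //; first by rewrite mulr_ge0 // ltW.
- by rewrite invr_ge0 ltW.
- by apply: ler_pM => //; exact: ltW.
Qed.

(** The distance to the empty set is 0: without zeros, [S] would vanish by the upper bound. *)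
Lemma zero_set_neq0 : L !=set0.
Proof.
apply/set0P/negP => /eqP L0; have [c c0 Hc] := Sbound; have [h _] := Hc 0.
have S0 : S 0 != 0 by apply/eqP => S0; have : L 0 by []; rewrite L0.
move: h; rewrite L0 /dist image_set0 inf0 mul0r mulr0 mul0r mulr0.
by rewrite leNgt cmod_gt0 S0.
Qed.

Lemma S_nonzero : exists z, S z != 0.
Proof.
have [l Ll] := zero_set_neq0; have [k k0 [d d0 Hd]] := simple_zeros Ll.
exists (l + (d / 2)%:C); rewrite -cmod_gt0.
have cs : cmod ((l + (d / 2)%:C) - l) = d / 2.
  by rewrite addrC addKr cmod_real ger0_norm//; lra.
have := Hd (l + (d / 2)%:C); rewrite cs => /(_ (ltac:(lra))); apply: lt_le_trans.
by rewrite mulr_gt0// divr_gt0.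
Qed.

Lemma fock_measurable f : entire f ->
  measurable_fun [set: R * R]
    (fun p => cmod (f (p.1 +i* p.2)) ^+ 2 * expR (- 2 * phi (cmod (p.1 +i* p.2)))).
Proof.
move=> fe; apply: measurable_funM.
  apply: measurable_funX; apply: (@ucont_measurable _ (fun w => cmod (f w))) => z.
  by apply: cmod_ucont; apply: cdiff_cont; exact: fe.
apply: (@measurableT_comp _ _ _ _ _ _ (@expR R)); first exact: measurable_expR.
apply: measurable_funM; first exact: measurable_cst.
exact: (ucont_measurable phi_uc).
Qed.

Lemma fock_of_bound f b C : entire f -> 1 < b ->
  (forall z, cmod (f z) <= C * (expR (phi (cmod z)) * (1 + cmod z) `^ (- b))) -> fock phi f.
Proof.
move=> fe b1 H; split => //.
have dfin := decay_integral2 b1.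
have d0 x : 0 <= decay b x by exact: powR_ge0.
have m2 := measurable_decay2 b.
apply: (@le_lt_trans _ _ (\int[mu2]_p ((C ^+ 2)%:E * (decay b p.1 * decay b p.2)%:E))%E); last first.
  rewrite ge0_integralZl; [|exact: measurableT|exact: m2| |].
  - by apply: lte_mul_pinfty => //; rewrite lee_fin sqr_ge0.
  - by move=> p _; rewrite lee_fin mulr_ge0.
  - by rewrite lee_fin sqr_ge0.
apply: ge0_le_integral.
- exact: measurableT.
- by move=> p _; rewrite lee_fin mulr_ge0 ?sqr_ge0// expR_ge0.
- by apply/measurable_EFinP; exact: fock_measurable.
- under eq_fun do rewrite -EFinM; apply/measurable_EFinP; apply: measurable_funM; first exact: measurable_cst.
  by apply/measurable_EFinP.
move=> [x y] _; rewrite -EFinM lee_fin /=; set z := x +i* y.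
have D := decay_cmod b1 z; rewrite /= in D.
have E0 := expR_gt0 (phi (cmod z)).
have -> : expR (-2 * phi (cmod z)) = (expR (phi (cmod z)) ^+ 2)^-1.
  by rewrite mulNr expRN expRM_natl.
rewrite ler_pdivrMr ?exprn_gt0//.
apply: (@le_trans _ _ ((C * (expR (phi (cmod z)) * (1 + cmod z) `^ (- b))) ^+ 2)).
  have h := H z; rewrite ler_pXn2r ?nnegrE ?cmod_ge0//.
  exact: le_trans (cmod_ge0 _) h.
rewrite exprMn (exprMn _ (expR _)) -[leRHS]mulrA; apply: ler_wpM2l; first exact: sqr_ge0.
by rewrite [leRHS]mulrC; apply: ler_wpM2l; [exact: sqr_ge0|exact: D].
Qed.

Lemma S_upper : 0 < gamma -> exists C : R, 0 < C /\ forall z,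
  cmod (S z) <= C * (expR (phi (cmod z)) * (1 + cmod z) `^ (- gamma)).
Proof.
move=> g0; have [c c0 Hc] := Sbound.
have [A A0 HA] := dist_le_rho rho_pos rho_slow phi_uc phi_lap Sent Sbound g0.
exists (c * A); split; first by rewrite mulr_gt0.
move=> z; have [h _] := Hc z; apply: (le_trans h).
have rz := rho_pos z; have E0 := expR_ge0 (phi (cmod z)).
have dA : dist z L / rho z <= A by rewrite ler_pdivrMr.
rewrite -[leRHS]mulrA ler_pM2l// powRN div1r [leRHS]mulrA.
apply: ler_wpM2r; first by rewrite invr_ge0 powR_ge0.
by rewrite [leRHS]mulrC; apply: ler_wpM2l.
Qed.

Lemma S_fock : 1 < gamma -> fock phi S.
Proof.
move=> g1; have g0 : 0 < gamma by lra.
have [C [_ HC]] := S_upper g0; exact: fock_of_bound Sent g1 HC.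
Qed.

(** Far from [l] the division by w - l improves the decay exponent of [S] from [gamma] to gamma + 1 > 1;
    near [l] the quotient is bounded by continuity. *)
Lemma quotient_fock l q : 0 < gamma -> S l = 0 -> entire q -> (forall w, S w = (w - l) * q w) ->
  forall a : R[i], fock phi (fun w => a * q w).
Proof.
move=> g0 Sl qe Sq a; have [C [C0 HC]] := S_upper g0.
have b1 : 1 < gamma + 1 by lra.
have [M HM] : exists M : R, forall x y, re l - 1 <= x <= re l + 1 -> im l - 1 <= y <= im l + 1 ->
    cmod (q (x +i* y)) <= M.
  apply: ccont_bounded; [lra|lra|].
  by move=> x y _ _; apply: cdiff_cont; exact: qe.
have cl := cmod_ge0 l.
pose B := 2 + cmod l; have B0 : 0 < B by rewrite /B; lra.
have E0 := expR_gt0 (phi 0).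
have M0 : 0 <= M.
  by apply: le_trans (cmod_ge0 _) (HM (re l) (im l) _ _); apply/andP; split; lra.
have PB : 0 < B `^ (gamma + 1) by rewrite powR_gt0.
pose D := C * B + M * B `^ (gamma + 1) / expR (phi 0).
have D0 : 0 <= M * B `^ (gamma + 1) / expR (phi 0).
  by rewrite divr_ge0 ?(ltW E0)// mulr_ge0// ltW.
have CB : 0 <= C * B by rewrite mulr_ge0// ltW.
have aqe : entire (fun w => a * q w).
  by move=> z; apply: (@cdiffM _ (fun=> a) q z); [exact: cdiff_cst|exact: qe].
apply: (fock_of_bound (C := cmod a * D) aqe b1).
move=> z; rewrite cmodM -mulrA; apply: ler_wpM2l; first exact: cmod_ge0.
have cz := cmod_ge0 z; have cp : 0 < 1 + cmod z by lra.
have Ez := expR_gt0 (phi (cmod z)).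
have pz : 0 < (1 + cmod z) `^ (- (gamma + 1)) by rewrite powR_gt0.
have [h|h] := lerP 1 (cmod (z - l)).
- apply: (@le_trans _ _ (C * B * (expR (phi (cmod z)) * (1 + cmod z) `^ (- (gamma + 1))))); last first.
    by rewrite ler_pM2r ?mulr_gt0// /D lerDl.
  have zB : 1 + cmod z <= B * cmod (z - l).
    have h1 := cmod_lerB z l.
    have : (1 + cmod l) * 1 <= (1 + cmod l) * cmod (z - l) by rewrite ler_wpM2l//; lra.
    by rewrite /B; lra.
  have := HC z; rewrite Sq cmodM => hz.
  have p1 : 0 < cmod (z - l) by lra.
  rewrite -(ler_pM2l p1); apply: (le_trans hz).
  have -> : (1 + cmod z) `^ (- gamma) = (1 + cmod z) * (1 + cmod z) `^ (- (gamma + 1)).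
    rewrite -{2}[1 + cmod z]powRr1 ?(ltW cp)// -powRD; last by rewrite (gt_eqF cp) implybT.
    by congr (_ `^ _); ring.
  have -> : cmod (z - l) * (C * B * (expR (phi (cmod z)) * (1 + cmod z) `^ (- (gamma + 1)))) =
    C * (expR (phi (cmod z)) * ((B * cmod (z - l)) * (1 + cmod z) `^ (- (gamma + 1)))) by ring.
  by rewrite ler_pM2l// ler_pM2l// ler_pM2r.
- apply: (@le_trans _ _ (M * B `^ (gamma + 1) / expR (phi 0) * (expR (phi (cmod z)) * (1 + cmod z) `^ (- (gamma + 1))))); last first.
    by rewrite ler_pM2r ?mulr_gt0// /D lerDr.
  have qM : cmod (q z) <= M.
    have := le_lt_trans (re_le_cmod _) h; have := le_lt_trans (im_le_cmod _) h.
    rewrite reD reN imD imN !ltr_norml => /andP[y1 y2] /andP[x1 x2].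
    by have := HM (re z) (im z) _ _; case: (z) x1 x2 y1 y2 => x y /= x1 x2 y1 y2; apply; lra.
  apply: (le_trans qM).
  have zB : 1 + cmod z <= B by have := cmod_lerB z l; rewrite /B; lra.
  have PP : (B `^ (gamma + 1))^-1 <= (1 + cmod z) `^ (- (gamma + 1)).
    rewrite powRN lef_pV2 ?posrE ?powR_gt0//.
    by apply: ge0_ler_powR; rewrite ?nnegrE; lra.
  have EE := expphi_ge z.
  have -> : M * B `^ (gamma + 1) / expR (phi 0) * (expR (phi (cmod z)) * (1 + cmod z) `^ (- (gamma + 1))) =
    M * ((expR (phi (cmod z)) / expR (phi 0)) * (B `^ (gamma + 1) * (1 + cmod z) `^ (- (gamma + 1)))) by ring.
  rewrite ler_peMr//; have e1 : 1 <= expR (phi (cmod z)) / expR (phi 0) by rewrite ler_pdivlMr// mul1r.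
  have e2 : 1 <= B `^ (gamma + 1) * (1 + cmod z) `^ (- (gamma + 1)).
    by rewrite mulrC -ler_pdivrMr// div1r.
  by rewrite mulr_ege1.
Qed.

(** The form in which the Liouville property of the density [gwt] applies to a quotient [h] of a
    Fock function [f] by [S]. *)
Lemma quotient_eq0 f h C : fock phi f -> entire h ->
  (forall z, gwt rho L h z <= C * (cmod (f z) ^+ 2 * expR (- 2 * phi (cmod z)))) ->
  forall z, h z = 0.
Proof.
move=> [fe ffin] he H; apply: (entire_L2_weight_eq0 rho_pos rho_slow rho_uc zero_set_neq0 sep he).
have mf := fock_measurable fe.
have f0 p : 0 <= cmod (f (toC p)) ^+ 2 * expR (- 2 * phi (cmod (toC p))).
  by rewrite mulr_ge0 ?sqr_ge0// expR_ge0.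
have C0 : 0 <= Num.max C 0 by rewrite le_max lexx orbT.
apply: (@le_lt_trans _ _ (\int[mu2]_p ((Num.max C 0)%:E * (cmod (f (toC p)) ^+ 2 * expR (- 2 * phi (cmod (toC p))))%:E))%E).
  apply: ge0_le_integral.
  - exact: measurableT.
  - by move=> p _; rewrite lee_fin gwt_ge0.
  - by apply/measurable_EFinP; exact: measurable_gwt.
  - under eq_fun do rewrite -EFinM; apply/measurable_EFinP; apply: measurable_funM => //.
  - move=> p _; rewrite -EFinM lee_fin; apply: (le_trans (H _)).
    by rewrite ler_wpM2r// le_max lexx.
rewrite ge0_integralZl; [|exact: measurableT|by apply/measurable_EFinP| |by rewrite lee_fin].
- by apply: lte_mul_pinfty; [rewrite lee_fin| |exact: ffin].
- by move=> p _; rewrite lee_fin.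
Qed.

(** The lower bound on [S], squared. *)
Lemma gwt_bound h : exists2 c : R, 0 < c & forall z,
  cmod (h z) ^+ 2 * (dist z L / rho z) ^+ 2 <=
    c * (cmod (S z * h z) ^+ 2 * expR (- 2 * phi (cmod z))) * ((1 + cmod z) `^ gamma) ^+ 2.
Proof.
have [c c0 Hc] := Sbound; exists (c ^+ 2); first by rewrite exprn_gt0.
move=> z; have [_ hz] := Hc z.
have E0 := expR_gt0 (phi (cmod z)).
have -> : expR (-2 * phi (cmod z)) = (expR (phi (cmod z)) ^+ 2)^-1.
  by rewrite mulNr expRN expRM_natl.
have rz := rho_pos z; have d0 := dist_ge0 z L; have cz := cmod_ge0 z.
have P0 : 0 < (1 + cmod z) `^ gamma by rewrite powR_gt0//; lra.
set q := dist z L / rho z in hz *; have q0 : 0 <= q by rewrite divr_ge0// ltW.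
have qS : q <= c * cmod (S z) / expR (phi (cmod z)) * (1 + cmod z) `^ gamma.
  rewrite mulrAC ler_pdivlMr// -ler_pdivrMr//.
  by apply: le_trans hz; rewrite div1r (mulrC q).
have q2 : q ^+ 2 <= (c * cmod (S z) / expR (phi (cmod z)) * (1 + cmod z) `^ gamma) ^+ 2.
  by rewrite ler_pXn2r ?nnegrE//; exact: le_trans qS.
rewrite cmodM.
have -> : c ^+ 2 * ((cmod (S z) * cmod (h z)) ^+ 2 / expR (phi (cmod z)) ^+ 2) * ((1 + cmod z) `^ gamma) ^+ 2
  = cmod (h z) ^+ 2 * (c * cmod (S z) / expR (phi (cmod z)) * (1 + cmod z) `^ gamma) ^+ 2.
  by field; rewrite gt_eqF.
by rewrite ler_wpM2l ?sqr_ge0.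
Qed.

(** For [gamma <= 1] the loss in the lower bound on [S] is at most the factor 1 + |z| of the Liouville
    theorem, which kills f / S. *)
Lemma uniqueness_of_le1 : gamma <= 1 -> uniqueness_set phi L.
Proof.
move=> g1 f ff f0.
have [h he fSh] := divide_entire ff.1 Sent f0 simple_zeros.
have [c c0 Hc] := gwt_bound h.
have h0 : forall z, h z = 0.
  apply: (quotient_eq0 (C := c) ff he) => z; rewrite /gwt.
  have cz := cmod_ge0 z; have cp : 0 < 1 + cmod z by lra.
  have P : (1 + cmod z) `^ gamma <= 1 + cmod z.
    rewrite -[leRHS]powRr1 ?(ltW cp)//; apply: ler_powR => //; lra.
  have P2 : ((1 + cmod z) `^ gamma) ^+ 2 <= (1 + cmod z) ^+ 2.
    by rewrite ler_pXn2r ?nnegrE ?powR_ge0// ltW.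
  rewrite /wt ler_pdivrMr ?exprn_gt0//; apply: (le_trans (Hc z)); rewrite -fSh.
  by rewrite ler_wpM2l// mulr_ge0 ?(ltW c0)// mulr_ge0 ?sqr_ge0 ?expR_ge0.
by move=> z; rewrite fSh h0 mulr0.
Qed.

(** For [gamma > 1] the function [S] itself is a Fock function vanishing on [L]. *)
Lemma uniqueness_iff : uniqueness_set phi L <-> gamma <= 1.
Proof.
split; last exact: uniqueness_of_le1.
move=> U; rewrite leNgt; apply/negP => g1.
have [z /eqP Sz] := S_nonzero; apply: Sz.
by apply: (U S (S_fock g1)) => l.
Qed.

(** The interpolating function is a multiple of S / (w - l). *)
Lemma weak_interpolation_of_gt0 : 0 < gamma -> weak_interpolation_set phi L.
Proof.
move=> g0 l Ll; have [q [qe ql Sq]] := factor_simple_root Sent Ll (simple_zeros Ll).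
exists (fun w => (q l)^-1 * q w); split.
- exact: quotient_fock g0 Ll qe Sq _.
- by rewrite mulVf.
- move=> m Lm ml; have := Lm; rewrite /zero_set /= Sq => /eqP; rewrite mulf_eq0 subr_eq0.
  by case/orP => /eqP h; [case: ml|rewrite h mulr0].
Qed.

(** If [f] peaks at [l] then (w - l) * f w = S w * h w with [h] entire. For [gamma <= 0] the factor w - l
    is absorbed by the weight of the Liouville theorem, so that [h] and then [f] vanish off [l], which
    contradicts the continuity of [f]. *)
Lemma weak_interpolation_iff : weak_interpolation_set phi L <-> 0 < gamma.
Proof.
split; last exact: weak_interpolation_of_gt0.
move=> W; rewrite ltNge; apply/negP => g0.
have [l Ll] := zero_set_neq0; have [f [ff fl f0]] := W l Ll.
have ge : entire (fun w => (w - l) * f w).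
  move=> z; apply: (@cdiffM _ (fun w => w - l) f z); last exact: ff.1.
  by apply: cdiffB; [exact: cdiff_id|exact: cdiff_cst].
have gz m : S m = 0 -> (m - l) * f m = 0.
  move=> Sm; have [->|/eqP ml] := eqVneq m l; first by rewrite subrr mul0r.
  by rewrite f0 ?mulr0.
have [h he gSh] := divide_entire ge Sent gz simple_zeros.
have [c c0 Hc] := gwt_bound h.
have cl := cmod_ge0 l.
have h0 : forall z, h z = 0.
  apply: (quotient_eq0 (C := c * (1 + cmod l) ^+ 2) ff he) => z; rewrite /gwt.
  have cz := cmod_ge0 z; have cp : 0 < 1 + cmod z by lra.
  have P : (1 + cmod z) `^ gamma <= 1.
    rewrite -[leRHS](powRr0 (1 + cmod z)); apply: ler_powR => //; lra.
  have P2 : ((1 + cmod z) `^ gamma) ^+ 2 <= 1 by rewrite exprn_ile1 ?powR_ge0.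
  rewrite /wt ler_pdivrMr ?exprn_gt0//; apply: (le_trans (Hc z)); rewrite -gSh cmodM.
  have X0 : 0 <= cmod (f z) ^+ 2 * expR (-2 * phi (cmod z)) by rewrite mulr_ge0 ?sqr_ge0 ?expR_ge0.
  set X := cmod (f z) ^+ 2 * _ in X0 *.
  have zl : cmod (z - l) <= (1 + cmod l) * (1 + cmod z).
    have := cmodD z (- l); rewrite cmodN; have := mulr_ge0 cl cz; lra.
  have zl2 : cmod (z - l) ^+ 2 <= ((1 + cmod l) * (1 + cmod z)) ^+ 2.
    by rewrite ler_pXn2r ?nnegrE ?cmod_ge0// mulr_ge0; lra.
  have -> : c * ((cmod (z - l) * cmod (f z)) ^+ 2 * expR (-2 * phi (cmod z))) * ((1 + cmod z) `^ gamma) ^+ 2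
    = (c * X) * (cmod (z - l) ^+ 2 * ((1 + cmod z) `^ gamma) ^+ 2) by rewrite /X; ring.
  have -> : c * (1 + cmod l) ^+ 2 * X * (1 + cmod z) ^+ 2 = (c * X) * (((1 + cmod l) * (1 + cmod z)) ^+ 2 * 1) by ring.
  by apply: ler_wpM2l; [rewrite mulr_ge0// ltW|apply: ler_pM; rewrite ?sqr_ge0].
have fz z : z != l -> f z = 0.
  move=> zl; have := gSh z; rewrite h0 mulr0 => /eqP; rewrite mulf_eq0 subr_eq0 (negbTE zl).
  by move=> /eqP.
have h2 : (0 : R) < 2^-1 by rewrite invr_gt0.
have [d d0 Hd] := cdiff_cont (ff.1 l) h2.
have dl : l + (d / 2)%:C != l.
  rewrite -subr_eq0 addrC addKr -cmod_gt0 cmod_real normr_gt0 gt_eqF//; lra.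
have := Hd (l + (d / 2)%:C); rewrite fz// fl sub0r cmodN cmod1 addrC addKr cmod_real.
rewrite ger0_norm; last lra.
by move=> /(_ (ltac:(lra))); lra.
Qed.

End FockClass.

(** * Specialization to a Fock weight *)

(** The infimum is +oo for a set with at most one point, where any gap will do. *)
Lemma separated_gap (R : realType) (rho : R[i] -> R) (L : set R[i]) : (forall z, 0 < rho z) ->
  (0 < ereal_inf [set e : \bar R | exists z w : R[i],
     [/\ L z, L w, z <> w & e = (cmod (z - w) / Num.min (rho z) (rho w))%:E]])%E ->
  exists2 delta : R, 0 < delta & forall l m, L l -> L m -> l <> m ->
    delta * Num.min (rho l) (rho m) <= cmod (l - m).
Proof.
move=> rho0; set E := (X in ereal_inf X) => E0.
have [delta d0 dE] : exists2 delta : R, 0 < delta & (delta%:E <= ereal_inf E)%E.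
  case: (ereal_inf E) E0 => [d|_|//]; first by rewrite lte_fin => d0; exists d.
  by exists 1; rewrite ?leey.
exists delta => // l m Ll Lm lm; have Elm : E (cmod (l - m) / Num.min (rho l) (rho m))%:E by exists l, m.
have := le_trans dE (ereal_inf_lbound Elm).
by rewrite lee_fin ler_pdivlMr// lt_min !rho0.
Qed.

Lemma asymp_setT (R : realType) (T : Type) (g h : T -> R) : asymp_on [set: T] g h ->
  exists2 c : R, 0 < c & forall x, g x <= c * h x /\ h x <= c * g x.
Proof. by move=> [c c0 H]; exists c => // x; exact: H. Qed.

Theorem theorem3 (R : realType) (phi : R -> R) (hphi : fock_weight phi)
    (gamma : R) (S : R[i] -> R[i]) (hS : class_S phi gamma S) :
  (uniqueness_set phi (zero_set S) <-> gamma <= 1) /\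
  (weak_interpolation_set phi (zero_set S) <-> 0 < gamma).
Proof.
have C2phi := weight_C2 hphi.
have rho_uc := rho_ucont C2phi (weight_lap_gt0 hphi).
have phi_uc := phi_ucont C2phi.
have phi_ge z : phi 0 <= phi (cmod z) := fw_increasing hphi (lexx 0) (cmod_ge0 z).
have phi_lap z : has_lap (radial phi) z ((Defs.rho phi z) ^- 2).
  rewrite (rhoV2 (weight_lap_gt0 hphi) z); exact: has_lap_laplacian.
have [Sent sep Sasymp] := hS.
have Sbound := asymp_setT Sasymp.
have gap := separated_gap (rho_pos hphi) sep.
split.
- exact: (uniqueness_iff (rho_pos hphi) (rho_slow hphi) rho_uc phi_uc phi_ge phi_lap Sent Sbound gap).
- exact: (weak_interpolation_iff (rho_pos hphi) (rho_slow hphi) rho_uc phi_uc phi_ge phi_lap Sent Sbound gap).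
Qed.
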